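(* Let $k\ge1$, let $a_0,a_1,a_2\in\mathbb{R}$ be constants with $a_2<0$, let $Lu=\sum_{m=0}^2a_m\Delta^mu$, and set $M=a_0-\frac{a_1^2}{4a_2}$. Consider $u_t=Lu$ on a rectangle $\Omega\subset\mathbb{R}^2$, $t>0$, with $u(\cdot,0)=u_0$ and periodic boundary conditions. Let $(u_h,q_h)(\cdot,t)\in Q_h\times Q_h$ be the solution of the semi-discrete DG scheme $$(u_{ht},\phi)=-\tilde A(q_h,\phi)+M(u_h,\phi),\qquad (q_h,\psi)=\tilde A(u_h,\psi)\qquad\text{for all }\phi,\psi\in Q_h,$$ with $$\tilde A(w,v)=\sqrt{-a_2}\,A(w,v)+\frac{a_1}{2\sqrt{-a_2}}(w,v),$$ where $u_h(\cdot,0)$ is the $L^2$ projection of $u_0$ onto $Q_h$. Then $$\|u_h(\cdot,t)\|\le\|u_h(\cdot,0)\|e^{Mt}.$$ Assume moreover that the exact solution $u$ is smooth. Then $$\|u_h(\cdot,t)-u(\cdot,t)\|\le Ch^{k+1},\qquad 0\le t\le T,$$ where $C$ depends on $\sup_{t\in[0,T]}\|u_t(\cdot,t)\|_{k+1}$, $\sup_{t\in[0,T]}|u(\cdot,t)|_{k+3}$, $\sup_{t\in[0,T]}|u(\cdot,t)|_{k+1}$ and $T$, but is independent of $h$.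
   Context: $\Omega$ is a rectangle partitioned into rectangular cells $I_{i,j}=[x_{i-1/2},x_{i+1/2}]\times[y_{j-1/2},y_{j+1/2}]$, $1\le i\le N$, $1\le j\le M_y$ ($M_y$ being the number of cells in the $y$ direction), uniform with sizes $\Delta x=x_{i+1/2}-x_{i-1/2}$, $\Delta y=y_{j+1/2}-y_{j-1/2}$; $h=\max\{\Delta x,\Delta y\}$ is the mesh size. $Q_h=\{v\in L^2(\Omega): v|_{I_{i,j}}\in Q^k(I_{i,j})\}$, where $Q^k$ denotes tensor-product polynomials of degree at most $k$ in each variable. On a vertical interface $x=x_{i+1/2}$: $\{v\}=\frac12(v(x_{i+1/2}^-,y)+v(x_{i+1/2}^+,y))$, $[v]=v(x_{i+1/2}^+,y)-v(x_{i+1/2}^-,y)$, and analogously on horizontal interfaces $y=y_{j+1/2}$; traces from outside $\Omega$ on the boundary are taken by periodicity. $(\cdot,\cdot)$ and $\|\cdot\|$ are the $L^2(\Omega)$ inner product and norm; $\|\cdot\|_m$, $|\cdot|_m$ are the $H^m(\Omega)$ norm and seminorm. The bilinear form $A$ is $$A(w,v)=\sum_{i,j=1}^{N,M_y}\iint_{I_{i,j}}\nabla w\cdot\nabla v\,dxdy+\sum_{i,j=1}^{N,M_y}\int_{y_{j-1/2}}^{y_{j+1/2}}\big(\{w_x\}[v]+\{v_x\}[w]\big)_{x_{i+1/2}}dy+\sum_{i,j=1}^{N,M_y}\int_{x_{i-1/2}}^{x_{i+1/2}}\big(\{w_y\}[v]+\{v_y\}[w]\big)_{y_{j+1/2}}dx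 .$$ The constant $C$ may also depend on the fixed coefficients $a_0,a_1,a_2$. *)

(* Defs.v *)
From mathcomp Require Export all_boot all_order all_algebra.
From mathcomp Require Export all_classical all_reals all_analysis.

Set Implicit Arguments.
Unset Strict Implicit.
Unset Printing Implicit Defensive.

Export Order.TTheory GRing.Theory Num.Theory.
Export numFieldNormedType.Exports.

Local Open Scope classical_set_scope.
Local Open Scope ring_scope.

Record rect (R : realType) := Rect {
  xlo : R; xhi : R; ylo : R; yhi : R;
  xlo_lt : xlo < xhi;
  ylo_lt : ylo < yhi }.

Section PlaneCalculus.
Context {R : realType}.
Implicit Types (v : R -> R -> R) (Om : rect R).

Definition dx v : R -> R -> R := fun x y => derive1 (fun s => v s y) x.
Definition dy v : R -> R -> R := fun x y => derive1 (fun s => v x s) y.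

Definition lap v : R -> R -> R := fun x y => dx (dx v) x y + dy (dy v) x y.

Definition Lop (a0 a1 a2 : R) v : R -> R -> R :=
  fun x y => a0 * v x y + a1 * lap v x y + a2 * lap (lap v) x y.

Definition leb2 := ((@lebesgue_measure R) \x (@lebesgue_measure R))%E.

Definition int2 (xl xr yl yr : R) v : R :=
  (\int[leb2]_(z in [set` `[xl, xr]] `*` [set` `[yl, yr]]) v z.1 z.2)%R.

Definition int1 (l r : R) (f : R -> R) : R :=
  (\int[lebesgue_measure]_(s in [set` `[l, r]]) f s)%R.

Definition intOm Om v : R := int2 (xlo Om) (xhi Om) (ylo Om) (yhi Om) v.

Definition L2 Om v : Prop :=
  let D := [set` `[xlo Om, xhi Om]] `*` [set` `[ylo Om, yhi Om]] in
  measurable_fun D (fun z : R * R => v z.1 z.2) /\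
  leb2.-integrable D (fun z : R * R => ((v z.1 z.2) ^+ 2)%:E).

(* H^m(Omega) norm and seminorm, with classical partial derivatives: they are
   only applied to smooth functions. *)
Definition Hnorm Om (m : nat) v : R :=
  Num.sqrt (\sum_(a < m.+1) \sum_(b < m.+1 | (a + b <= m)%N)
     intOm Om (fun x y => (iter a dx (iter b dy v) x y) ^+ 2)).

Definition Hseminorm Om (m : nat) v : R :=
  Num.sqrt (\sum_(a < m.+1) \sum_(b < m.+1 | (a + b == m)%N)
     intOm Om (fun x y => (iter a dx (iter b dy v) x y) ^+ 2)).

End PlaneCalculus.

Section SpaceTime.
Context {R : realType}.
Variable T : R.
Implicit Types u : R -> R -> R -> R.

(* Time derivative relative to [0, T], hence one-sided at the end points. *)
Definition quot_t u (t x y : R) : R -> R :=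
  fun s => (u s x y - u t x y) / (s - t).

Definition derivable_t u (t x y : R) : Prop :=
  cvg (quot_t u t x y s @[s --> within [set` `[0, T]] t^']).

Definition dt u : R -> R -> R -> R := fun t x y =>
  lim (quot_t u t x y s @[s --> within [set` `[0, T]] t^']).

(* C^n regularity on [0, T] x R^2; arguments are ordered t, x, y. *)
Fixpoint Cn (n : nat) u : Prop :=
  {within [set p : R * R * R | 0 <= p.1.1 <= T],
     continuous (fun p : R * R * R => u p.1.1 p.1.2 p.2)} /\
  (if n is n'.+1 then
    [/\ (forall t x y, 0 <= t <= T ->
           [/\ derivable_t u t x y,
               derivable (fun s => u t s y) x 1 &
               derivable (fun s => u t x s) y 1]),
        Cn n' (dt u),
        Cn n' (fun t => dx (u t)) &
        Cn n' (fun t => dy (u t))]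
   else True).

Definition smooth u : Prop := forall n, Cn n u.

(* Periodic functions on Omega are represented by their periodic extension to
   the plane. *)
Definition periodic (Om : rect R) u : Prop :=
  forall t x y, 0 <= t <= T ->
    u t (x + (xhi Om - xlo Om)) y = u t x y /\
    u t x (y + (yhi Om - ylo Om)) = u t x y.

Definition exact_solution (Om : rect R) (a0 a1 a2 : R) (u0 : R -> R -> R) u :
    Prop :=
  [/\ periodic Om u,
      (forall x y, xlo Om <= x <= xhi Om -> ylo Om <= y <= yhi Om ->
         u 0 x y = u0 x y) &
      (forall t x y, 0 < t <= T -> dt u t x y = Lop a0 a1 a2 (u t) x y)].

End SpaceTime.

Section DG.
Context {R : realType}.
Variables (Om : rect R) (N My : nat).

Definition Dx : R := (xhi Om - xlo Om) / N%:R.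
Definition Dy : R := (yhi Om - ylo Om) / My%:R.
Definition meshsize : R := Num.max Dx Dy.

(* Cells are numbered from 0, so cell (i, j) is [xl i, xr i] x [yl j, yr j]. *)
Definition xl (i : 'I_N) : R := xlo Om + i%:R * Dx.
Definition xr (i : 'I_N) : R := xlo Om + i.+1%:R * Dx.
Definition yl (j : 'I_My) : R := ylo Om + j%:R * Dy.
Definition yr (j : 'I_My) : R := ylo Om + j.+1%:R * Dy.

(* A piecewise smooth function is given by its restrictions to the cells.  Each
   restriction carries an extension to the plane, so that the trace from
   inside a cell on one of its edges is the value of that cell's piece there;
   a function w on the whole plane is the family (fun _ _ => w). *)
Definition broken := 'I_N -> 'I_My -> R -> R -> R.
Implicit Types v w : broken.

Definition bdx v : broken := fun i j => dx (v i j).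
Definition bdy v : broken := fun i j => dy (v i j).

(* Tensor-product polynomials of degree at most k in each variable. *)
Definition Qpoly (k : nat) (f : R -> R -> R) : Prop :=
  exists c : 'M[R]_k.+1, forall x y,
    f x y = \sum_(a < k.+1) \sum_(b < k.+1) c a b * x ^+ a * y ^+ b.

Definition Qh (k : nat) v : Prop := forall i j, Qpoly k (v i j).

Definition cellint (i : 'I_N) (j : 'I_My) (f : R -> R -> R) : R :=
  int2 (xl i) (xr i) (yl j) (yr j) f.

Definition ip w v : R :=
  \sum_(i < N) \sum_(j < My) cellint i j (fun x y => w i j x y * v i j x y).

Definition bnorm v : R := Num.sqrt (ip v v).

(* Average and jump on the right edge of cell (i, j), as functions of y, and on
   its upper edge, as functions of x.  ordS is the cyclic successor, so on the
   boundary of Omega the outer trace is the periodic one. *)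
Definition avgx v i j : R -> R := fun y =>
  2^-1 * (v i j (xr i) y + v (ordS i) j (xl (ordS i)) y).
Definition jumpx v i j : R -> R := fun y =>
  v (ordS i) j (xl (ordS i)) y - v i j (xr i) y.
Definition avgy v i j : R -> R := fun x =>
  2^-1 * (v i j x (yr j) + v i (ordS j) x (yl (ordS j))).
Definition jumpy v i j : R -> R := fun x =>
  v i (ordS j) x (yl (ordS j)) - v i j x (yr j).

Definition Aform w v : R :=
  \sum_(i < N) \sum_(j < My) cellint i j (fun x y =>
      bdx w i j x y * bdx v i j x y + bdy w i j x y * bdy v i j x y)
  + \sum_(i < N) \sum_(j < My) int1 (yl j) (yr j) (fun y =>
      avgx (bdx w) i j y * jumpx v i j y + avgx (bdx v) i j y * jumpx w i j y)
  + \sum_(i < N) \sum_(j < My) int1 (xl i) (xr i) (fun x =>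
      avgy (bdy w) i j x * jumpy v i j x + avgy (bdy v) i j x * jumpy w i j x).

Definition Atilde (a1 a2 : R) w v : R :=
  Num.sqrt (- a2) * Aform w v + a1 / (2 * Num.sqrt (- a2)) * ip w v.

Definition L2projection (k : nat) (u0 : R -> R -> R) v : Prop :=
  Qh k v /\ forall phi, Qh k phi -> ip v phi = ip (fun _ _ => u0) phi.

Record dg_solution (k : nat) (a0 a1 a2 : R) (u0 : R -> R -> R)
    (uh qh : R -> broken) : Prop := DGSolution {
  dg_init : L2projection k u0 (uh 0);
  dg_init_cont : forall i j x y, uh s i j x y @[s --> 0^'+] --> uh 0 i j x y;
  dg_uh : forall t, 0 < t -> Qh k (uh t);
  dg_qh : forall t, 0 < t -> Qh k (qh t);
  dg_derivable : forall t i j x y, 0 < t ->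
    derivable (fun s => uh s i j x y) t 1;
  dg_eq1 : forall t phi, 0 < t -> Qh k phi ->
    ip (fun i j x y => derive1 (fun s => uh s i j x y) t) phi =
    - Atilde a1 a2 (qh t) phi + (a0 - a1 ^+ 2 / (4 * a2)) * ip (uh t) phi;
  dg_eq2 : forall t psi, 0 < t -> Qh k psi ->
    ip (qh t) psi = Atilde a1 a2 (uh t) psi }.

End DG.

(* Main.v *)
(** With [s = sqrt (- a2)], [b = a1 / (2 s)] and [B = - s Delta + b], the
    operator is [L = - B^2 + M], and [Atilde] is the symmetric DG form of [B].
    Testing with [u_h] and [q_h] gives
    [d/dt ||u_h||^2 / 2 = - ||q_h||^2 + M ||u_h||^2], which is the stability bound.

    For the error, [u] and [q = B u] are compared with a tensor-product
    interpolant [P].  Its one-dimensional factor reproduces degree [k]; on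
    polynomials of degree [k + 2] its error is orthogonal to degree [k - 2] and
    its average trace and average derivative vanish at the interfaces.  Summing by
    parts, the form therefore sees only derivatives of order [k + 3]:
    [|A (P u, v) + (Delta u, v)| <= C h^(k+1) ||v||], with no inverse power of [h]
    and no stability of [A].  These consistency errors enter the energy identity
    of [(u_h - P u, q_h - P q)] and are absorbed by [||q_h - P q||^2] and by
    Gronwall's inequality.  Since [P] samples point values, it commutes with the
    time derivative.

    The consistency error of [q] involves derivatives of [u] of order [k + 5].
    Periodicity bounds [g_xx] and [g_yy] by [Delta g] in [L^2], so that they
    reduce to [Delta^2 u = (u_t - a0 u - a1 Delta u) / a2]. *)
Require Import Defs.
From mathcomp Require Import ring lra.

Set Implicit Arguments.
Unset Strict Implicit.
Unset Printing Implicit Defensive.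

Local Open Scope classical_set_scope.
Local Open Scope ring_scope.

(** * Continuous functions and their integrals *)

(** The form has no penalty term and is not shown to be coercive, so nothing controls the jumps of a
    test function, and consistency errors must be paired with [v] in L^2 alone. The form scales like
    h^(-2) on a reference cell; order k + 1 thus asks for a residual that vanishes on every
    polynomial of degree k + 2, although the discrete space only reproduces degree k. Prescribing
    interface averages globally would couple all cells of a row in one cyclic system. Here the
    conditions are met cell by cell: on degree k + 1 the error is the same multiple of one
    polynomial in all cells, so antiperiodicity of that polynomial on [0, 1] is enough; on degree k
    + 2 the change of the coefficient of degree k + 1 between neighbours is compensated in the
    boundary data of a second polynomial. For P = Px Py, the horizontal residual of P u is that of
    Px u plus that of Px (Py u - u). The second function is already small of order k + 1, so a
    residual vanishing on degree 1 suffices for it. The negative powers of the mesh sizes cancel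
    within each direction, hence no bound on their ratio is assumed. *)

Definition cont2 {R : realType} (F : R -> R -> R) :=
  continuous (fun z : R * R => F z.1 z.2).

Section Continuity.
Context {R : realType} {T : topologicalType}.
Implicit Types f g : T -> R.

Lemma cont_cst (c : R) : continuous (fun _ : T => c).
Proof. by move=> x; exact: cvg_cst. Qed.

Lemma contD f g : continuous f -> continuous g ->
  continuous (fun x => f x + g x).
Proof. by move=> cf cg x; exact: (cvgD (cf x) (cg x)). Qed.

Lemma contN f : continuous f -> continuous (fun x => - f x).
Proof. by move=> cf x; exact: (cvgN (cf x)). Qed.

Lemma contB f g : continuous f -> continuous g ->
  continuous (fun x => f x - g x).
Proof. by move=> cf cg x; exact: (cvgB (cf x) (cg x)). Qed.

Lemma contM f g : continuous f -> continuous g ->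
  continuous (fun x => f x * g x).
Proof. by move=> cf cg x; exact: (cvgM (cf x) (cg x)). Qed.

Lemma contX f n : continuous f -> continuous (fun x => f x ^+ n).
Proof.
move=> cf; elim: n => [|n IHn]; first exact: cont_cst.
have -> : (fun x => f x ^+ n.+1) = (fun x => f x * f x ^+ n).
  by apply/funext => x; rewrite exprS.
exact: contM.
Qed.

Lemma cont_sum (I : Type) (r : seq I) (P : pred I) (F : I -> T -> R) :
  (forall i, P i -> continuous (F i)) ->
  continuous (fun x => \sum_(i <- r | P i) F i x).
Proof.
move=> cF; elim: r => [|i r IHr].
  have -> : (fun x => \sum_(i <- [::] | P i) F i x) = fun=> 0.
    by apply/funext => x; rewrite big_nil.
  exact: cont_cst.
have -> : (fun x => \sum_(i <- i :: r | P i) F i x) =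
    (fun x => (if P i then F i x else 0) + \sum_(i <- r | P i) F i x).
  by apply/funext => x; rewrite big_cons; case: ifP; rewrite ?add0r.
apply: contD => //; move: (cF i); case: (P i) => [|_]; first exact.
exact: cont_cst.
Qed.

Lemma cont_comp f (g : R -> R) : continuous g -> continuous f ->
  continuous (fun x => g (f x)).
Proof. by move=> cg cf x; apply: continuous_comp; [exact: cf|exact: cg]. Qed.

Lemma cont_comp2 (F : R -> R -> R) f g :
  cont2 F -> continuous f -> continuous g ->
  continuous (fun x => F (f x) (g x)).
Proof.
move=> cF cf cg x.
apply: (@continuous_comp _ _ _ (fun x => (f x, g x)) (fun z => F z.1 z.2)).
  exact: (cvg_pair (cf x) (cg x)).
exact: cF.
Qed.

End Continuity.

Lemma cont_id {R : realType} : continuous (fun x : R => x).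
Proof. by move=> x; exact: cvg_id. Qed.

Lemma cont_fst {R : realType} : continuous (fun z : R * R => z.1).
Proof. by move=> x; exact: cvg_fst. Qed.

Lemma cont_snd {R : realType} : continuous (fun z : R * R => z.2).
Proof. by move=> x; exact: cvg_snd. Qed.

Lemma cont_slice1 {R : realType} (F : R -> R -> R) (y : R) : cont2 F ->
  continuous (fun x => F x y).
Proof. by move=> cF; apply: (cont_comp2 cF cont_id); exact: cont_cst. Qed.

Lemma cont_slice2 {R : realType} (F : R -> R -> R) (x : R) : cont2 F ->
  continuous (fun y => F x y).
Proof. by move=> cF; apply: (cont_comp2 cF _ cont_id); exact: cont_cst. Qed.

Lemma cont_horner {R : realType} {T : topologicalType} (p : {poly R})
  (f : T -> R) : continuous f -> continuous (fun x => p.[f x]).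
Proof. by move=> cf; apply: (cont_comp _ cf); exact: continuous_horner. Qed.

(** Purely syntactic: atoms are looked for in the context as [cont2] or [continuous] hypotheses, so
    many proofs instantiate an indexed family just before calling [cont]. A slice in one variable is
    reduced to joint continuity. *)
Ltac cont_step := match goal with
  | H : cont2 ?F |- cont2 ?G => constr_eq F G; exact H
  | H : continuous ?f |- continuous ?g => constr_eq f g; exact H
  | |- cont2 (fun x => _) => rewrite /cont2; cbv beta
  | |- continuous (fun _ => ?c) => exact (@cont_cst _ _ c)
  | |- continuous (fun x => x) => exact cont_id
  | |- continuous (fun x => x.1) => exact cont_fst
  | |- continuous (fun x => x.2) => exact cont_snd
  | |- continuous fst => exact cont_fst
  | |- continuous snd => exact cont_snd
  | |- continuous (fun x => (@?f x - @?g x)%R) => apply (@contB _ _ f g)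
  | |- continuous (fun x => (@?f x + @?g x)%R) => apply (@contD _ _ f g)
  | |- continuous (fun x => (- (@?f x))%R) => apply (@contN _ _ f)
  | |- continuous (fun x => (@?f x * @?g x)%R) => apply (@contM _ _ f g)
  | |- continuous (fun x => (@?f x ^+ _)%R) => apply (@contX _ _ f)
  | |- continuous (fun x => horner ?p (@?f x)) => apply (@cont_horner _ _ p f)
  | |- continuous (fun x => bigop _ _ _) =>
      apply: cont_sum; let i := fresh "i" in let h := fresh "h" in intros i h
  | |- continuous (horner ?p) => exact (@continuous_horner _ p)
  | |- continuous ( *%R ?c) => exact (@contM _ _ _ _ (@cont_cst _ _ c) cont_id)
  | |- continuous ( +%R ?c) => exact (@contD _ _ _ _ (@cont_cst _ _ c) cont_id)
  | |- continuous (fun x => ?F x.1 x.2) => change (cont2 F); solve [auto]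
  | |- continuous (fun x => ?F x) => solve [auto]
  | |- cont2 _ => solve [auto]
  | |- continuous (fun x => ?F x ?y) => apply (@cont_slice1 _ F y)
  | |- continuous (fun x => ?F ?y x) => apply (@cont_slice2 _ F y)
  | |- continuous (?F ?y) => apply (@cont_slice2 _ F y)
  | |- continuous (fun x => ?F (@?p x) (@?q x)) =>
      apply (@cont_comp2 _ _ F p q)
  | |- continuous (fun x => ?F (@?p x)) => apply (@cont_comp _ _ p F)
  end.
Ltac cont := repeat cont_step.

Section OneDimensionalIntegral.
Context {R : realType}.
Notation mu := (@lebesgue_measure R).
Implicit Types (f g F G : R -> R) (a b c : R).

Lemma itv_integrable f a b : continuous f ->
  mu.-integrable [set` `[a, b]] (EFin \o f).
Proof.
move=> cf; apply: continuous_compact_integrable; first exact: segment_compact.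
exact: continuous_subspaceT.
Qed.

Lemma int1D f g a b : continuous f -> continuous g ->
  int1 a b (fun x => f x + g x) = int1 a b f + int1 a b g.
Proof.
by move=> cf cg; rewrite /int1 RintegralD//; exact: itv_integrable.
Qed.

Lemma int1Z f a b k : continuous f ->
  int1 a b (fun x => k * f x) = k * int1 a b f.
Proof. by move=> cf; rewrite /int1 RintegralZl//; exact: itv_integrable. Qed.

Lemma int1N f a b : continuous f ->
  int1 a b (fun x => - f x) = - int1 a b f.
Proof.
move=> cf; rewrite -mulN1r -int1Z//; congr int1.
by apply/funext => x; rewrite mulN1r.
Qed.

Lemma eq_int1 f g a b : (forall x, a <= x <= b -> f x = g x) ->
  int1 a b f = int1 a b g.
Proof.
move=> fg; apply: eq_Rintegral => x; rewrite inE/= in_itv/= => xab.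
exact: fg.
Qed.

Lemma int1_0 a b : int1 a b (fun=> 0) = 0 :> R.
Proof. by rewrite /int1 Rintegral_cst//= mul0r. Qed.

Lemma int1_sum (I : Type) (r : seq I) (P : pred I) (F : I -> R -> R) a b :
  (forall i, continuous (F i)) ->
  int1 a b (fun x => \sum_(i <- r | P i) F i x) =
  \sum_(i <- r | P i) int1 a b (F i).
Proof.
move=> cF; elim: r => [|i r IHr].
  rewrite big_nil -[RHS](int1_0 a b); apply: eq_int1 => x _.
  by rewrite big_nil.
rewrite big_cons; case: ifPn => Pi; rewrite -IHr.
  rewrite -int1D//; last by cont.
  by apply: eq_int1 => x _; rewrite big_cons Pi.
by apply: eq_int1 => x _; rewrite big_cons (negbTE Pi).
Qed.

Lemma int1_le f g a b : continuous f -> continuous g ->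
  (forall x, a <= x <= b -> f x <= g x) -> int1 a b f <= int1 a b g.
Proof.
move=> cf cg fg; by apply: le_Rintegral => //; exact: itv_integrable.
Qed.

Lemma int1_ge0 f a b : (forall x, a <= x <= b -> 0 <= f x) -> 0 <= int1 a b f.
Proof. by move=> f0; apply: Rintegral_ge0 => x; exact: f0. Qed.

Lemma int1_norm f g a b : continuous f -> continuous g ->
  (forall x, a <= x <= b -> `|f x| <= g x) -> `|int1 a b f| <= int1 a b g.
Proof.
move=> cf cg fg; rewrite ler_norml -int1N//; apply/andP; split.
  by apply: int1_le => //; [cont|move=> x /fg; rewrite ler_norml => /andP[]].
by apply: int1_le => // x /fg; rewrite ler_norml => /andP[].
Qed.

Lemma int1_cst k a b : a <= b -> int1 a b (fun=> k) = k * (b - a).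
Proof.
rewrite /int1 Rintegral_cst//= lebesgue_measure_itv/= lte_fin.
by rewrite le_eqVlt => /predU1P[->|->]; rewrite ?ltxx ?subrr.
Qed.

Lemma int1_set1 f a : int1 a a f = 0.
Proof. by rewrite /int1 set_itv1 Rintegral_set1. Qed.

Lemma int1_ftc F f a b : a <= b -> (forall x : R, is_derive x (1 : R) F (f x)) ->
  continuous f -> int1 a b f = F b - F a.
Proof.
move=> + dF cf; rewrite le_eqVlt => /predU1P[->|ab].
  by rewrite /int1 set_itv1 Rintegral_set1 subrr.
have cF : continuous F.
  move=> x; apply: differentiable_continuous; apply/derivable1_diffP.
  by have [] := dF x.
rewrite /int1 /Rintegral (@continuous_FTC2 _ f F a b)//.
- exact: continuous_subspaceT.
- split => [x _||].
  + by have [] := dF x.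
  + exact/cvg_at_right_filter/cF.
  + exact/cvg_at_left_filter/cF.
- by move=> x _; rewrite derive1E; have [_ ->] := dF x.
Qed.

Lemma int1_chasles f a b c : continuous f -> a <= b -> b <= c ->
  int1 a c f = int1 a b f + int1 b c f.
Proof.
move=> cf ab bc; apply/eqP; rewrite addrC -subr_eq; apply/eqP.
have := @Rintegral_itvB R f (BLeft a) (BRight c) b; rewrite /int1 => -> //.
  rewrite Rintegral_itv_obnd_cbnd//.
  apply: (@integrableS _ _ _ mu [set` `[b, c]]) => //; last exact: itv_integrable.
  by apply: subset_itvr; rewrite bnd_simp.
exact: itv_integrable.
Qed.

End OneDimensionalIntegral.

Lemma is_derive_affine {R : realType} (a h x : R) :
  is_derive x (1 : R) (fun s : R => a + h * s) h.
Proof.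
have := is_derive_poly (a%:P + h *: 'X) x.
rewrite derivD derivC derivZ derivX add0r alg_polyC hornerC.
by congr (is_derive _ _ _ _); apply/funext => s; rewrite !hornerE.
Qed.

Section AffineSubstitution.
Context {R : realType}.
Notation mu := (@lebesgue_measure R).
Implicit Types (f g F G : R -> R) (a b c : R).

Lemma int1_affine f a h : continuous f -> 0 < h ->
  int1 a (a + h) f = h * int1 0 1 (fun s => f (a + h * s)).
Proof.
move=> cf h0; pose F (s : R) : R := a + h * s.
have dF x : is_derive (x : R) (1 : R) F h by exact: is_derive_affine.
have F' : derive1 F = cst h.
  by apply/funext => x; rewrite derive1E; have [_ ->] := dF x.
have cF : continuous F by rewrite /F; cont.
rewrite -int1Z; last by cont.
have -> : a = F 0 by rewrite /F mulr0 addr0.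
have -> : F 0 + h = F 1 by rewrite /F mulr0 addr0 mulr1.
rewrite /int1 /Rintegral (@integration_by_substitution_increasing _ F f 0 1)//.
- congr fine; apply: eq_integral => x _; rewrite F' /= /F mulr0 addr0.
  by rewrite mulrC.
- by move=> x y _ _ xy; rewrite /F ltrD2l ltr_pM2l.
- by move=> x _; rewrite F'; exact: cvg_cst.
- by rewrite F'; exact: is_cvg_cst.
- by rewrite F'; exact: is_cvg_cst.
- split => [x _||].
  + by have [] := dF x.
  + exact/cvg_at_right_filter/cF.
  + exact/cvg_at_left_filter/cF.
- exact: continuous_subspaceT.
Qed.

Lemma int1_shift f a b c : continuous f -> a < b ->
  int1 (a + c) (b + c) f = int1 a b (fun s => f (s + c)).
Proof.
move=> cf ab; have h0 : 0 < b - a by rewrite subr_gt0.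
have -> : b + c = (a + c) + (b - a) by lra.
have cfc : continuous (fun s => f (s + c)) by cont.
have eb : b = a + (b - a) by lra.
rewrite int1_affine// [X in _ = int1 a X _]eb int1_affine//.
congr (_ * _); apply: eq_int1 => x _; congr f; lra.
Qed.

(** The integral of [(f + l * g) ^+ 2] is a nonnegative quadratic polynomial in [l], evaluated at
    its minimum [- A / Q]. If [Q] vanishes it is affine in [l], and a nonzero slope would make it
    negative somewhere. *)
Lemma int1_CS f g a b : continuous f -> continuous g ->
  int1 a b (fun x => f x * g x) ^+ 2 <=
  int1 a b (fun x => f x ^+ 2) * int1 a b (fun x => g x ^+ 2).
Proof.
move=> cf cg.
set A := int1 a b _; set P := int1 a b _; set Q := int1 a b _.
have H l : 0 <= P + (2 * l) * A + l ^+ 2 * Q.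
  have -> : P + (2 * l) * A + l ^+ 2 * Q =
      int1 a b (fun x => (f x + l * g x) ^+ 2).
    rewrite /A /P /Q -!int1Z -?int1D; try by cont.
    by apply: eq_int1 => x _; ring.
  by apply: int1_ge0 => x _; exact: sqr_ge0.
have Q0 : 0 <= Q by apply: int1_ge0 => x _; exact: sqr_ge0.
move: Q0; rewrite le_eqVlt => /predU1P[Q0|Q0].
  have [->|A0] := eqVneq A 0; first by rewrite -Q0 mulr0 expr0n.
  have := H (- (P + 1) / (2 * A)); rewrite -Q0 mulr0 addr0.
  have -> : P + 2 * (- (P + 1) / (2 * A)) * A = - 1 by field.
  by lra.
have := H (- A / Q).
have -> : P + 2 * (- A / Q) * A + (- A / Q) ^+ 2 * Q = (P * Q - A ^+ 2) / Q.
  by field; exact: lt0r_neq0.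
by rewrite pmulr_lge0 ?invr_gt0// subr_ge0.
Qed.

End AffineSubstitution.

(** * Integrals over rectangles *)

Section ProductIntegral.
Context {R : realType}.
Notation mu := (@lebesgue_measure R).
Implicit Types (F : R -> R -> R) (a b c d : R).

(** Measurability refers to the product sigma-algebra, which is generated by rectangles: an open set
    is the union of the rational open rectangles that it contains, and these are countably many. *)
Lemma open_measurable2 (A : set (R * R)) : open A ->
  measurable (A : set (measurableTypeR R * measurableTypeR R)).
Proof.
move=> oA; pose Q (q : rat * rat * (rat * rat)) : set (R * R) :=
  [set` `]ratr q.1.1, ratr q.1.2[] `*` [set` `]ratr q.2.1, ratr q.2.2[].
pose B q := if pselect (Q q `<=` A) is left _ then Q q else set0.
have -> : A = \bigcup_q B q.
  apply/seteqP; split => [[x y] Axy|z [q _]]; last first.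
    by rewrite /B; case: pselect => // QA /QA.
  have /nbhs_ballP[/= e e0 eA] : nbhs (x, y) A by apply: open_nbhs_nbhs.
  have rat_near (t : R) : exists q : rat * rat, [/\ ratr q.1 < t,
      t < ratr q.2 & forall s, ratr q.1 < s < ratr q.2 -> ball t e s].
    have [p] := @rat_in_itvoo R (t - e) t (ltac:(rewrite ltrBlDr ltrDl//)).
    have [q] := @rat_in_itvoo R t (t + e) (ltac:(rewrite ltrDl//)).
    rewrite !in_itv/= => /andP[tq qe] /andP[ep pt]; exists (p, q); split => //.
    move=> s /= /andP[ps sq].
    by rewrite /ball /= ltr_distlC; apply/andP; split; lra.
  have [[p1 p2] /= [xp1 xp2 px]] := rat_near x.
  have [[q1 q2] /= [yq1 yq2 qy]] := rat_near y.
  exists ((p1, p2), (q1, q2)) => //; rewrite /B; case: pselect => [_|].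
    by split; rewrite /= in_itv/=; apply/andP.
  case=> -[s t] [/=]; rewrite !in_itv/= => /px xs /qy yt.
  by apply: eA; split.
apply: countable_bigcupT_measurable => [|q]; first exact: countableP.
rewrite /B; case: pselect => // _.
by apply: measurableX; exact: measurable_itv.
Qed.

Lemma cont2_measurable F : cont2 F ->
  measurable_fun [set: measurableTypeR R * measurableTypeR R]
    (fun z => F z.1 z.2 : measurableTypeR R).
Proof.
move=> /continuousP cF; apply: (measurability _ (measurable_realfun.RGenOpens.measurableE R)).
move=> _ [_ [a [b ->] <-]]; rewrite setTI.
apply: open_measurable2; apply: cF; exact: interval_open.
Qed.

Lemma cont2_bounded F a b c d : cont2 F ->
  exists M : R, forall x y, a <= x <= b -> c <= y <= d -> `|F x y| <= M.
Proof.
move=> cF; pose K := [set` `[a, b]] `*` [set` `[c, d]] : set (R * R).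
have cK : compact K by apply: compact_setX; exact: segment_compact.
have /compact_bounded[M [_ HM]] :
    compact [set (F z.1 z.2 : R^o) | z in K].
  apply: (continuous_compact _ cK).
  by apply: continuous_subspaceT; exact: cF.
exists (M + 1) => x y xab ycd; apply: (HM (M + 1)); first by rewrite ltrDl.
by exists (x, y).
Qed.

Lemma cont2_integrable F a b c d : cont2 F ->
  (leb2 (R := R)).-integrable ([set` `[a, b]] `*` [set` `[c, d]])
    (fun z => (F z.1 z.2)%:E).
Proof.
move=> cF; apply: (@measurable_bounded_integrable _ _ R leb2 (fun z => F z.1 z.2)).
- by apply: measurableX; exact: measurable_itv.
- rewrite [X in (X < _)%E](_ : _ =
      (mu [set` `[a, b]] * mu [set` `[c, d]])%E); last first.
    by apply: product_measure1E; exact: measurable_itv.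
  rewrite !lebesgue_measure_itv/=.
  by case: ifP; case: ifP; rewrite ?mule0 ?mul0e ?ltry.
- by apply: measurable_funTS; exact: cont2_measurable.
- have [M HM] := @cont2_bounded F a b c d cF.
  exists M; split; first exact: num_real.
  by move=> N MN z [/= z1 z2]; apply: (le_trans _ (ltW MN)); exact: HM.
Qed.

(** Dominated convergence near [x]: on the compact strip of half-width 1 the integrand is bounded by
    a constant. *)
Lemma cont_int1 F a b : cont2 F -> continuous (fun x => int1 a b (F x)).
Proof.
move=> cF x.
have [M HM] := @cont2_bounded F (x - 1) (x + 1) a b cF.
have cFx y : continuous (F y) by cont.
apply: (@continuity_under_integral R _ _ mu F [set` `[a, b]] _ (x - 1) (x + 1)
  _ _ (fun=> M)) => //.
- by move=> y _; exact: itv_integrable.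
- by apply/aeW => y _ z _; have : continuous (F^~ y) by cont; exact.
- by apply: itv_integrable; cont.
- move=> y; rewrite /= in_itv/= => /andP[y1 y2]; apply/aeW => z zab.
  by apply: HM => //; rewrite !ltW.
- by rewrite inE/= in_itv/=; apply/andP; split; lra.
Qed.

Let fubiniF F a b c d : cont2 F ->
  (leb2 (R := R)).-integrable setT
    ((fun z => (F z.1 z.2)%:E) \_ ([set` `[a, b]] `*` [set` `[c, d]])).
Proof.
move=> cF; apply/integrable_restrict => //.
  by apply: measurableX; exact: measurable_itv.
by rewrite setTI; exact: cont2_integrable.
Qed.

Lemma int2E F a b c d : cont2 F ->
  int2 a b c d F = int1 c d (fun y => int1 a b (F^~ y)).
Proof.
move=> cF; rewrite /int2 /int1 {1}/Rintegral integral_mkcond.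
rewrite /leb2 -integral21_prod_meas1; last exact: fubiniF.
rewrite [in RHS]/Rintegral [in RHS]integral_mkcond; congr fine.
apply: eq_integral => y _; rewrite /fubini_G patchE; case: ifPn => ycd.
  rewrite /Rintegral fineK; last first.
    apply: integrable_fin_num => //; apply: (itv_integrable (f := F^~ y)).
    by cont.
  rewrite [RHS]integral_mkcond; apply: eq_integral => x _.
  by rewrite !patchE in_setX ycd andbT.
by rewrite integral0_eq// => x _; rewrite patchE in_setX (negbTE ycd) andbF.
Qed.

Lemma int2Er F a b c d : cont2 F ->
  int2 a b c d F = int1 a b (fun x => int1 c d (F x)).
Proof.
move=> cF; rewrite /int2 /int1 {1}/Rintegral integral_mkcond.
rewrite /leb2 -integral12_prod_meas1; last exact: fubiniF.
rewrite [in RHS]/Rintegral [in RHS]integral_mkcond; congr fine.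
apply: eq_integral => x _; rewrite /fubini_F patchE; case: ifPn => xab.
  rewrite /Rintegral fineK; last first.
    apply: integrable_fin_num => //; apply: (itv_integrable (f := F x)).
    by cont.
  rewrite [RHS]integral_mkcond; apply: eq_integral => y _.
  by rewrite !patchE in_setX xab.
by rewrite integral0_eq// => y _; rewrite patchE in_setX (negbTE xab).
Qed.

Lemma eq_int2 F G a b c d :
  (forall x y, a <= x <= b -> c <= y <= d -> F x y = G x y) ->
  int2 a b c d F = int2 a b c d G.
Proof.
move=> FG; apply: eq_Rintegral => -[x y]; rewrite inE/= !in_itv/= => -[? ?].
exact: FG.
Qed.

End ProductIntegral.

Ltac cont ::= repeat first
  [ match goal with
    | |- continuous (fun x => int1 ?a ?b (@?F x)) => apply (@cont_int1 _ F a b)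
    end
  | cont_step ].

(** * The reference projector *)

Section ReferencePolynomials.
Context {R : realType}.
Implicit Types (p q c r : {poly R}).

Definition pint p : R := int1 0 1 (fun x => p.[x]).

Lemma pintD p q : pint (p + q) = pint p + pint q.
Proof.
rewrite /pint -int1D; try by cont.
by apply: eq_int1 => x _; rewrite hornerD.
Qed.

Lemma pintZ a p : pint (a *: p) = a * pint p.
Proof.
rewrite /pint -int1Z; last by cont.
by apply: eq_int1 => x _; rewrite hornerZ.
Qed.

Lemma pintB p q : pint (p - q) = pint p - pint q.
Proof. by rewrite pintD -scaleN1r pintZ mulN1r. Qed.

Lemma pint0 : pint 0 = 0.
Proof. by rewrite -(scale0r 0) pintZ mul0r. Qed.

Lemma pint_deriv p : pint p^`() = p.[1] - p.[0].
Proof.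
by rewrite /pint (int1_ftc _ (fun x => is_derive_poly p x))//; cont.
Qed.

Lemma size_deriv_leq p n : (size p <= n.+1)%N -> (size p^`() <= n)%N.
Proof.
move=> sp; apply/leq_sizeP => j nj; rewrite coef_deriv.
by rewrite nth_default ?mul0rn// (leq_trans sp).
Qed.

Lemma deriv_eq0 p : p^`() = 0 -> p = p.[0]%:P.
Proof.
move=> p'0; apply/polyP => -[|i]; rewrite coefC/=.
  by rewrite horner_coef0.
have := congr1 (fun q : {poly R} => q`_i) p'0.
by rewrite coef_deriv coef0 => /eqP; rewrite mulrn_eq0/= => /eqP.
Qed.

Lemma poly_eq0_on01 p : (forall x, 0 <= x <= 1 -> p.[x] = 0) -> p = 0.
Proof.
move=> p0; pose f (i : nat) : R := i.+1%:R^-1.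
apply: (@roots_geq_poly_eq0 _ p (map f (iota 0 (size p)))).
- apply/allP => _ /mapP[i _ ->]; apply/rootP/p0; rewrite /f invr_ge0 ler0n/=.
  by rewrite invf_le1 ?ltr0n// ler1n.
- rewrite map_inj_uniq ?iota_uniq// => i j /invr_inj /eqP.
  by rewrite eqr_nat => /eqP[].
- by rewrite size_map size_iota.
Qed.

Definition prim p : {poly R} := \poly_(i < (size p).+1) (p`_i.-1 / i%:R).

Lemma deriv_prim p : (prim p)^`() = p.
Proof.
apply/polyP => i; rewrite coef_deriv coef_poly ltnS; case: ltnP => [ip|pi].
  rewrite /= -[LHS]mulr_natr divfK// pnatr_eq0//.
by rewrite mul0rn nth_default.
Qed.

(** A primitive of [p ^+ 2] is nondecreasing on [0, 1] with equal values at the ends, so it is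
    constant there, hence constant as a polynomial, and its derivative vanishes. *)
Lemma pint_sqr_eq0 p : pint (p ^+ 2) = 0 -> p = 0.
Proof.
move=> p0; suff : p ^+ 2 = 0 by move/eqP; rewrite sqrf_eq0 => /eqP.
rewrite -(deriv_prim (p ^+ 2)); set Q := prim _.
suff -> : Q = Q.[0]%:P by rewrite derivC.
apply/eqP; rewrite -subr_eq0; apply/eqP/poly_eq0_on01 => x /andP[x0 x1].
have E a b : a <= b -> int1 a b (fun t => (p ^+ 2).[t]) = Q.[b] - Q.[a].
  move=> ab; apply: (@int1_ftc _ (fun x => Q.[x])) => //; last by cont.
  by move=> t; rewrite -[X in X.[_]](deriv_prim (p ^+ 2)); exact: is_derive_poly.
have ge0 a b : 0 <= int1 a b (fun t => (p ^+ 2).[t]).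
  by apply: int1_ge0 => t _; rewrite horner_exp sqr_ge0.
rewrite hornerD hornerN hornerC; apply/eqP; rewrite -E// eq_le ge0 andbT.
have := int1_chasles (@continuous_horner _ (p ^+ 2)) x0 x1.
rewrite -[X in X = _]/(pint _) p0 => H.
by have := ge0 x 1; lra.
Qed.

(** Source and target both have dimension [n], so injectivity gives surjectivity. The construction
    of a polynomial with prescribed functionals is thereby reduced to a uniqueness proof. *)
Lemma lin_surj n (l : 'I_n -> {poly R} -> R) :
  (forall i a p q, l i (a *: p + q) = a * l i p + l i q) ->
  (forall c, (size c <= n)%N -> (forall i, l i c = 0) -> c = 0) ->
  forall d : 'I_n -> R, exists2 c : {poly R}, (size c <= n)%N & forall i, l i c = d i.
Proof.
move=> llin linj d.
have l0 i : l i 0 = 0.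
  by have := llin i (-1) 0 0; rewrite scaler0 addr0 => E; lra.
have lsum i (I : Type) (s : seq I) (a : I -> R) (P : I -> {poly R}) :
    l i (\sum_(x <- s) a x *: P x) = \sum_(x <- s) a x * l i (P x).
  elim: s => [|x s IHs]; first by rewrite !big_nil.
  by rewrite !big_cons llin IHs.
pose A : 'M[R]_n := \matrix_(i, j) l j 'X^i.
have lA (v : 'rV[R]_n) j : l j (rVpoly v) = (v *m A) 0 j.
  rewrite mxE /rVpoly poly_def lsum.
  by apply: eq_bigr => i _; rewrite mxE valK.
have Au : A \in unitmx.
  rewrite -row_free_unit -kermx_eq0; apply/eqP/row_matrixP => i.
  rewrite row0; apply: (can_inj rVpolyK); rewrite linear0.
  apply: linj => [|j]; first exact: size_poly.
  by rewrite lA -row_mul mulmx_ker row0 mxE.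
pose v : 'rV[R]_n := \row_j d j.
exists (rVpoly (v *m invmx A)) => [|i]; first exact: size_poly.
by rewrite lA mulmxKV// mxE.
Qed.

(** Riesz representation in finite dimension: [l] is the pairing with some [g], and Cauchy-Schwarz
    gives for [K] the squared norm of [g]. It serves to measure traces and derivatives of test
    functions by their L^2 norm. *)
Lemma lin_bounded n (l : {poly R} -> R) :
  (forall a p q, l (a *: p + q) = a * l p + l q) ->
  exists2 K : R, 0 <= K & forall c, (size c <= n)%N ->
    l c ^+ 2 <= K * int1 0 1 (fun x => c.[x] ^+ 2).
Proof.
move=> llin.
have [g sg gE] : exists2 g : {poly R}, (size g <= n)%N &
    forall i : 'I_n, pint (g * 'X^i) = l 'X^i.
  apply: (@lin_surj n (fun i g => pint (g * 'X^i))) => [i a p q|c sc c0].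
    by rewrite mulrDl pintD -scalerAl pintZ.
  (* A polynomial orthogonal to all monomials up to its own degree is orthogonal to itself. *)
  apply: pint_sqr_eq0; rewrite expr2 -{2}[c](coefK c) poly_def mulr_sumr.
  have : forall i, (i < size c)%N -> pint (c * (c`_i *: 'X^i)) = 0.
    move=> i ic; rewrite -scalerAr pintZ.
    by rewrite (c0 (Ordinal (leq_trans ic sc))) mulr0.
  elim: (size c) => [|m IHm] H; first by rewrite big_ord0 pint0.
  by rewrite big_ord_recr/= pintD H// addr0 IHm// => i im; apply/H/ltnW.
exists (int1 0 1 (fun x => g.[x] ^+ 2)) => [|c sc].
  by apply: int1_ge0 => x _; exact: sqr_ge0.
have -> : l c = pint (g * c).
  rewrite -[c](coefK c) poly_def mulr_sumr.
  have : forall i, (i < size c)%N -> pint (g * 'X^i) = l 'X^i.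
    by move=> i ic; rewrite (gE (Ordinal (leq_trans ic sc))).
  have l0 : l 0 = 0.
    by have := llin (-1) 0 0; rewrite scaler0 addr0 => E; lra.
  elim: (size c) => [|m IHm] H; first by rewrite !big_ord0 pint0.
  rewrite !big_ord_recr/= pintD -scalerAr pintZ H// addrC llin addrC IHm//.
  by move=> i im; apply/H/ltnW.
rewrite /pint (eq_int1 (g := fun x => g.[x] * c.[x])); last first.
  by move=> x _; rewrite hornerM.
by apply: int1_CS; cont.
Qed.

Lemma pint_parts p q :
  pint (p^`() * q) = p.[1] * q.[1] - p.[0] * q.[0] - pint (p * q^`()).
Proof.
apply/eqP; rewrite eq_sym subr_eq eq_sym -pintD -derivM pint_deriv.
by rewrite !hornerM.
Qed.

(* Uniqueness: c'' is orthogonal to c, so that the integral of c' ^+ 2 is the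
   boundary term c(1) c'(1) - c(0) c'(0), which antiperiodicity kills. *)
Lemma antiperiodic_projection k p (a b : R) : (1 <= k)%N ->
  exists2 c : {poly R}, (size c <= k.+1)%N &
    [/\ forall r, (size r <= k.-1)%N -> pint ((p - c) * r) = 0,
        (p - c).[1] + (p - c).[0] = a &
        (p - c)^`().[1] + (p - c)^`().[0] = b].
Proof.
case: k => // k _.
(* [k] now stands for its predecessor: [k] moments and two interface conditions make up the
   dimension [k.+2]. *)
pose l (i : 'I_k.+2) c : R := if (i < k)%N then pint (c * 'X^i)
  else if i == k :> nat then c.[1] + c.[0] else c^`().[1] + c^`().[0].
have llin i u v w : l i (u *: v + w) = u * l i v + l i w.
  rewrite /l; case: ifP => _; last case: ifP => _.
  - by rewrite mulrDl pintD -scalerAl pintZ.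
  - by rewrite !hornerD !hornerZ; ring.
  - by rewrite derivD derivZ !hornerD !hornerZ; ring.
have orth c : (forall i, l i c = 0) -> forall r, (size r <= k)%N ->
    pint (c * r) = 0.
  move=> c0 r sr; rewrite -[r](coefK r) poly_def mulr_sumr.
  have : forall i, (i < size r)%N -> pint (c * (r`_i *: 'X^i)) = 0.
    move=> i ir; rewrite -scalerAr pintZ; have ik := leq_trans ir sr.
    have := c0 (Ordinal (leq_trans ik (leqW (leqnSn k)))).
    by rewrite /l/= ik => ->; rewrite mulr0.
  elim: (size r) => [|m IHm] H; first by rewrite big_ord0 pint0.
  by rewrite big_ord_recr/= pintD H// addr0 IHm// => i im; apply/H/ltnW.
have [|c sc cE] := @lin_surj k.+2 l llin _ (fun i =>
    if (i < k)%N then pint (p * 'X^i)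
    else if i == k :> nat then p.[1] + p.[0] - a
    else p^`().[1] + p^`().[0] - b).
  move=> c sc c0.
  have v0 : c.[1] = - c.[0].
    have := c0 (Ordinal (leqnSn k.+1)).
    by rewrite /l/= ltnn eqxx => /eqP; rewrite addr_eq0 => /eqP.
  have d0 : c^`().[1] = - c^`().[0].
    have := c0 (Ordinal (leqnn k.+2)); rewrite /l/= ltnNge leqnSn/=.
    by rewrite gtn_eqF// => /eqP; rewrite addr_eq0 => /eqP.
  have c'0 : c^`() = 0.
    apply: pint_sqr_eq0; rewrite expr2 pint_parts v0 d0 orth//; first by ring.
    by do 2 apply: size_deriv_leq.
  have c0C := deriv_eq0 c'0; move: v0; rewrite c0C !hornerC => v0.
  by have -> : c.[0] = 0 by lra.
exists c => //; split.
- move=> r sr; have -> : (p - c) * r = p * r - c * r by rewrite mulrBl.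
  rewrite pintB; apply/eqP; rewrite subr_eq0 -[r](coefK r) poly_def !mulr_sumr.
  have : forall i, (i < size r)%N ->
      pint (p * (r`_i *: 'X^i)) = pint (c * (r`_i *: 'X^i)).
    move=> i ir; rewrite -!scalerAr !pintZ; have ik := leq_trans ir sr.
    have := cE (Ordinal (leq_trans ik (leqW (leqnSn k)))).
    by rewrite /l/= ik => ->.
  elim: (size r) => [|m IHm] H; first by rewrite !big_ord0.
  rewrite !big_ord_recr/= !pintD H//.
  by rewrite (eqP (IHm _))// => i im; apply/H/ltnW.
- have := cE (Ordinal (leqnSn k.+1)).
  by rewrite /l/= ltnn eqxx !hornerD !hornerN => E; lra.
- have := cE (Ordinal (leqnn k.+2)); rewrite /l/= ltnNge leqnSn/=.
  by rewrite gtn_eqF// derivB !hornerD !hornerN => E; lra.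
Qed.

End ReferencePolynomials.

(** * Degree reduction by point sampling *)

Section QuasiProjector.
Context {R : realType}.
Implicit Types (p q c r : {poly R}).

Lemma lagrange_basis n (node : 'I_n -> R) : injective node ->
  exists lag : 'I_n -> {poly R}, (forall m, (size (lag m) <= n)%N) /\
    forall p, (size p <= n)%N -> \sum_m p.[node m] *: lag m = p.
Proof.
move=> node_inj.
have inj0 p : (size p <= n)%N -> (forall m, p.[node m] = 0) -> p = 0.
  move=> sp p0; apply: (@roots_geq_poly_eq0 _ p (map node (enum 'I_n))).
  - by apply/allP => _ /mapP[i _ ->]; apply/rootP.
  - by rewrite map_inj_uniq ?enum_uniq.
  - by rewrite size_map size_enum_ord.
have llin (m : 'I_n) a p q :
    (a *: p + q).[node m] = a * p.[node m] + q.[node m].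
  by rewrite hornerD hornerZ.
have H m : exists c : {poly R}, (size c <= n)%N /\
    forall i, c.[node i] = (i == m)%:R.
  have [c sc cE] := lin_surj (l := fun m p => p.[node m]) llin inj0
    (fun i => (i == m)%:R).
  by exists c.
have [lag lagP] := choice H.
exists lag; split => [m|p sp]; first by have [] := lagP m.
apply/eqP; rewrite -subr_eq0; apply/eqP/inj0 => [|i].
  rewrite (leq_trans (size_polyD _ _))// geq_max size_polyN sp andbT.
  apply: (leq_trans (size_sum _ _ _)); apply/bigmax_leqP => j _.
  by rewrite (leq_trans (size_scale_leq _ _))//; have [] := lagP j.
rewrite hornerD hornerN horner_sum (bigD1 i)//= hornerZ (lagP i).2 eqxx mulr1.
rewrite big1 ?addr0 ?subrr// => j ji.
by rewrite hornerZ (lagP j).2 eq_sym (negbTE ji) mulr0.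
Qed.

Definition quasi_interp n (node : 'I_n -> R) (lam : 'I_n -> {poly R})
  (f : R -> R) : {poly R} := \sum_m f (node m) *: lam m.

(** Passage to the coordinates of the next cell; for the interpolation error only the coefficients
    of degree [k.+1] and [k.+2] matter. *)
Lemma coef_shift p j n : (size p <= n)%N ->
  (p \Po ('X + 1%:P))`_j = \sum_(i < n) p`_i *+ 'C(i, j).
Proof.
move=> sp.
have coefXD1 i : (('X + 1%:P : {poly R}) ^+ i)`_j = 'C(i, j)%:R.
  rewrite addrC exprDn coef_sum.
  under eq_bigr do rewrite polyC1 expr1n mul1r coefMn coefXn.
  case: (ltnP j i.+1) => ji; last first.
    rewrite bin_small// big1// => l _; rewrite gtn_eqF ?mul0rn//.
    exact: leq_trans (ltn_ord l) ji.
  rewrite (bigD1 (Ordinal ji))//= eqxx big1 ?addr0// => l lj.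
  by rewrite eq_sym (_ : (l == j :> nat) = false) ?mul0rn//; exact: negbTE.
rewrite comp_polyE coef_sum.
under eq_bigr do rewrite coefZ coefXD1 mulr_natr.
rewrite (big_ord_widen n (fun i => p`_i *+ 'C(i, j)) sp) big_mkcond/=.
apply: eq_bigr => i _; case: ltnP => // pi.
by rewrite nth_default ?mul0rn.
Qed.

(* The interpolation error on polynomials of degree k + 2 is orthogonal to
   degree k - 2, and has zero mean value and zero mean derivative across each
   cell interface. *)
Definition quasi_projector k (node : 'I_k.+3 -> R)
    (lam : 'I_k.+3 -> {poly R}) : Prop :=
  [/\ forall m, 0 <= node m <= 1,
      forall m, (size (lam m) <= k.+1)%N,
      forall p, (size p <= k.+1)%N -> quasi_interp node lam (horner p) = p &
      forall p, (size p <= k.+3)%N ->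
        let e p := p - quasi_interp node lam (horner p) in
        [/\ forall r, (size r <= k.-1)%N -> pint (e p * r) = 0,
            (e p).[1] + (e (p \Po ('X + 1%:P))).[0] = 0 &
            (e p)^`().[1] + (e (p \Po ('X + 1%:P)))^`().[0] = 0]].

(** [G1] and [G2] are the errors on the two monomials that degree [k] misses, so [p - e p] is a
    reduction to degree [k], defined through coefficients. Lagrange interpolation at [k.+3] nodes is
    exact on the degrees concerned and expresses this reduction through point values. *)
Lemma exists_quasi_projector k : (1 <= k)%N ->
  exists node lam, @quasi_projector k node lam.
Proof.
move=> k1.
have [c1 sc1 [orth1 v1 d1]] := @antiperiodic_projection R k 'X^(k.+1) 0 0 k1.
(* From one cell to the next, the coefficient of degree [k.+1] grows by [k.+2] times the one of
   degree [k.+2]; with these data [G2] compensates the resulting mismatch between multiples of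
   [G1]. *)
have [c2 sc2 [orth2 v2 d2]] := @antiperiodic_projection R k 'X^(k.+2)
  (- k.+2%:R * ('X^(k.+1) - c1).[0]) (- k.+2%:R * ('X^(k.+1) - c1)^`().[0]) k1.
set G1 := 'X^(k.+1) - c1 in orth1 v1 d1 v2 d2; set G2 := 'X^(k.+2) - c2 in orth2 v2 d2.
pose e p := p`_k.+1 *: G1 + p`_k.+2 *: G2.
pose node (m : 'I_k.+3) : R := m%:R / k.+2%:R.
have node_inj : injective node.
  move=> i j /(mulIf _) /eqP; rewrite invr_eq0 pnatr_eq0/= => /(_ isT).
  by rewrite eqr_nat => /eqP /val_inj.
have [lag [slag lagP]] := lagrange_basis node_inj.
pose lam m := lag m - e (lag m).
have e_sum (I : Type) (s : seq I) (a : I -> R) (P : I -> {poly R}) :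
    e (\sum_(i <- s) a i *: P i) = \sum_(i <- s) a i *: e (P i).
  rewrite /e !coef_sum !scaler_suml -big_split/=.
  apply: eq_bigr => i _; rewrite !coefZ.
  by rewrite [RHS]scalerDr !scalerA.
have QE p : (size p <= k.+3)%N -> quasi_interp node lam (horner p) = p - e p.
  move=> sp; rewrite -[in RHS](lagP p sp) e_sum /quasi_interp -sumrB.
  by apply: eq_bigr => m _; rewrite scalerBr.
have sQ p : (size p <= k.+3)%N -> (size (p - e p)%R <= k.+1)%N.
  move=> sp; apply/leq_sizeP => j kj.
  rewrite coefB coefD !coefZ !coefB !coefXn.
  rewrite [c1`_j]nth_default ?(leq_trans sc1)//.
  rewrite [c2`_j]nth_default ?(leq_trans sc2)// !subr0.
  have [->|jk1] := eqVneq j k.+1.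
    by rewrite ltn_eqF// mulr1 mulr0 addr0 subrr.
  have [->|jk2] := eqVneq j k.+2; first by rewrite mulr1 mulr0 add0r subrr.
  rewrite !mulr0 addr0 subr0 nth_default// (leq_trans sp)//.
  by rewrite ltn_neqAle eq_sym jk2 ltn_neqAle eq_sym jk1.
exists node, lam; split => [m|m|p sp|p sp].
- rewrite /node divr_ge0//= ler_pdivrMr ?ltr0n// mul1r ler_nat.
  by rewrite -ltnS.
- exact: sQ.
- rewrite QE; last by apply/(leq_trans sp)/leqW/leqnSn.
  by rewrite /e !nth_default ?scale0r ?addr0 ?subr0// (leq_trans sp).
- have sp' : (size (p \Po ('X + 1%:P)) <= k.+3)%N.
    apply/leq_sizeP => j kj; rewrite (coef_shift _ sp) big1// => i _.
    by rewrite bin_small ?mulr0n// (leq_trans (ltn_ord i)).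
  have small (n j : nat) : (n <= j)%N -> \sum_(i < n) p`_i *+ 'C(i, j) = 0.
    by move=> nj; rewrite big1// => i _; rewrite bin_small// (leq_trans _ nj).
  have E1 : (p \Po ('X + 1%:P))`_k.+1 = p`_k.+1 + p`_k.+2 * k.+2%:R.
    rewrite (coef_shift _ sp) !big_ord_recr/= small// binn.
    by rewrite bin_small// binSn mulr0n !add0r mulr_natr.
  have E2 : (p \Po ('X + 1%:P))`_k.+2 = p`_k.+2.
    rewrite (coef_shift _ sp) !big_ord_recr/= small; last exact: leqW.
    by rewrite binn !bin_small// !mulr0n !add0r.
  rewrite /= !QE// !subKr /e E1 E2.
  split => [r sr||].
  + by rewrite mulrDl pintD -!scalerAl !pintZ orth1// orth2// !mulr0 addr0.
  + rewrite !hornerD !hornerZ.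
    rewrite (_ : G1.[1] = - G1.[0]); last by lra.
    by rewrite (_ : G2.[1] = - k.+2%:R * G1.[0] - G2.[0]); [ring|lra].
  + rewrite !derivD !derivZ !hornerD !hornerZ.
    rewrite (_ : G1^`().[1] = - G1^`().[0]); last by lra.
    by rewrite (_ : G2^`().[1] = - k.+2%:R * G1^`().[0] - G2^`().[0]); [ring|lra].
Qed.

End QuasiProjector.

(** * Interpolation of smooth functions *)

Section Towers.
Context {R : realType}.
Implicit Types (D E : nat -> R -> R) (p : {poly R}).

(** A function with its successive derivatives given as data, so that rescaled, translated or
    interpolated functions need no computation of iterated derivatives. *)
Definition tower D := forall n (x : R), is_derive x (1 : R) (D n) (D n.+1 x).

Lemma is_derive_cont (f f' : R -> R) :
  (forall x : R, is_derive x (1 : R) f (f' x)) -> continuous f.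
Proof.
move=> df x; apply: differentiable_continuous; apply/derivable1_diffP.
by have [] := df x.
Qed.

Lemma tower_cont D n : tower D -> continuous (D n).
Proof. by move=> tD; apply: is_derive_cont (tD n). Qed.

Lemma towerB D E : tower D -> tower E -> tower (fun n x => D n x - E n x).
Proof. by move=> tD tE n x; apply: is_deriveB. Qed.

Lemma towerD D E : tower D -> tower E -> tower (fun n x => D n x + E n x).
Proof. by move=> tD tE n x; apply: is_deriveD. Qed.

Lemma towerZ c D : tower D -> tower (fun n x => c * D n x).
Proof. by move=> tD n x; apply: is_deriveZ. Qed.

Lemma tower0 : tower (fun _ _ => 0).
Proof. by move=> n x; exact: is_derive_cst. Qed.

Lemma tower_sum (I : Type) (r : seq I) (F : I -> nat -> R -> R) :
  (forall i, tower (F i)) -> tower (fun n x => \sum_(i <- r) F i n x).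
Proof.
move=> tF; elim: r => [|i r IHr].
  have -> : (fun n x => \sum_(i <- [::]) F i n x) = fun _ _ => 0.
    by apply/funext => n; apply/funext => x; rewrite big_nil.
  exact: tower0.
have -> : (fun n x => \sum_(i <- i :: r) F i n x) =
    fun n x => F i n x + \sum_(i <- r) F i n x.
  by apply/funext => n; apply/funext => x; rewrite big_cons.
exact: towerD.
Qed.

Lemma tower_poly p : tower (fun n x => p^`(n).[x]).
Proof. by move=> n x; rewrite derivnS; exact: is_derive_poly. Qed.

(** Apart from Jacobians, the positive powers of the mesh size in the estimates come from this
    factor [h ^+ n]. *)
Lemma tower_affine D a h : tower D ->
  tower (fun n s => h ^+ n * D n (a + h * s)).
Proof.
move=> tD n x.
have dG := is_derive_affine a h x.
have dF : is_derive (a + h * x) (1 : R) (D n) (D n.+1 (a + h * x)) by exact: tD.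
have := @is_derive1_comp R (D n) (fun s : R => a + h * s) x _ _ dF dG.
move=> /(is_deriveZ (h ^+ n)).
rewrite exprS => H; refine (is_derive_eq H _).
by rewrite /GRing.scale/=; ring.
Qed.

(** [D s] is integrated back from 0, where the lower derivatives vanish: once by Cauchy-Schwarz,
    then by the mean value theorem. The length 3 is that of a patch of three reference cells, and
    each step costs at most a factor 9. *)
Lemma taylor_remainder D s lo hi : tower D -> lo <= 0 -> 0 <= hi ->
  hi - lo <= 3 -> (forall m, (m < s)%N -> D m 0 = 0) ->
  forall m x, (m < s)%N -> lo <= x <= hi ->
    D m x ^+ 2 <= 9 ^+ s * int1 lo hi (fun t => D s t ^+ 2).
Proof.
move=> tD lo0 hi0 hilo D0; set I := int1 lo hi _.
have I0 : 0 <= I by apply: int1_ge0 => x _; exact: sqr_ge0.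
have cD n : continuous (D n) by exact: tower_cont.
have sub (a b : R) : lo <= a -> a <= b -> b <= hi ->
    int1 a b (fun t => D s t ^+ 2) <= I.
  move=> la ab bh; have cs : continuous (fun t => D s t ^+ 2) by cont.
  rewrite /I (int1_chasles cs la (le_trans ab bh)).
  rewrite [X in _ <= _ + X](int1_chasles cs ab bh).
  have H (u v : R) : 0 <= int1 u v (fun t => D s t ^+ 2).
    by apply: int1_ge0 => t _; exact: sqr_ge0.
  by have := H lo a; have := H b hi; lra.
have base (a b : R) : lo <= a -> a <= b -> b <= hi ->
    int1 a b (D s) ^+ 2 <= 9 * I.
  move=> la ab bh; have := @int1_CS _ (fun=> 1) (D s) a b (@cont_cst _ _ 1) (cD s).
  rewrite (eq_int1 (g := D s)) => [|t _]; last by rewrite mul1r.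
  move=> /le_trans; apply.
  rewrite (eq_int1 (g := fun=> 1)) => [|t _]; last by rewrite expr1n.
  rewrite int1_cst// mul1r; apply: ler_pM.
  - by rewrite subr_ge0.
  - by apply: int1_ge0 => t _; exact: sqr_ge0.
  - by lra.
  - exact: sub.
(* Induction on the number [j.+1] of integrations, hence downwards on the order of the
   derivative. *)
have step j : (j < s)%N -> forall x, lo <= x <= hi ->
    D (s - j.+1)%N x ^+ 2 <= 9 ^+ j.+1 * I.
  elim: j => [|j IHj] js x /andP[lx xh].
    have es : s = (s - 1).+1 by rewrite subn1 prednK.
    have D00 : D (s - 1)%N 0 = 0 by apply: D0; rewrite {2}es.
    have dD (y : R) : is_derive y (1 : R) (D (s - 1)%N) (D s y).
      by rewrite [X in D X y]es; exact: tD.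
    rewrite expr1; have [x0|/ltW x0] := leP 0 x.
      have := int1_ftc x0 dD (cD s); rewrite D00 subr0 => <-.
      exact: base.
    have := int1_ftc x0 dD (cD s); rewrite D00 sub0r => E.
    by rewrite -sqrrN -E; exact: base.
  have e : (s - j.+1 = (s - j.+2).+1)%N by rewrite -subSn.
  have dD (y : R) : is_derive y (1 : R) (D (s - j.+2)%N) (D (s - j.+1)%N y).
    by have := tD (s - j.+2)%N y; rewrite e.
  have D00 : D (s - j.+2)%N 0 = 0 by apply: D0; rewrite ltn_subrL (leq_trans _ js).
  have [c /andP[lc ch] ->] : exists2 c, lo <= c <= hi &
      D (s - j.+2)%N x = D (s - j.+1)%N c * x.
    have cf a b : {within `[a, b], continuous (D (s - j.+2)%N)}.
      exact/continuous_subspaceT/cD.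
    have [x0|/ltW x0] := leP 0 x.
      have [c + E] := MVT_segment x0 (fun y _ => dD y) (cf 0 x).
      rewrite in_itv/= => /andP[c0 cx]; exists c.
        by rewrite (le_trans lo0)// (le_trans cx).
      by move: E; rewrite D00 !subr0.
    have [c + E] := MVT_segment x0 (fun y _ => dD y) (cf x 0).
    rewrite in_itv/= => /andP[xc c0]; exists c.
      by rewrite (le_trans lx)// (le_trans c0).
    by move: E; rewrite D00 !sub0r; lra.
  rewrite exprMn [9 ^+ _]exprS mulrC -mulrA ler_pM ?sqr_ge0//.
    by nra.
  by apply: IHj; [exact: ltnW|rewrite lc ch].
move=> m x ms xI; have := step (s - m.+1)%N.
rewrite -subSn// subSS subKn; last exact: ltnW.
rewrite leq_subr => /(_ isT x xI) /le_trans; apply.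
by rewrite ler_wpM2r// ler_weXn2l ?ler1n// leq_subr.
Qed.

End Towers.

(** * Bounds uniform over a family of data *)

Section UniformBounds.
Context {R : realType} {T : Type}.
Variable dom : T -> Prop.
Implicit Types x y : T -> R.

(** [x] is bounded by the square root of the energy [y], with one constant for all admissible data.
    Long expressions can then be estimated term by term without naming constants, and energies
    multiply along with the factors of a product. *)
Definition ubd x y :=
  exists2 K : R, 0 <= K & forall t, dom t -> x t ^+ 2 <= K * y t.

Lemma ubdD x x' y : ubd x y -> ubd x' y -> ubd (fun t => x t + x' t) y.
Proof.
move=> [K K0 HK] [L L0 HL]; exists (2 * K + 2 * L) => [|t dt].
  by rewrite addr_ge0// mulr_ge0.
have := HK t dt; have := HL t dt; have := sqr_ge0 (x t - x' t).
rewrite sqrrB sqrrD mulrDl; lra.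
Qed.

Lemma ubdN x y : ubd x y -> ubd (fun t => - x t) y.
Proof. by move=> [K K0 HK]; exists K => // t dt; rewrite sqrrN HK. Qed.

Lemma ubdB x x' y : ubd x y -> ubd x' y -> ubd (fun t => x t - x' t) y.
Proof. by move=> bx bx'; apply: ubdD => //; exact: ubdN. Qed.

Lemma ubdM x x' y y' : ubd x y -> ubd x' y' ->
  ubd (fun t => x t * x' t) (fun t => y t * y' t).
Proof.
move=> [K K0 HK] [L L0 HL]; exists (K * L) => [|t dt]; first by rewrite mulr_ge0.
by rewrite exprMn [leRHS]mulrACA ler_pM ?sqr_ge0 ?HK ?HL.
Qed.

Lemma ubdZ c x y : ubd x y -> ubd (fun t => c * x t) y.
Proof.
move=> [K K0 HK]; exists (c ^+ 2 * K) => [|t dt]; first by rewrite mulr_ge0 ?sqr_ge0.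
by rewrite exprMn -mulrA ler_wpM2l ?sqr_ge0 ?HK.
Qed.

Lemma ubd_sum n (x : 'I_n -> T -> R) y : (forall i, ubd (x i) y) ->
  (forall t, dom t -> 0 <= y t) ->
  ubd (fun t => \sum_i x i t) y.
Proof.
move=> + y0; elim: n x => [|n IHn] x bx.
  by exists 0 => // t dt; rewrite big_ord0 mul0r expr0n.
have [K K0 HK] := ubdD (IHn (fun i => x (widen_ord (leqnSn n) i)) (fun i => bx _))
  (bx ord_max).
by exists K => // t dt; rewrite big_ord_recr/=; exact: HK.
Qed.

Lemma eq_ubd x x' y y' : (forall t, dom t -> x t = x' t) ->
  (forall t, dom t -> y t = y' t) -> ubd x y -> ubd x' y'.
Proof.
by move=> ex ey [K K0 HK]; exists K => // t dt; rewrite -ex// -ey// HK.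
Qed.

End UniformBounds.

(** * Taylor remainders and one-dimensional interpolation *)

Section TaylorPolynomial.
Context {R : realType}.
Implicit Types (D : nat -> R -> R) (p : {poly R}).

Definition taylor D s : {poly R} := \poly_(m < s) (D m 0 / m`!%:R).

Definition trem D s n x := D n x - (taylor D s)^`(n).[x].

Lemma tower_trem D s : tower D -> tower (trem D s).
Proof. by move=> tD; apply: towerB => //; exact: tower_poly. Qed.

Lemma derivn_small p n : (size p <= n)%N -> p^`(n) = 0.
Proof.
move=> pn; apply/polyP => i; rewrite coef_derivn coef0.
by rewrite nth_default ?mul0rn// (leq_trans pn)// leq_addr.
Qed.

Lemma trem_high D s n : (s <= n)%N -> trem D s n = D n.
Proof.
move=> sn; apply/funext => x; rewrite /trem derivn_small ?horner0 ?subr0//.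
exact: leq_trans (size_poly _ _) sn.
Qed.

Lemma trem_bound D s lo hi m x : tower D -> lo <= 0 -> 0 <= hi ->
  hi - lo <= 3 -> (m < s)%N -> lo <= x <= hi ->
  trem D s m x ^+ 2 <= 9 ^+ s * int1 lo hi (fun t => D s t ^+ 2).
Proof.
move=> tD lo0 hi0 hilo ms xI.
rewrite -(trem_high D (leqnn s)).
apply: taylor_remainder => //; first exact: tower_trem.
move=> n ns; rewrite /trem horner_coef0 coef_derivn addn0 ffactnn coef_poly ns.
by rewrite -[_ *+ _]mulr_natr divfK ?subrr// pnatr_eq0 -lt0n fact_gt0.
Qed.

End TaylorPolynomial.

Section QuasiInterpolant.
Context {R : realType}.
Variables (k : nat) (node : 'I_k.+3 -> R) (lam : 'I_k.+3 -> {poly R}).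
Hypothesis hk : (1 <= k)%N.
Hypothesis hP : quasi_projector node lam.
Implicit Types (D : nat -> R -> R) (p V : {poly R}) (f g : R -> R).

Local Notation P := (quasi_interp node lam).

Lemma interpB f g : P (fun x => f x - g x) = P f - P g.
Proof.
by rewrite /quasi_interp -sumrB; apply: eq_bigr => m _; rewrite scalerBl.
Qed.

Lemma interpD f g : P (fun x => f x + g x) = P f + P g.
Proof.
rewrite /quasi_interp -big_split; apply: eq_bigr => m _.
by rewrite scalerDl.
Qed.

Lemma horner_interp f x : (P f).[x] = \sum_m f (node m) * (lam m).[x].
Proof.
by rewrite /quasi_interp horner_sum; apply: eq_bigr => m _; rewrite hornerZ.
Qed.

Lemma poly_ubd p : ubd (fun x => 0 <= x <= 1) (fun x => p.[x]) (fun=> 1).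
Proof.
have [M HM] := @cont2_bounded R (fun x _ => p.[x]) 0 1 0 1 (ltac:(cont)).
exists (M ^+ 2) => [|x x01]; first exact: sqr_ge0.
have := HM x 0 x01; rewrite lexx ler01 => /(_ isT) pM.
rewrite mulr1 -[leLHS]real_normK ?num_real// ler_sqr ?nnegrE//.
exact: le_trans pM.
Qed.

Lemma interp_sup : exists2 K : R, 0 <= K &
  forall f B, (forall m, f (node m) ^+ 2 <= B) -> forall x, 0 <= x <= 1 ->
    (P f).[x] ^+ 2 <= K * B.
Proof.
pose dom (t : (R -> R) * R * R) :=
  (forall m, t.1.1 (node m) ^+ 2 <= t.1.2) /\ 0 <= t.2 <= 1.
have H : ubd dom (fun t => \sum_m t.1.1 (node m) * (lam m).[t.2])
    (fun t => t.1.2 * 1).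
  apply: ubd_sum => [m|t [H _]]; last first.
    by rewrite mulr1; apply: le_trans (H ord0); exact: sqr_ge0.
  apply: ubdM; first by exists 1 => // t [H _]; rewrite mul1r.
  have [K K0 HK] := poly_ubd (lam m).
  by exists K => // t [_ t01]; exact: HK.
have [K K0 HK] := H; exists K => // f B fB x x01.
by rewrite horner_interp; have := HK (f, B, x); rewrite /= mulr1; apply.
Qed.

Lemma node01 m : 0 <= node m <= 1.
Proof. by have [] := hP. Qed.

(** Bramble-Hilbert argument: the interpolant reproduces the Taylor polynomial of degree [s - 1], so
    only the remainder contributes, and it is bounded pointwise, in particular at the nodes. *)
Lemma interp_approx s : (0 < s <= k.+1)%N -> exists2 C : R, 0 <= C &
  forall D, tower D ->
    int1 0 1 (fun x => ((P (D 0%N)).[x] - D 0%N x) ^+ 2) <=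
    C * int1 0 1 (fun x => D s x ^+ 2).
Proof.
move=> /andP[s0 sk]; have [K K0 HK] := interp_sup.
exists (2 * (K + 1) * 9 ^+ s) => [|D tD].
  by rewrite mulr_ge0 ?exprn_ge0// mulr_ge0// addr_ge0.
have cD n : continuous (D n) by exact: tower_cont.
set I := int1 0 1 (fun x => D s x ^+ 2).
have rB x : 0 <= x <= 1 -> trem D s 0 x ^+ 2 <= 9 ^+ s * I.
  by move=> x01; apply: trem_bound => //; lra.
suff H x : 0 <= x <= 1 ->
    ((P (D 0%N)).[x] - D 0%N x) ^+ 2 <= 2 * (K + 1) * 9 ^+ s * I.
  apply: le_trans (int1_le _ (@cont_cst _ _ (2 * (K + 1) * 9 ^+ s * I)) H) _.
    by cont.
  by rewrite int1_cst// subr0 mulr1.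
move=> x01; have -> : (P (D 0%N)).[x] - D 0%N x =
    (P (trem D s 0)).[x] - trem D s 0 x.
  rewrite /trem interpB derivn0; have [_ _ Pp _] := hP.
  rewrite Pp ?(leq_trans (size_poly _ _))//.
  by rewrite hornerD hornerN; ring.
have H1 := HK (trem D s 0) _ (fun m => rB _ (node01 m)) x x01.
have := rB x x01; have := sqr_ge0 ((P (trem D s 0)).[x] + trem D s 0 x).
move: H1; set a := _.[_]; set b := trem _ _ _ _ => H1 H2 H3.
have -> : (a - b) ^+ 2 = 2 * a ^+ 2 + 2 * b ^+ 2 - (a + b) ^+ 2 by ring.
rewrite -[X in _ <= X]mulrA; move: H1 H2 H3.
by set B := 9 ^+ s * I; set c := (a + b) ^+ 2; lra.
Qed.

(** Point values are not controlled by the L^2 norm; the first derivative enters through the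
    one-dimensional Sobolev inequality. This loss of one derivative is the origin of the mixed term
    in [approx_norm]. *)
Lemma interp_stable : exists2 C : R, 0 <= C & forall D, tower D ->
  int1 0 1 (fun x => (P (D 0%N)).[x] ^+ 2) <=
  C * (int1 0 1 (fun x => D 0%N x ^+ 2) + int1 0 1 (fun x => D 1%N x ^+ 2)).
Proof.
have [K K0 HK] := interp_sup; exists (K * 2) => [|D tD]; first by rewrite mulr_ge0.
have cD n : continuous (D n) by exact: tower_cont.
set I0 := int1 0 1 (fun x => D 0%N x ^+ 2).
set I1 := int1 0 1 (fun x => D 1%N x ^+ 2).
have diff x y : 0 <= x <= 1 -> 0 <= y <= 1 -> (D 0%N x - D 0%N y) ^+ 2 <= I1.
  wlog yx : x y / y <= x => [W x01 y01|].
    by have [|/ltW] := leP y x => xy; [|rewrite -sqrrN opprB]; exact: W.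
  move=> /andP[x0 x1] /andP[y0 y1]; rewrite -(int1_ftc yx (tD 0%N) (cD 1%N)).
  have c1 : continuous (fun t => D 1%N t ^+ 2) by cont.
  have pos (a b : R) : 0 <= int1 a b (fun t => D 1%N t ^+ 2).
    by apply: int1_ge0 => t _; exact: sqr_ge0.
  have := @int1_CS _ (fun=> 1) (D 1%N) y x (@cont_cst _ _ 1) (cD 1%N).
  rewrite (eq_int1 (g := D 1%N)) => [|t _]; last by rewrite mul1r.
  rewrite (eq_int1 (f := fun=> 1 ^+ 2) (g := fun=> 1)) => [|t _]; last by rewrite expr1n.
  rewrite int1_cst// mul1r => /le_trans; apply.
  have : int1 y x (fun t => D 1%N t ^+ 2) <= I1.
    rewrite /I1 (int1_chasles c1 y0 y1) (int1_chasles c1 yx x1).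
    by have := pos 0 y; have := pos x 1; lra.
  by have := pos y x; nra.
have pw x : 0 <= x <= 1 -> D 0%N x ^+ 2 <= 2 * (I0 + I1).
  move=> x01.
  (* The value at [x] is compared with the value at [y], and the comparison is averaged over [y]. *)
  have : int1 0 1 (fun=> D 0%N x ^+ 2) <=
      int1 0 1 (fun y => 2 * D 0%N y ^+ 2 + 2 * I1).
    apply: int1_le => [||y y01]; [by cont|by cont|].
    have := diff x y x01 y01; have := sqr_ge0 (D 0%N x - 2 * D 0%N y).
    by rewrite !sqrrB exprMn; lra.
  rewrite int1_cst// subr0 mulr1 int1D; [|by cont|by cont].
  rewrite int1Z; last by cont.
  by rewrite int1_cst// subr0 mulr1 -mulrDr.
have H x : 0 <= x <= 1 -> (P (D 0%N)).[x] ^+ 2 <= K * (2 * (I0 + I1)).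
  by move=> x01; apply: HK => // m; exact/pw/node01.
apply: le_trans (int1_le _ (@cont_cst _ _ (K * (2 * (I0 + I1)))) H) _.
  by cont.
by rewrite int1_cst// subr0 mulr1 mulrA.
Qed.

End QuasiInterpolant.

(** * Consistency on a periodic row of cells *)

Section LocalResidual.
Context {R : realType}.
Variables (k : nat) (node : 'I_k.+3 -> R) (lam : 'I_k.+3 -> {poly R}).
Hypothesis hk : (1 <= k)%N.
Hypothesis hP : quasi_projector node lam.
Implicit Types (D : nat -> R -> R) (p V W : {poly R}) (f g : R -> R).

Local Notation P := (quasi_interp node lam).

(* The part of the form, after integration by parts on every cell, in which the
   test function on a given cell occurs; Wm and Wp are the pieces on the
   previous and on the next cell. *)
Definition cell_form W Wm Wp V : R :=
  - pint (W^`()^`() * V) + 2^-1 * (W^`().[1] - Wp^`().[0]) * V.[1]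
  + 2^-1 * (Wm^`().[1] - W^`().[0]) * V.[0]
  + 2^-1 * V^`().[1] * (Wp.[0] - W.[1]) + 2^-1 * V^`().[0] * (W.[0] - Wm.[1]).

Lemma cell_formD W Wm Wp W' Wm' Wp' V :
  cell_form (W + W') (Wm + Wm') (Wp + Wp') V =
  cell_form W Wm Wp V + cell_form W' Wm' Wp' V.
Proof. by rewrite /cell_form !derivD mulrDl pintD !hornerD; ring. Qed.

Let translate c p := p \Po ('X + c%:P).

Let horner_translate c p x : (translate c p).[x] = p.[x + c].
Proof. by rewrite horner_comp !hornerE. Qed.

Let deriv_translate c p : (translate c p)^`() = translate c p^`().
Proof. by rewrite deriv_comp derivD derivX derivC addr0 mulr1. Qed.

Let size_translate c p : size (translate c p) = size p.
Proof. by rewrite size_comp_poly2// size_XaddC. Qed.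

(** Without interpolation the interface terms vanish and the volume terms cancel, so only the error
    [e] remains. Two integrations by parts put all derivatives on [V]: the volume term then pairs
    [e] with degree [k - 2], and the interface terms contain only averages of [e] and of its
    derivative, which vanish. *)
Lemma cell_form_poly p V : (size p <= k.+3)%N -> (size V <= k.+1)%N ->
  cell_form (P (horner p)) (P (fun x => p.[x - 1])) (P (fun x => p.[x + 1])) V
  + int1 0 1 (fun x => p^`()^`().[x] * V.[x]) = 0.
Proof.
move=> sp sV; have [_ _ _ HP] := hP.
have -> : (fun x => p.[x - 1]) = horner (translate (-1) p).
  by apply/funext => x; rewrite horner_translate.
have -> : (fun x => p.[x + 1]) = horner (translate 1 p).
  by apply/funext => x; rewrite horner_translate.
have -> : int1 0 1 (fun x => p^`()^`().[x] * V.[x]) = pint (p^`()^`() * V).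
  by apply: eq_int1 => x _; rewrite hornerM.
have [orth v0 d0] := HP p sp.
(* The same property for the polynomial as seen from the previous cell: it yields the conditions at
   the left interface. *)
have [_ + +] := HP (translate (-1) p) (ltac:(by rewrite size_translate)).
rewrite -/(translate 1 (translate (-1) p)).
have -> : translate 1 (translate (-1) p) = p.
  by rewrite /translate -comp_polyA comp_polyD comp_polyX comp_polyC
             -addrA -polyCD subrr addr0 comp_polyXr.
move: orth v0 d0; rewrite -/(translate 1 p).
set e := p - P (horner p).
set em := translate (-1) p - P (horner (translate (-1) p)).
set ep := translate 1 p - P (horner (translate 1 p)).
move=> orth v0 d0 v1 d1.
have -> : P (horner p) = p - e by rewrite /e subKr.
have -> : P (horner (translate (-1) p)) = translate (-1) p - em.
  by rewrite /em subKr.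
have -> : P (horner (translate 1 p)) = translate 1 p - ep.
  by rewrite /ep subKr.
clearbody e em ep.
have E1 : pint (e^`()^`() * V) = e^`().[1] * V.[1] - e^`().[0] * V.[0]
    - (e.[1] * V^`().[1] - e.[0] * V^`().[0]).
  rewrite !pint_parts orth ?subr0//; do 2 apply: size_deriv_leq.
  by rewrite prednK// prednK.
have {}v0 : ep.[0] = - e.[1] by lra.
have {}v1 : em.[1] = - e.[0] by lra.
have {}d0 : ep^`().[0] = - e^`().[1] by lra.
have {}d1 : em^`().[1] = - e^`().[0] by lra.
rewrite /cell_form !derivB mulrBl pintB E1 !deriv_translate.
rewrite !(hornerD, hornerN) !horner_translate v0 v1 d0 d1.
by rewrite subrr add0r; field.
Qed.

Definition linear_form (L : {poly R} -> R) :=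
  forall a p q, L (a *: p + q) = a * L p + L q.

Lemma linear_form_sum (L : {poly R} -> R) n (a : 'I_n -> R) q :
  linear_form L -> L (\sum_i a i *: q i) = \sum_i a i * L (q i).
Proof.
move=> Llin.
have L0 : L 0 = 0 by have := Llin (-1) 0 0; rewrite scaler0 addr0 => E; lra.
by elim/big_rec2: _ => [//|i x y _ <-]; rewrite Llin.
Qed.

(** Bramble-Hilbert argument on the patch [-1, 2]: the residual vanishes on the Taylor polynomial of
    degree [s - 1], which is at most [k + 2], and each of its terms is bounded for the remainder. On
    the side of [V], linear functionals on polynomials of bounded degree are bounded in L^2. *)
Lemma local_residual s : (2 <= s <= k.+3)%N -> exists2 C : R, 0 <= C &
  forall D V, tower D -> (size V <= k.+1)%N ->
  (cell_form (P (D 0%N)) (P (fun x => D 0%N (x - 1)))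
     (P (fun x => D 0%N (x + 1))) V
   + int1 0 1 (fun x => D 2%N x * V.[x])) ^+ 2 <=
  C * (int1 (-1) 2 (fun x => D s x ^+ 2) * int1 0 1 (fun x => V.[x] ^+ 2)).
Proof.
move=> /andP[s2 sk].
pose T := ((nat -> R -> R) * {poly R})%type.
pose dom (t : T) := tower t.1 /\ (size t.2 <= k.+1)%N.
pose yI (t : T) := int1 (-1) 2 (fun x => t.1 s x ^+ 2).
pose yV (t : T) := int1 0 1 (fun x => t.2.[x] ^+ 2).
(* The values -1, 0 and 1 of [c] select the interpolant of the remainder on the previous, the same
   and the next cell. *)
pose Pc (c : R) (t : T) := P (fun x => trem t.1 s 0 (x + c)).
have yI0 t : 0 <= yI t by apply: int1_ge0 => x _; exact: sqr_ge0.
have yV0 t : 0 <= yV t by apply: int1_ge0 => x _; exact: sqr_ge0.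
have rB t m x : dom t -> (m < s)%N -> -1 <= x <= 2 ->
    trem t.1 s m x ^+ 2 <= 9 ^+ s * yI t.
  by move=> [tD _] ms xI; apply: trem_bound => //; lra.
have bnode c m : -1 <= c <= 1 ->
    ubd dom (fun t => trem t.1 s 0 (node m + c)) yI.
  move=> c1; exists (9 ^+ s) => [|t dt]; first exact: exprn_ge0.
  apply: rB => //; first exact: ltnW.
  by have := node01 hP m; lra.
have bL c L : -1 <= c <= 1 -> linear_form L -> ubd dom (fun t => L (Pc c t)) yI.
  move=> c1 Llin.
  apply: (@eq_ubd _ _ dom (fun t => \sum_m L (lam m) * trem t.1 s 0 (node m + c)) _ yI) => //.
    move=> t _; rewrite /Pc /quasi_interp linear_form_sum//.
    by apply: eq_bigr => m _; rewrite mulrC.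
  by apply: ubd_sum => // m; apply: ubdZ; exact: bnode.
have bV L : linear_form L -> ubd dom (fun t => L t.2) yV.
  move=> Llin; have [K K0 HK] := lin_bounded k.+1 Llin.
  by exists K => // t [_ st]; exact: HK.
have hor x : linear_form (fun p => p.[x]).
  by move=> a p q; rewrite hornerD hornerZ.
have horD x : linear_form (fun p => p^`().[x]).
  by move=> a p q; rewrite derivD derivZ hornerD hornerZ.
have pm1 : -1 <= (-1 : R) <= 1 by lra.
have p0 : -1 <= (0 : R) <= 1 by lra.
have p1 : -1 <= (1 : R) <= 1 by lra.
have b1 : ubd dom (fun t => pint ((Pc 0 t)^`()^`() * t.2)) (fun t => yI t * yV t).
  apply: (@eq_ubd _ _ dom (fun t => \sum_m trem t.1 s 0 (node m + 0) *
      pint ((lam m)^`()^`() * t.2)) _ (fun t => yI t * yV t)) => //.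
    move=> t _; rewrite /Pc /quasi_interp.
    rewrite (linear_form_sum (L := fun q => pint (q^`()^`() * t.2)))//.
    move=> a p q; rewrite !derivD !derivZ mulrDl pintD -scalerAl.
    by rewrite pintZ.
  apply: ubd_sum => [m|t _]; last exact: mulr_ge0.
  apply: ubdM; first exact: bnode.
  apply: (bV (fun V => pint ((lam m)^`()^`() * V))) => a p q.
  by rewrite mulrDr pintD -scalerAr pintZ.
have b2 : ubd dom (fun t => int1 0 1 (fun x => trem t.1 s 2 x * t.2.[x]))
    (fun t => yI t * yV t).
  exists (9 ^+ s) => [|t dt]; first exact: exprn_ge0.
  have tR : tower (trem t.1 s) by apply: tower_trem; case: dt.
  have cR n : continuous (trem t.1 s n) by exact: tower_cont.
  apply: le_trans (int1_CS _ _ (cR 2) (@continuous_horner _ t.2)) _.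
  rewrite mulrA; apply: ler_wpM2r; first exact: yV0.
  (* The pointwise bound covers derivatives of order below [s] only; for [s = 2] the second
     derivative of the remainder is that of the function itself, and its integral is bounded
     directly. *)
  have [es|s3] : s = 2%N \/ (2 < s)%N.
    by move: s2; rewrite leq_eqVlt => /predU1P[]; [left|right].
    have e2 : trem t.1 s 2 = t.1 s by rewrite trem_high ?es.
    have cs : continuous (fun x => t.1 s x ^+ 2).
      by apply: contX; apply: tower_cont; case: dt.
    rewrite e2; apply: (@le_trans _ _ (yI t)).
      rewrite /yI (@int1_chasles _ _ (-1) 0 2)//.
      rewrite [X in _ <= _ + X](@int1_chasles _ _ 0 1 2)//; [|lra..].
      have := @int1_ge0 _ (fun x => t.1 s x ^+ 2) (-1) 0 (fun x _ => sqr_ge0 _).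
      have := @int1_ge0 _ (fun x => t.1 s x ^+ 2) 1 2 (fun x _ => sqr_ge0 _).
      by lra.
    rewrite ler_peMl// exprn_ege1//; lra.
  have H x : 0 <= x <= 1 -> trem t.1 s 2 x ^+ 2 <= 9 ^+ s * yI t.
    by move=> x01; apply: rB => //; lra.
  apply: le_trans (int1_le _ (@cont_cst _ _ (9 ^+ s * yI t)) H) _.
    by cont.
  by rewrite int1_cst// subr0 mulr1.
have [C C0 HC] : ubd dom (fun t => cell_form (Pc 0 t) (Pc (-1) t) (Pc 1 t) t.2
    + int1 0 1 (fun x => trem t.1 s 2 x * t.2.[x])) (fun t => yI t * yV t).
  rewrite /cell_form; apply: ubdD b2; do ![apply: ubdD].
  - exact: ubdN.
  - apply: ubdM; last exact: (bV (fun p => p.[1])).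
    apply: ubdZ; apply: ubdB; first exact: (bL _ (fun p => p^`().[1])).
    exact: (bL _ (fun p => p^`().[0])).
  - apply: ubdM; last exact: (bV (fun p => p.[0])).
    apply: ubdZ; apply: ubdB; first exact: (bL _ (fun p => p^`().[1])).
    exact: (bL _ (fun p => p^`().[0])).
  - apply: (@eq_ubd _ _ dom (fun t => ((Pc 1 t).[0] - (Pc 0 t).[1]) *
      (2^-1 * t.2^`().[1])) _ (fun t => yI t * yV t)) => //.
      by move=> t _; rewrite mulrC.
    apply: ubdM; last by apply: ubdZ; exact: (bV (fun p => p^`().[1])).
    apply: ubdB; first exact: (bL _ (fun p => p.[0])).
    exact: (bL _ (fun p => p.[1])).
  - apply: (@eq_ubd _ _ dom (fun t => ((Pc 0 t).[0] - (Pc (-1) t).[1]) *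
      (2^-1 * t.2^`().[0])) _ (fun t => yI t * yV t)) => //.
      by move=> t _; rewrite mulrC.
    apply: ubdM; last by apply: ubdZ; exact: (bV (fun p => p^`().[0])).
    apply: ubdB; first exact: (bL _ (fun p => p.[0])).
    exact: (bL _ (fun p => p.[1])).
exists C => // D V tD sV; have /= := HC (D, V) (conj tD sV).
rewrite -[in X in _ -> X]/(yI (D, V)) -/(yV (D, V)).
congr (_ ^+ 2 <= _); rewrite /Pc.
set t := taylor D s.
have st : (size t <= k.+3)%N by apply: (leq_trans (size_poly _ _)).
have Z := cell_form_poly st sV.
have E c : P (fun x => D 0%N (x + c)) =
    P (fun x => trem D s 0 (x + c)) + P (fun x => t.[x + c]).
  rewrite -interpD; congr P; apply/funext => x.
  by rewrite /trem derivn0 subrK.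
have E0 : P (D 0%N) = P (fun x => trem D s 0 (x + 0)) + P (horner t).
  have := E 0; have -> : (fun x => D 0%N (x + 0)) = D 0%N.
    by apply/funext => x; rewrite addr0.
  move=> ->; congr (_ + P _).
  by apply/funext => x; rewrite addr0.
rewrite E0 !E cell_formD.
have cD : continuous (D 2%N) by exact: tower_cont.
have cR : continuous (trem D s 2) by exact/tower_cont/tower_trem.
have -> : int1 0 1 (fun x => D 2%N x * V.[x]) =
  int1 0 1 (fun x => trem D s 2 x * V.[x])
  + int1 0 1 (fun x => t^`()^`().[x] * V.[x]).
  rewrite -int1D; [|by cont|by cont].
  by apply: eq_int1 => x _; rewrite /trem -mulrDl subrK.
by move: Z; lra.
Qed.

End LocalResidual.

(** * The form along a periodic row *)

Section CyclicSums.
Context {R : realType} {N : nat}.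

Lemma sum_ordS (g : 'I_N -> R) : \sum_i g (ordS i) = \sum_i g i.
Proof. by rewrite [RHS](reindex_inj (@ordS_inj N)). Qed.

Lemma sum_ord_pred (g : 'I_N -> 'I_N -> R) :
  \sum_i g i (ordS i) = \sum_i g (ord_pred i) i.
Proof.
rewrite -(sum_ordS (fun i => g (ord_pred i) i)).
by apply: eq_bigr => i _; rewrite ordSK.
Qed.

End CyclicSums.

Section ReferenceForm.
Context {R : realType}.
Implicit Types (p q : {poly R}).

(** The horizontal part of the bilinear form on one row of cells, at a fixed height and in reference
    coordinates. *)
Definition dg1 N (W V : 'I_N -> {poly R}) : R :=
  \sum_i (pint ((W i)^`() * (V i)^`())
    + 2^-1 * ((W i)^`().[1] + (W (ordS i))^`().[0])
        * ((V (ordS i)).[0] - (V i).[1])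
    + 2^-1 * ((V i)^`().[1] + (V (ordS i))^`().[0])
        * ((W (ordS i)).[0] - (W i).[1])).

(** Integration by parts on every cell, followed by a cyclic shift of the interface terms, so that
    each lands in the cell of its test function. *)
Lemma dg1_cells N (W V : 'I_N -> {poly R}) : dg1 W V =
  \sum_i cell_form (W i) (W (ord_pred i)) (W (ordS i)) (V i).
Proof.
(* [A] collects terms with the test function of the cell itself, [g] pairs a cell with the test
   function of the next one, and [h] drops out because its sum over the row is invariant under the
   shift. *)
pose A i := - pint ((W i)^`()^`() * V i) + 2^-1 * ((W i)^`().[1]
  - (W (ordS i))^`().[0]) * (V i).[1] - 2^-1 * (W i)^`().[0] * (V i).[0]
  + 2^-1 * (V i)^`().[1] * ((W (ordS i)).[0] - (W i).[1])
  + 2^-1 * (V i)^`().[0] * (W i).[0].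
pose g i j := 2^-1 * (W i)^`().[1] * (V j).[0]
  - 2^-1 * (V j)^`().[0] * (W i).[1].
pose h i := 2^-1 * (W i)^`().[0] * (V i).[0] + 2^-1 * (V i)^`().[0] * (W i).[0].
transitivity (\sum_i A i + \sum_i g i (ordS i) +
    (\sum_i h (ordS i) - \sum_i h i)).
  rewrite -sumrB -!big_split/=; apply: eq_bigr => i _.
  have := pint_parts (W i)^`() (V i); rewrite /A /g /h.
  set X := pint _; set Y := pint _ => E; rewrite (_ : Y = (W i)^`().[1] *
    (V i).[1] - (W i)^`().[0] * (V i).[0] - X); last by lra.
  by field.
rewrite sum_ordS subrr addr0 sum_ord_pred -big_split; apply: eq_bigr => i _.
by rewrite /A /g /cell_form/=; ring.
Qed.

Lemma dg1D N (W W' V : 'I_N -> {poly R}) :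
  dg1 (fun i => W i + W' i) V = dg1 W V + dg1 W' V.
Proof.
rewrite !dg1_cells -big_split; apply: eq_bigr => i _.
by rewrite cell_formD.
Qed.

End ReferenceForm.

(** Young's inequality for squared bounds. The additive form can be summed over cells and integrated
    over rows, and the free weight [e] later lets the energy absorb the terms in the test
    function. *)
Lemma sqr_le_AMGM {R : realType} (x a b C e : R) : 0 <= a -> 0 <= b -> 0 <= C ->
  0 < e -> x ^+ 2 <= C * (a * b) -> `|x| <= e^-1 * C * a + e * b.
Proof.
move=> a0 b0 C0 e0 xab; have e0' := ltW e0.
have r0 : 0 <= e^-1 * C * a + e * b.
  by rewrite addr_ge0// !mulr_ge0// invr_ge0.
rewrite -(@ler_sqr _ `|x|) ?nnegrE//.
rewrite real_normK ?num_real//; apply: (le_trans xab).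
have := sqr_ge0 (e^-1 * C * a - e * b).
have -> : (e^-1 * C * a + e * b) ^+ 2 =
    (e^-1 * C * a - e * b) ^+ 2 + 4 * (C * (a * b)).
  by field; exact: lt0r_neq0.
have : 0 <= C * (a * b) by apply: mulr_ge0 => //; exact: mulr_ge0.
by lra.
Qed.

Section ReferenceResidual.
Context {R : realType}.
Variables (k : nat) (node : 'I_k.+3 -> R) (lam : 'I_k.+3 -> {poly R}).
Hypothesis hk : (1 <= k)%N.
Hypothesis hP : quasi_projector node lam.

Local Notation P := (quasi_interp node lam).

(** The patches of three cells cover every cell of the row three times, whence the factor 3. *)
Lemma dg1_residual s : (2 <= s <= k.+3)%N -> exists2 C : R, 0 <= C &
  forall N (f : 'I_N -> nat -> R -> R) (V : 'I_N -> {poly R}) (e : R),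
  0 < e -> (forall i, tower (f i)) ->
  (forall i n x, f (ordS i) n x = f i n (x + 1)) ->
  (forall i, (size (V i) <= k.+1)%N) ->
  `|dg1 (fun i => P (f i 0%N)) V
    + \sum_i int1 0 1 (fun x => f i 2%N x * (V i).[x])|
  <= e^-1 * C * (\sum_i int1 0 1 (fun x => f i s x ^+ 2))
     + e * (\sum_i int1 0 1 (fun x => (V i).[x] ^+ 2)).
Proof.
move=> sI; have [C C0 HC] := local_residual hk hP sI.
exists (C * 3) => [|N f V e e0 tf fS sV]; first by rewrite mulr_ge0.
rewrite dg1_cells -big_split/=.
have fm i n x : f (ord_pred i) n x = f i n (x - 1).
  by rewrite -{2}[i]ord_predK fS subrK.
have cf i : continuous (fun x => f i s x ^+ 2) by apply: contX; exact: tower_cont.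
pose a i := int1 (-1) 2 (fun x => f i s x ^+ 2).
pose b i := int1 0 1 (fun x => (V i).[x] ^+ 2).
have Ea : \sum_i a i = 3 * \sum_i int1 0 1 (fun x => f i s x ^+ 2).
  pose g i := int1 0 1 (fun x => f i s x ^+ 2).
  transitivity (\sum_i (g (ord_pred i) + g i + g (ordS i))); last first.
    rewrite !big_split/= sum_ordS -(sum_ord_pred (fun i _ => g i)) -/g.
    by rewrite /g; ring.
  apply: eq_bigr => i _; rewrite /a (@int1_chasles _ _ (-1) 0 2)//.
  rewrite (@int1_chasles _ _ 0 1 2)//; [|lra..].
  have -> : int1 (-1) 0 (fun x => f i s x ^+ 2) =
      int1 0 1 (fun x => f i s (x - 1) ^+ 2).
    by rewrite -(@int1_shift _ (fun x => f i s x ^+ 2))// add0r subrr.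
  have -> : int1 1 2 (fun x => f i s x ^+ 2) =
      int1 0 1 (fun x => f i s (x + 1) ^+ 2).
    by rewrite -(@int1_shift _ (fun x => f i s x ^+ 2))// add0r.
  rewrite addrA; congr (_ + _ + _); apply: eq_int1 => x _.
    by rewrite fm.
  by rewrite fS.
move: Ea; set S := \sum_i int1 0 1 (fun x => f i s x ^+ 2) => Ea.
rewrite (_ : e^-1 * (C * 3) * S = e^-1 * C * \sum_i a i); last first.
  by rewrite Ea; ring.
rewrite !mulr_sumr -big_split/=.
apply: (le_trans (ler_norm_sum _ _ _)); apply: ler_sum => i _.
apply: sqr_le_AMGM => //.
- by apply: int1_ge0 => x _; exact: sqr_ge0.
- by apply: int1_ge0 => x _; exact: sqr_ge0.
have -> : f (ord_pred i) 0%N = fun x => f i 0%N (x - 1).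
  by apply/funext => x; rewrite fm.
have -> : f (ordS i) 0%N = fun x => f i 0%N (x + 1).
  by apply/funext => x; rewrite fS.
exact: HC.
Qed.

End ReferenceResidual.

Section PolynomialFamilies.
Context {R : realType}.
Implicit Types (p q : R -> {poly R}).

(** Continuous dependence of a polynomial on a parameter, expressed through finitely many fixed
    polynomials, so that no topology on [{poly R}] is involved. *)
Definition cpoly p := exists n (c : 'I_n -> R -> R) (q : 'I_n -> {poly R}),
  (forall a, continuous (c a)) /\ forall y, p y = \sum_a c a y *: q a.

Lemma cpoly_linear L p : linear_form L -> cpoly p ->
  continuous (fun y => L (p y)).
Proof.
move=> Llin [n [c [q [cc pE]]]].
have -> : (fun y => L (p y)) = fun y => \sum_a c a y * L (q a).
  by apply/funext => y; rewrite pE linear_form_sum.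
by cont.
Qed.

Lemma cpoly_horner x p : cpoly p -> continuous (fun y => (p y).[x]).
Proof.
by apply: (@cpoly_linear (fun r => r.[x])) => a u v; rewrite hornerD hornerZ.
Qed.

Lemma cpoly_deriv p : cpoly p -> cpoly (fun y => (p y)^`()).
Proof.
move=> [n [c [q [cc pE]]]]; exists n, c, (fun a => (q a)^`()); split => // y.
by rewrite pE linear_sum; apply: eq_bigr => a _; rewrite /= linearZ.
Qed.

Lemma cpoly_pint p q : cpoly p -> cpoly q ->
  continuous (fun y => pint (p y * q y)).
Proof.
move=> [n [c [r [cc pE]]]] cq.
have -> : (fun y => pint (p y * q y)) =
    fun y => \sum_a c a y * pint (r a * q y).
  apply/funext => y; rewrite pE (linear_form_sum (L := fun v => pint (v * q y)))//.
  by move=> a u v; rewrite mulrDl pintD -scalerAl pintZ.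
apply: cont_sum => a _; apply: contM => //.
apply: (@cpoly_linear (fun v => pint (r a * v))) => // b u v.
by rewrite mulrDr pintD -scalerAr pintZ.
Qed.

Lemma cpoly_cont2 p : cpoly p -> cont2 (fun x y => (p y).[x]).
Proof.
move=> [n [c [q [cc pE]]]].
have -> : (fun x y => (p y).[x]) = fun x y => \sum_a c a y * (q a).[x].
  apply/funext => x; apply/funext => y; rewrite pE horner_sum.
  by apply: eq_bigr => a _; rewrite hornerZ.
by cont.
Qed.

Lemma cpoly_dg1 N (W V : 'I_N -> R -> {poly R}) :
  (forall i, cpoly (W i)) -> (forall i, cpoly (V i)) ->
  continuous (fun y => dg1 (fun i => W i y) (fun i => V i y)).
Proof.
move=> cW cV; apply: cont_sum => i _.
have cW' j := cpoly_deriv (cW j); have cV' j := cpoly_deriv (cV j).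
have hW j x := @cpoly_horner x _ (cW j); have hV j x := @cpoly_horner x _ (cV j).
have hW' j x := @cpoly_horner x _ (cW' j); have hV' j x := @cpoly_horner x _ (cV' j).
apply: contD; first apply: contD; first exact: cpoly_pint.
  apply: contM; last exact: contB.
  by apply: contM; [exact: cont_cst|exact: contD].
apply: contM; last exact: contB.
by apply: contM; [exact: cont_cst|exact: contD].
Qed.

End PolynomialFamilies.

Definition unit_int2 {R : realType} (F : R -> R -> R) : R :=
  int1 0 1 (fun y => int1 0 1 (fun x => F x y)).

Lemma unit_int2C {R : realType} (F : R -> R -> R) : cont2 F ->
  unit_int2 F = int1 0 1 (fun x => int1 0 1 (F x)).
Proof. by move=> cF; rewrite /unit_int2 -int2E// int2Er. Qed.

Section RowResidual.
Context {R : realType}.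
Variables (k : nat) (node : 'I_k.+3 -> R) (lam : 'I_k.+3 -> {poly R}).
Hypothesis hk : (1 <= k)%N.
Hypothesis hP : quasi_projector node lam.

Local Notation P := (quasi_interp node lam).

(* H is the tower of vertical derivatives of F i 2.  The first interpolation
   error is measured by F i (k + 3); what remains is the interpolation error g
   in the other variable, for which two derivatives suffice. *)
Lemma row_residual : exists2 C : R, 0 <= C &
  forall N (F H : 'I_N -> nat -> R -> R -> R) (V : 'I_N -> R -> {poly R}) (e : R),
  0 < e ->
  (forall i n, cont2 (F i n)) -> (forall i y, tower (fun n x => F i n x y)) ->
  (forall i n x y, F (ordS i) n x y = F i n (x + 1) y) ->
  (forall i n, cont2 (H i n)) -> (forall i x, tower (fun n y => H i n x y)) ->
  (forall i x y, H i 0%N x y = F i 2%N x y) ->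
  (forall i, cpoly (V i)) -> (forall i y, (size (V i y) <= k.+1)%N) ->
  `|int1 0 1 (fun y =>
      dg1 (fun i => P (fun x => (P (F i 0%N x)).[y])) (fun i => V i y)
      + \sum_i int1 0 1 (fun x => F i 2%N x y * (V i y).[x]))|
  <= e^-1 * C * (\sum_i unit_int2 (fun x y => F i k.+3 x y ^+ 2)
                 + \sum_i unit_int2 (fun x y => H i k.+1 x y ^+ 2))
     + e * (\sum_i unit_int2 (fun x y => (V i y).[x] ^+ 2)).
Proof.
have [C1 C10 HC1] := dg1_residual hk hP (s := k.+3) (leqnn _).
have [C2 C20 HC2] := dg1_residual hk hP (s := 2%N) isT.
have [C3 C30 HC3] := interp_approx hP (s := k.+1) (leqnn _).
exists (3 * (C1 + (C2 + 1) * C3)) => [|N F H V e e0 cF tF FS cH tH H0 cV sV].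
  by rewrite mulr_ge0// addr_ge0// mulr_ge0// addr_ge0.
pose g i n x y := (P (F i n x)).[y] - F i n x y.
have gE i n x y : g i n x y =
    \sum_m (lam m).[y] * F i n x (node m) - F i n x y.
  by rewrite /g horner_interp; congr (_ - _); apply: eq_bigr => m _; rewrite mulrC.
have cg i n : cont2 (g i n).
  have -> : g i n = fun x y => \sum_m (lam m).[y] * F i n x (node m) - F i n x y.
    by apply/funext => x; apply/funext => y; rewrite gE.
  have cFin := cF i n; by cont.
have tg i y : tower (fun n x => g i n x y).
  have -> : (fun n x => g i n x y) =
      fun n x => \sum_m (lam m).[y] * F i n x (node m) - F i n x y.
    by apply/funext => n; apply/funext => x; rewrite gE.
  by apply: towerB => //; apply: tower_sum => m; exact: towerZ.
have gS i n x y : g (ordS i) n x y = g i n (x + 1) y.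
  by rewrite !gE FS; congr (_ - _); apply: eq_bigr => m _; rewrite FS.
have cVx i y : continuous (fun x => (V i y).[x]) by exact: continuous_horner.
have cV2 i := cpoly_cont2 (cV i).
have cFx i n y : continuous (fun x => F i n x y) by have cFin := cF i n; cont.
have cgx i n y : continuous (fun x => g i n x y) by have cFin := cg i n; cont.
(* Young's inequality is used three times: for the residual of [F], for the residual of [g], and for
   the integral of [g i 2] against [V], which has to be removed from the latter residual. *)
have e3 : 0 < e / 3 by rewrite divr_gt0.
have pw y : `|dg1 (fun i => P (fun x => (P (F i 0%N x)).[y])) (fun i => V i y)
      + \sum_i int1 0 1 (fun x => F i 2%N x y * (V i y).[x])| <=
    (e / 3)^-1 * (C1 * (\sum_i int1 0 1 (fun x => F i k.+3 x y ^+ 2))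
      + (C2 + 1) * (\sum_i int1 0 1 (fun x => g i 2%N x y ^+ 2)))
    + e * (\sum_i int1 0 1 (fun x => (V i y).[x] ^+ 2)).
  have := HC1 N (fun i n x => F i n x y) (fun i => V i y) _ e3
    (fun i => tF i y) (fun i n x => FS i n x y) (fun i => sV i y).
  have := HC2 N (fun i n x => g i n x y) (fun i => V i y) _ e3
    (fun i => tg i y) (fun i n x => gS i n x y) (fun i => sV i y).
  have : `|\sum_i int1 0 1 (fun x => g i 2%N x y * (V i y).[x])| <=
      (e / 3)^-1 * 1 * (\sum_i int1 0 1 (fun x => g i 2%N x y ^+ 2))
      + e / 3 * (\sum_i int1 0 1 (fun x => (V i y).[x] ^+ 2)).
    rewrite !mulr_sumr -big_split/=.
    apply: (le_trans (ler_norm_sum _ _ _)); apply: ler_sum => i _.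
    apply: sqr_le_AMGM => //.
    - by apply: int1_ge0 => x _; exact: sqr_ge0.
    - by apply: int1_ge0 => x _; exact: sqr_ge0.
    - by rewrite mul1r; exact: int1_CS.
  have -> : (fun i => P (fun x => (P (F i 0%N x)).[y])) =
      fun i => P (fun x => F i 0%N x y) + P (fun x => g i 0%N x y).
    apply/funext => i; rewrite -interpD; congr quasi_interp.
    by apply/funext => x; rewrite /g addrC subrK.
  rewrite dg1D.
  set B := dg1 _ _; set A := dg1 _ _.
  set X := \sum_i int1 0 1 (fun x => F i 2%N x y * _).
  set Y := \sum_i int1 0 1 (fun x => g i 2%N x y * _).
  set u := \sum_i _; set v := \sum_i _; set w := \sum_i _.
  move=> h1 h2 h3.
  have -> : A + B + X = (A + X) + (B + Y) - Y by ring.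
  apply: (le_trans (ler_normB _ _)).
  apply: (le_trans (lerD (ler_normD _ _) (lexx _))).
  apply: (le_trans (lerD (lerD h3 h2) h1)).
  rewrite le_eqVlt; apply/orP; left; apply/eqP.
  by field; exact: lt0r_neq0.
have cW i : cpoly (fun y => P (fun x => (P (F i 0%N x)).[y])).
  exists k.+3, (fun a y => (P (F i 0%N (node a))).[y]), lam.
  by split => [a|y //]; exact: continuous_horner.
set S1 := \sum_i unit_int2 (fun x y => F i k.+3 x y ^+ 2).
set S2 := \sum_i unit_int2 (fun x y => H i k.+1 x y ^+ 2).
have cS (G : 'I_N -> R -> R -> R) : (forall i, cont2 (G i)) ->
    continuous (fun y => \sum_i int1 0 1 (fun x => G i x y)).
  by move=> cG; apply: cont_sum => i _; have cGi := cG i; cont.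
have c1 : continuous (fun y => \sum_i int1 0 1 (fun x => F i k.+3 x y ^+ 2)).
  by apply: (cS (fun i x y => F i k.+3 x y ^+ 2)) => i; have cFi := cF i k.+3; cont.
have c2 : continuous (fun y => \sum_i int1 0 1 (fun x => g i 2%N x y ^+ 2)).
  by apply: (cS (fun i x y => g i 2%N x y ^+ 2)) => i; have cFi := cg i 2%N; cont.
have c3 : continuous (fun y => \sum_i int1 0 1 (fun x => (V i y).[x] ^+ 2)).
  apply: (cS (fun i x y => (V i y).[x] ^+ 2)) => i.
  by apply: contX; exact: cV2.
apply: (le_trans (int1_norm _ _ (fun y _ => pw y))).
- apply: contD; first exact: cpoly_dg1.
  apply: (cS (fun i x y => F i 2%N x y * (V i y).[x])) => i.
  by apply: contM; [exact: cF|exact: cV2].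
- apply: contD; last by apply: contM => //; exact: cont_cst.
  apply: contM; first exact: cont_cst.
  by apply: contD; apply: contM => //; exact: cont_cst.
have cc (c : R) (h : R -> R) : continuous h -> continuous (fun y => c * h y).
  by move=> ch; apply: contM => //; exact: cont_cst.
have lin (a b c d : R) (s1 s2 s3 : R -> R) :
    continuous s1 -> continuous s2 -> continuous s3 ->
    int1 0 1 (fun y => a * (b * s1 y + c * s2 y) + d * s3 y) =
    a * (b * int1 0 1 s1 + c * int1 0 1 s2) + d * int1 0 1 s3.
  move=> k1 k2 k3; rewrite int1D; [|by cont|by cont].
  rewrite (int1Z _ _ a); last by cont.
  by rewrite int1D; [rewrite !int1Z|cont|cont].
rewrite lin//.
have sumE (G : 'I_N -> R -> R -> R) : (forall i, cont2 (G i)) ->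
    int1 0 1 (fun y => \sum_i int1 0 1 (fun x => G i x y)) =
    \sum_i unit_int2 (G i).
  by move=> cG; rewrite int1_sum// => i; have cGi := cG i; cont.
have cF2 i : cont2 (fun x y => F i k.+3 x y ^+ 2) by have cFi := cF i k.+3; cont.
have cg2 i : cont2 (fun x y => g i 2%N x y ^+ 2) by have cFi := cg i 2%N; cont.
have cV3 i : cont2 (fun x y => (V i y).[x] ^+ 2) by apply: contX; exact: cV2.
rewrite (sumE _ cF2) (sumE _ cg2) (sumE _ cV3).
have G2 : \sum_i unit_int2 (fun x y => g i 2%N x y ^+ 2) <= C3 * S2.
  rewrite /S2 mulr_sumr; apply: ler_sum => i _.
  have cHi : cont2 (fun x y => H i k.+1 x y ^+ 2) by have cFi := cH i k.+1; cont.
  rewrite !unit_int2C// -int1Z; last by cont.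
  apply: int1_le => [||x _].
  - by have cgi := cg2 i; cont.
  - by cont.
  have := HC3 (fun n y => H i n x y) (tH i x).
  rewrite (eq_int1 (g := fun y => g i 2%N x y ^+ 2))// => y _.
  by rewrite /g (_ : H i 0%N x = F i 2%N x)//; apply/funext => z.
have S10 : 0 <= S1.
  apply: sumr_ge0 => i _; apply: int1_ge0 => y _; apply: int1_ge0 => x _.
  exact: sqr_ge0.
have S20 : 0 <= S2.
  apply: sumr_ge0 => i _; apply: int1_ge0 => y _; apply: int1_ge0 => x _.
  exact: sqr_ge0.
rewrite -/S1; clearbody S1 S2; rewrite lerD2r.
have -> : e^-1 * (3 * (C1 + (C2 + 1) * C3)) * (S1 + S2) = (e / 3)^-1 *
  ((C1 + (C2 + 1) * C3) * (S1 + S2)) by field; exact: lt0r_neq0.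
apply: ler_wpM2l; first by rewrite invr_ge0 ltW.
apply: (@le_trans _ _ (C1 * S1 + (C2 + 1) * (C3 * S2))).
  by rewrite lerD2l ler_wpM2l// addr_ge0.
have : 0 <= C1 * S2 by exact: mulr_ge0.
have : 0 <= (C2 + 1) * C3 * S1 by apply: mulr_ge0 => //; apply: mulr_ge0 => //; exact: addr_ge0.
lra.
Qed.

End RowResidual.

(** * Smooth functions of two variables *)

Section PlaneSmoothness.
Context {R : realType}.
Implicit Types (v w : R -> R -> R).

Definition derivable2 v := forall x y : R,
  derivable (fun s => v s y) x 1 /\ derivable (fun s => v x s) y 1.

Fixpoint Sn n v : Prop := cont2 v /\
  (if n is n'.+1 then [/\ derivable2 v, Sn n' (dx v) & Sn n' (dy v)] else True).

Definition smooth2 v := forall n, Sn n v.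

Lemma smooth2_cont v : smooth2 v -> cont2 v.
Proof. by move=> /(_ 0%N)[]. Qed.

Lemma smooth2_dx v : smooth2 v -> smooth2 (dx v).
Proof. by move=> sv n; have [_ []] := sv n.+1. Qed.

Lemma smooth2_dy v : smooth2 v -> smooth2 (dy v).
Proof. by move=> sv n; have [_ []] := sv n.+1. Qed.

Lemma smooth2_iter v a b : smooth2 v -> smooth2 (iter a dx (iter b dy v)).
Proof.
move=> sv; elim: a => [|a IHa] /=; last exact: smooth2_dx.
by elim: b => [|b IHb] //=; exact: smooth2_dy.
Qed.

Lemma smooth2_is_derive_x v x y : smooth2 v ->
  is_derive (x : R) (1 : R) (fun s => v s y) (dx v x y).
Proof.
move=> /(_ 1%N)[_ [/(_ x y)[dv _] _ _]].
by rewrite /dx derive1E; exact: derivableP.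
Qed.

Lemma smooth2_is_derive_y v x y : smooth2 v ->
  is_derive (y : R) (1 : R) (fun s => v x s) (dy v x y).
Proof.
move=> /(_ 1%N)[_ [/(_ x y)[_ dv] _ _]].
by rewrite /dy derive1E; exact: derivableP.
Qed.

Lemma dx_eq v (w : R -> R -> R) :
  (forall x y : R, is_derive x (1 : R) (fun s => v s y) (w x y)) -> dx v = w.
Proof.
move=> h; apply/funext => x; apply/funext => y.
by rewrite /dx derive1E; have [_ ->] := h x y.
Qed.

Lemma dy_eq v (w : R -> R -> R) :
  (forall x y : R, is_derive y (1 : R) (fun s => v x s) (w x y)) -> dy v = w.
Proof.
move=> h; apply/funext => x; apply/funext => y.
by rewrite /dy derive1E; have [_ ->] := h x y.
Qed.

Lemma tower_dx v y : smooth2 v -> tower (fun n x => iter n dx v x y).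
Proof.
move=> sv n x; apply: smooth2_is_derive_x.
exact: (@smooth2_iter v n 0 sv).
Qed.

Lemma smooth2_iter_dy v b : smooth2 v -> smooth2 (iter b dy v).
Proof. by move=> sv; exact: (@smooth2_iter v 0 b sv). Qed.

Lemma tower_dy v x : smooth2 v -> tower (fun n y => iter n dy v x y).
Proof. by move=> sv n y; apply: smooth2_is_derive_y; exact: smooth2_iter_dy. Qed.

Lemma is_derive_lin (f g : R -> R) (x f' g' a b : R) :
  is_derive x (1 : R) f f' -> is_derive x (1 : R) g g' ->
  is_derive x (1 : R) (fun s => a * f s + b * g s) (a * f' + b * g').
Proof.
move=> df dg.
exact: (is_deriveD (is_deriveZ a df) (is_deriveZ b dg)).
Qed.

Lemma dx_lin v w a b : smooth2 v -> smooth2 w ->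
  dx (fun x y => a * v x y + b * w x y) = fun x y => a * dx v x y + b * dx w x y.
Proof.
by move=> sv sw; apply: dx_eq => x y; apply: is_derive_lin;
  exact: smooth2_is_derive_x.
Qed.

Lemma dy_lin v w a b : smooth2 v -> smooth2 w ->
  dy (fun x y => a * v x y + b * w x y) = fun x y => a * dy v x y + b * dy w x y.
Proof.
by move=> sv sw; apply: dy_eq => x y; apply: is_derive_lin;
  exact: smooth2_is_derive_y.
Qed.

Lemma smooth2_lin v w a b : smooth2 v -> smooth2 w ->
  smooth2 (fun x y => a * v x y + b * w x y).
Proof.
move=> + + n; elim: n v w => [|n IHn] v w sv sw; split=> //.
- have := smooth2_cont sv; have := smooth2_cont sw; by move=> ? ?; cont.
- have := smooth2_cont sv; have := smooth2_cont sw; by move=> ? ?; cont.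
split; last 2 first.
- by rewrite dx_lin//; apply: IHn; exact: smooth2_dx.
- by rewrite dy_lin//; apply: IHn; exact: smooth2_dy.
move=> x y; split.
  have [] // := is_derive_lin a b (smooth2_is_derive_x x y sv)
                              (smooth2_is_derive_x x y sw).
have [] // := is_derive_lin a b (smooth2_is_derive_y x y sv)
                            (smooth2_is_derive_y x y sw).
Qed.

Lemma iter_dx_lin v w a b n : smooth2 v -> smooth2 w ->
  iter n dx (fun x y => a * v x y + b * w x y) =
  fun x y => a * iter n dx v x y + b * iter n dx w x y.
Proof.
move=> sv sw; elim: n => [//|n /= ->]; apply: dx_lin.
  exact: (@smooth2_iter v n 0 sv).
exact: (@smooth2_iter w n 0 sw).
Qed.

Lemma iter_dy_lin v w a b n : smooth2 v -> smooth2 w ->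
  iter n dy (fun x y => a * v x y + b * w x y) =
  fun x y => a * iter n dy v x y + b * iter n dy w x y.
Proof.
move=> sv sw; elim: n => [//|n /= ->]; apply: dy_lin; exact: smooth2_iter_dy.
Qed.

Lemma mvt (f f' : R -> R) (a b : R) : a < b ->
  (forall x : R, is_derive x (1 : R) f (f' x)) ->
  exists2 c, a < c < b & f b - f a = f' c * (b - a).
Proof.
move=> ab df; have cf : {within `[a, b], continuous f}.
  by apply: continuous_subspaceT; exact: is_derive_cont df.
have [c cab E] := MVT ab (fun x _ => df x) cf.
by exists c => //; move: cab; rewrite in_itv.
Qed.

Lemma no_midpoint (A B Z : R) :
  `|A - Z| < `|A - B| / 2 -> `|B - Z| < `|A - B| / 2 -> False.
Proof.
have := ler_distD Z A B; rewrite (distrC Z B).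
by set a := `|_|; set b := `|_|; set c := `|_|; lra.
Qed.

(** The second difference of [v] over a small square, divided by its area, is a value of either
    mixed derivative inside the square, by the mean value theorem in the two orders. By continuity
    both derivatives at the corner are close to this one number. *)
Lemma schwarz v : smooth2 v -> dx (dy v) = dy (dx v).
Proof.
move=> sv; apply/funext => x; apply/funext => y; apply/eqP.
apply/negP => /negP AB.
set A := dx (dy v) x y in AB *; set B := dy (dx v) x y in AB *.
pose e := `|A - B| / 2.
have e0 : 0 < e by rewrite divr_gt0// normr_gt0 subr_eq0.
have near (w : R -> R -> R) : cont2 w -> exists2 d : R, 0 < d &
    forall s t, x < s < x + d -> y < t < y + d -> `|w x y - w s t| < e.
  move=> cw; have /cvgrPdist_lt/(_ e e0)/nbhs_ballP[/= d d0 dP] := cw (x, y).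
  exists d => // s t /andP[xs sd] /andP[yt td]; apply: (dP (s, t)).
  by split; rewrite /ball /= ltr_distlC; apply/andP; split; lra.
have [d1 d10 H1] := near _ (smooth2_cont (smooth2_dx (smooth2_dy sv))).
have [d2 d20 H2] := near _ (smooth2_cont (smooth2_dy (smooth2_dx sv))).
pose d := Num.min d1 d2 / 2.
have d0 : 0 < d by rewrite divr_gt0// lt_min d10.
have dd1 : d < d1.
  by rewrite /d ltr_pdivrMr// (le_lt_trans (_ : _ <= d1)) ?ge_min ?lexx//; lra.
have dd2 : d < d2.
  by rewrite /d ltr_pdivrMr// (le_lt_trans (_ : _ <= d2)) ?ge_min ?lexx ?orbT//; lra.
have xd : x < x + d by rewrite ltrDl.
have yd : y < y + d by rewrite ltrDl.
pose D := v (x + d) (y + d) - v (x + d) y - (v x (y + d) - v x y).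
have [s1 s1I E1] := mvt xd (fun s => is_deriveB
  (smooth2_is_derive_x s (y + d) sv) (smooth2_is_derive_x s y sv)).
have [t1 t1I F1] := mvt yd (fun t => smooth2_is_derive_y s1 t (smooth2_dx sv)).
have [t2 t2I E2] := mvt yd (fun t => is_deriveB
  (smooth2_is_derive_y (x + d) t sv) (smooth2_is_derive_y x t sv)).
have [s2 s2I F2] := mvt xd (fun s => smooth2_is_derive_x s t2 (smooth2_dy sv)).
have xdE : x + d - x = d by ring.
have ydE : y + d - y = d by ring.
rewrite xdE in E1 F2; rewrite ydE in F1 E2.
have D1 : D = dy (dx v) s1 t1 * d * d.
  rewrite -F1; exact: E1.
have D2 : D = dx (dy v) s2 t2 * d * d.
  rewrite -F2; transitivity (v (x + d) (y + d) - v x (y + d)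
    - (v (x + d) y - v x y)); first by rewrite /D; ring.
  exact: E2.
have dn0 := lt0r_neq0 d0.
have EQ : dy (dx v) s1 t1 = dx (dy v) s2 t2.
  exact: (mulIf dn0 (mulIf dn0 (etrans (esym D1) D2))).
have b1 : `|A - dx (dy v) s2 t2| < e by apply: H1; lra.
have b2 : `|B - dx (dy v) s2 t2| < e by rewrite -EQ; apply: H2; lra.
exact: no_midpoint b1 b2.
Qed.

Lemma iter_dy_dx v n : smooth2 v -> iter n dy (dx v) = dx (iter n dy v).
Proof.
move=> sv; elim: n => [//|n /= ->]; rewrite schwarz//.
exact: smooth2_iter_dy.
Qed.

End PlaneSmoothness.

(** * Periodic functions and the Laplacian *)

Section Periodicity.
Context {R : realType}.
Implicit Types (v g : R -> R -> R).

Definition perx (L : R) v := forall x y, v (x + L) y = v x y.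
Definition pery (L : R) v := forall x y, v x (y + L) = v x y.

Lemma is_derive_shift (f : R -> R) (x L d : R) :
  is_derive (x + L) (1 : R) f d -> is_derive x (1 : R) (fun s => f (s + L)) d.
Proof.
move=> df.
have dG := is_derive_affine L 1 x.
have dF : is_derive (L + 1 * x) (1 : R) f d by rewrite mul1r addrC.
have := @is_derive1_comp R f (fun s : R => L + 1 * s) x _ _ dF dG.
rewrite mulr1; congr (is_derive _ _ _ _).
by apply/funext => s /=; rewrite mul1r addrC.
Qed.

Lemma is_derive_unique (f : R -> R) (x d1 d2 : R) :
  is_derive x (1 : R) f d1 -> is_derive x (1 : R) f d2 -> d1 = d2.
Proof. by move=> [_ <-] [_ <-]. Qed.

Lemma perx_dx L v : smooth2 v -> perx L v -> perx L (dx v).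
Proof.
move=> sv pv x y; apply: (@is_derive_unique (fun s => v s y) x); last first.
  exact: smooth2_is_derive_x.
have := is_derive_shift (smooth2_is_derive_x (x + L) y sv).
by congr (is_derive _ _ _ _); apply/funext => s; rewrite pv.
Qed.

Lemma perx_dy L v : perx L v -> perx L (dy v).
Proof.
by move=> pv x y; rewrite /dy; congr derive1; apply/funext => s; rewrite pv.
Qed.

Lemma pery_dy L v : smooth2 v -> pery L v -> pery L (dy v).
Proof.
move=> sv pv x y; apply: (@is_derive_unique (fun s => v x s) y); last first.
  exact: smooth2_is_derive_y.
have := is_derive_shift (smooth2_is_derive_y x (y + L) sv).
by congr (is_derive _ _ _ _); apply/funext => s; rewrite pv.
Qed.

Lemma pery_dx L v : pery L v -> pery L (dx v).
Proof.
by move=> pv x y; rewrite /dx; congr derive1; apply/funext => s; rewrite pv.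
Qed.

Lemma lapE v x y : lap v x y = dx (dx v) x y + dy (dy v) x y.
Proof. by []. Qed.

(* Unification must not see through these. *)
Opaque dx dy lap.

Lemma perx_iter L v a b : smooth2 v -> perx L v ->
  perx L (iter a dx (iter b dy v)).
Proof.
move=> sv pv; elim: a => [|a IHa] /=.
  by elim: b => [//|b IHb]; exact: perx_dy.
by apply: perx_dx => //; exact: smooth2_iter.
Qed.

Lemma pery_iter L v a b : smooth2 v -> pery L v ->
  pery L (iter a dx (iter b dy v)).
Proof.
move=> sv pv; elim: a => [|a IHa] /=; last exact: pery_dx.
elim: b => [//|b IHb] /=; apply: pery_dy => //.
exact: smooth2_iter_dy.
Qed.

Lemma int1_parts_periodic (f g f' g' : R -> R) (a b : R) : a <= b ->
  (forall x : R, is_derive x (1 : R) f (f' x)) ->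
  (forall x : R, is_derive x (1 : R) g (g' x)) ->
  continuous f' -> continuous g' -> f b * g b = f a * g a ->
  int1 a b (fun x => f' x * g x) = - int1 a b (fun x => f x * g' x).
Proof.
move=> ab df dg cf' cg' fg.
have cf : continuous f := is_derive_cont df.
have cg : continuous g := is_derive_cont dg.
have dfg (x : R) : is_derive x (1 : R) (fun s => f s * g s) (f x * g' x + g x * f' x).
  exact: (is_deriveM (df x) (dg x)).
have := int1_ftc ab dfg (ltac:(cont)).
rewrite fg subrr int1D; [|by cont|by cont].
rewrite (eq_int1 (f := fun x => g x * f' x) (g := fun x => f' x * g x)).
  by move/eqP; rewrite addrC addr_eq0 => /eqP.
by move=> x _; rewrite mulrC.
Qed.

(** Integration by parts in [x] and then in [y], with boundary terms cancelled by periodicity, turns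
    the integral into that of the square of the mixed derivative. *)
Lemma lap_dxx_ge0 g (a b c d : R) : smooth2 g -> a < b -> c < d ->
  perx (b - a) g -> pery (d - c) g ->
  0 <= int2 a b c d (fun x y => dx (dx g) x y * dy (dy g) x y).
Proof.
move=> sg ab cd pxg pyg.
have sx := smooth2_dx sg; have sy := smooth2_dy sg.
have sxx := smooth2_dx sx; have syy := smooth2_dy sy.
have sxy := smooth2_dx sy; have sxyy := smooth2_dx syy.
have sxxy := smooth2_dy sxy.
have cx := smooth2_cont sx; have cxx := smooth2_cont sxx.
have cyy := smooth2_cont syy; have cxyy := smooth2_cont sxyy.
have cxy := smooth2_cont sxy.
rewrite int2E; last by cont.
have Ex y : int1 a b (fun x => dx (dx g) x y * dy (dy g) x y) =
    int1 a b (fun x => - (dx g x y * dx (dy (dy g)) x y)).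
  rewrite (@int1N _ (fun x => dx g x y * dx (dy (dy g)) x y)); last by cont.
  apply: (@int1_parts_periodic (fun x => dx g x y) (fun x => dy (dy g) x y)
    (fun x => dx (dx g) x y) (fun x => dx (dy (dy g)) x y)) => [|x|x|||].
  - exact: ltW.
  - exact: smooth2_is_derive_x.
  - exact: smooth2_is_derive_x.
  - by cont.
  - by cont.
  have -> : b = a + (b - a) by ring.
  rewrite (perx_dx sg pxg).
  by rewrite (perx_dy (perx_dy pxg)).
have -> : (fun y => int1 a b (fun x => dx (dx g) x y * dy (dy g) x y)) =
    fun y => int1 a b (fun x => - (dx g x y * dx (dy (dy g)) x y)).
  by apply/funext => y.
rewrite -(int2E (F := fun x y => - (dx g x y * dx (dy (dy g)) x y))); last by cont.
rewrite int2Er; last by cont.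
apply: int1_ge0 => x _.
have -> : int1 c d (fun y => - (dx g x y * dx (dy (dy g)) x y)) =
    int1 c d (fun y => dx (dy g) x y * dx (dy g) x y).
  rewrite (@int1N _ (fun y => dx g x y * dx (dy (dy g)) x y)); last by cont.
  apply/esym; rewrite (schwarz sy).
  apply: (@int1_parts_periodic (fun y => dx g x y) (fun y => dx (dy g) x y)
    (fun y => dx (dy g) x y) (fun y => dy (dx (dy g)) x y)) => [|y|y|||].
  - exact: ltW.
  - by rewrite (schwarz sg); exact: smooth2_is_derive_y.
  - exact: smooth2_is_derive_y.
  - by cont.
  - by have cc := smooth2_cont sxxy; cont.
  have -> : d = c + (d - c) by ring.
  rewrite (pery_dx pyg).
  by rewrite (pery_dx (pery_dy sg pyg)).
by apply: int1_ge0 => y _; exact: sqr_ge0.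
Qed.

Lemma int2_lin_ge0 (F G H : R -> R -> R) a b c d :
  cont2 F -> cont2 G -> cont2 H ->
  int2 a b c d (fun x y => F x y + 2 * G x y + H x y) =
  int2 a b c d F + 2 * int2 a b c d G + int2 a b c d H.
Proof.
move=> cF cG cH; rewrite !int2E//; last by cont.
rewrite -int1Z; last by cont.
rewrite -!int1D; [|by cont..].
apply: eq_int1 => y _; rewrite -int1Z; last by cont.
by rewrite -!int1D//; cont.
Qed.

Lemma int2_ge0 (F : R -> R -> R) a b c d : cont2 F ->
  (forall x y, 0 <= F x y) -> 0 <= int2 a b c d F.
Proof.
move=> cF F0; rewrite int2E//.
by apply: int1_ge0 => y _; apply: int1_ge0 => x _.
Qed.

Lemma dominated_by_sum (A B C : R) : 0 <= A -> 0 <= B -> 0 <= C ->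
  B <= B + 2 * C + A /\ A <= B + 2 * C + A.
Proof. by split; lra. Qed.

(** The cross term in the square of the Laplacian has a nonnegative integral, by [lap_dxx_ge0]. *)
Lemma lap_dominates g (a b c d : R) : smooth2 g -> a < b -> c < d ->
  perx (b - a) g -> pery (d - c) g ->
  int2 a b c d (fun x y => dx (dx g) x y ^+ 2) <=
    int2 a b c d (fun x y => lap g x y ^+ 2) /\
  int2 a b c d (fun x y => dy (dy g) x y ^+ 2) <=
    int2 a b c d (fun x y => lap g x y ^+ 2).
Proof.
move=> sg ab cd pxg pyg; have := lap_dxx_ge0 sg ab cd pxg pyg.
have cxx := smooth2_cont (smooth2_dx (smooth2_dx sg)).
have cyy := smooth2_cont (smooth2_dy (smooth2_dy sg)).
have -> : int2 a b c d (fun x y => lap g x y ^+ 2) =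
  int2 a b c d (fun x y => dx (dx g) x y ^+ 2) +
  2 * int2 a b c d (fun x y => dx (dx g) x y * dy (dy g) x y) +
  int2 a b c d (fun x y => dy (dy g) x y ^+ 2).
  rewrite -int2_lin_ge0; [|by cont|by cont|by cont].
  by apply: eq_int2 => x y _ _; rewrite lapE; ring.
have : 0 <= int2 a b c d (fun x y => dx (dx g) x y ^+ 2).
  by apply: int2_ge0 => [|x y]; [cont|exact: sqr_ge0].
have : 0 <= int2 a b c d (fun x y => dy (dy g) x y ^+ 2).
  by apply: int2_ge0 => [|x y]; [cont|exact: sqr_ge0].
exact: dominated_by_sum.
Qed.

End Periodicity.

(** * Time slices of smooth functions *)

Section SpaceTimeSmoothness.
Context {R : realType}.
Variable T : R.
Implicit Types u : R -> R -> R -> R.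

Lemma smooth_dt u : smooth T u -> smooth T (dt T u).
Proof. by move=> su n; have [_ []] := su n.+1. Qed.

Lemma smooth_dx u : smooth T u -> smooth T (fun t => dx (u t)).
Proof. by move=> su n; have [_ []] := su n.+1. Qed.

Lemma smooth_dy u : smooth T u -> smooth T (fun t => dy (u t)).
Proof. by move=> su n; have [_ []] := su n.+1. Qed.

Lemma smooth_iter u a b : smooth T u ->
  smooth T (fun t => iter a dx (iter b dy (u t))).
Proof.
move=> su; elim: a => [|a IHa] /=; last exact: (smooth_dx IHa).
by elim: b => [//|b IHb] /=; exact: (smooth_dy IHb).
Qed.

Lemma smooth_smooth2 u t : smooth T u -> 0 <= t <= T -> smooth2 (u t).
Proof.
move=> su t0T.
have cont2_slice w :
    {within [set p : R * R * R | 0 <= p.1.1 <= T],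
       continuous (fun p : R * R * R => w p.1.1 p.1.2 p.2)} -> cont2 (w t).
  move=> /subspace_continuousP cw z; have wt := cw (t, z.1, z.2) t0T.
  pose phi (y : R * R) : R * R * R := (t, y.1, y.2).
  apply: (@cvg_comp _ _ _ phi (fun p => w p.1.1 p.1.2 p.2) _ _ _ _ wt).
  have cphi : phi y @[y --> z] --> phi z.
    have c1 : (fun y : R * R => (t, y.1)) y @[y --> z] --> (t, z.1).
      exact: (cvg_pair (cvg_cst t) cvg_fst).
    exact: (cvg_pair c1 cvg_snd).
  move=> P wP; have H : nbhs z (phi @^-1` (fun p => 0 <= p.1.1 <= T -> P p)).
    exact: cphi wP.
  have : nbhs z (phi @^-1` P) by apply: filterS H => y /(_ t0T).
  exact.
move=> n; move: (su n); elim: n u {su} => [|n IHn] u /= [cu su]; split => //.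
- exact: cont2_slice.
- exact: cont2_slice.
case: su => du _ sx sy; split; [|exact: (IHn (fun t => dx (u t)))
  |exact: (IHn (fun t => dy (u t)))].
move=> x y; have [_ dux duy] := du t x y t0T.
by split; [exact: dux|exact: duy].
Qed.

Lemma smooth_bounded u (a b c d : R) : smooth T u -> exists2 M : R, 0 <= M &
  forall t x y, 0 <= t <= T -> a <= x <= b -> c <= y <= d -> `|u t x y| <= M.
Proof.
move=> su; pose K := [set` `[0, T]] `*` [set` `[a, b]] `*` [set` `[c, d]]
  : set (R * R * R).
have cK : compact K by do 2?apply: compact_setX; exact: segment_compact.
have [cu _] := su 0%N.
have cuK : {within K, continuous (fun p : R * R * R => u p.1.1 p.1.2 p.2)}.
  apply: continuous_subspaceW cu => -[[t x] y] /= [[]].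
  by rewrite /= in_itv.
have /compact_bounded[M [_ HM]] :
    compact [set (u p.1.1 p.1.2 p.2 : R^o) | p in K].
  exact: continuous_compact cuK cK.
exists (`|M| + 1) => [|t x y tT xab ycd]; first by rewrite addr_ge0.
apply: (HM (`|M| + 1)); first by rewrite ltr_pwDr// ler_norm.
by exists (t, x, y).
Qed.

End SpaceTimeSmoothness.

(** * Tensor-product polynomials on the grid *)

Section TensorPolynomials.
Context {R : realType}.
Implicit Types (f g : R -> R -> R) (p q : {poly R}).

Lemma Qpoly_eq k f g : (forall x y, f x y = g x y) -> Qpoly k f -> Qpoly k g.
Proof. by move=> fg [c cP]; exists c => x y; rewrite -fg. Qed.

Lemma QpolyD k f g a b : Qpoly k f -> Qpoly k g ->
  Qpoly k (fun x y => a * f x y + b * g x y).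
Proof.
move=> [c cP] [d dP]; exists (a *: c + b *: d) => x y.
rewrite cP dP !mulr_sumr -big_split/=; apply: eq_bigr => i _.
rewrite !mulr_sumr -big_split/=; apply: eq_bigr => j _.
by rewrite !mxE; ring.
Qed.

Lemma Qpoly_prod k p q : (size p <= k.+1)%N -> (size q <= k.+1)%N ->
  Qpoly k (fun x y => p.[x] * q.[y]).
Proof.
move=> sp sq; exists (\matrix_(i, j) (p`_i * q`_j)) => x y.
rewrite (horner_coef_wide _ sp) (horner_coef_wide _ sq) mulr_suml.
apply: eq_bigr => i _; rewrite mulr_sumr; apply: eq_bigr => j _.
by rewrite mxE; ring.
Qed.

Lemma Qpoly0 k : Qpoly k (fun _ _ : R => 0).
Proof.
apply: Qpoly_eq (@Qpoly_prod k 0 0 _ _); rewrite ?size_poly0// => x y.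
by rewrite !horner0 mulr0.
Qed.

Lemma Qpoly_sum k n (f : 'I_n -> R -> R -> R) : (forall i, Qpoly k (f i)) ->
  Qpoly k (fun x y => \sum_i f i x y).
Proof.
move=> fQ; elim: n f fQ => [|n IHn] f fQ.
  by apply: Qpoly_eq (Qpoly0 k) => x y; rewrite big_ord0.
apply: Qpoly_eq (QpolyD 1 1 (IHn _ (fun i => fQ (widen_ord (leqnSn n) i)))
  (fQ ord_max)) => x y.
by rewrite big_ord_recr !mul1r.
Qed.

Lemma Qpoly_transpose k f : Qpoly k f -> Qpoly k (fun x y => f y x).
Proof.
move=> [c cP]; exists c^T => x y; rewrite cP exchange_big; apply: eq_bigr => i _.
by apply: eq_bigr => j _; rewrite mxE; ring.
Qed.

Lemma Qpoly_cont k f : Qpoly k f -> cont2 f.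
Proof.
move=> [c cP].
have -> : f = fun x y => \sum_(a < k.+1) \sum_(b < k.+1) c a b * x ^+ a * y ^+ b.
  by apply/funext => x; apply/funext => y; rewrite cP.
by cont.
Qed.

Lemma poly_ext p q : (forall x, p.[x] = q.[x]) -> p = q.
Proof.
move=> pq; apply/eqP; rewrite -subr_eq0; apply/eqP/poly_eq0_on01 => x _.
by rewrite hornerD hornerN pq subrr.
Qed.

(* V y is the horizontal slice of f in the coordinates of a reference cell. *)
Definition slices (x0 hx y0 hy : R) k f (V : R -> {poly R}) : Prop :=
  [/\ cpoly V, forall y, (size (V y) <= k.+1)%N,
      forall x y, f (x0 + hx * x) (y0 + hy * y) = (V y).[x] &
      forall x y, hx * dx f (x0 + hx * x) (y0 + hy * y) = (V y)^`().[x]].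

Lemma Qpoly_slices k f x0 hx y0 hy : Qpoly k f -> hx != 0 ->
  exists V, slices x0 hx y0 hy k f V.
Proof.
move=> [c cP] hx0.
pose p y : {poly R} := \sum_(a < k.+1) (\sum_(b < k.+1) c a b * y ^+ b) *: 'X^a.
have pE x y : f x y = (p y).[x].
  rewrite cP horner_sum; apply: eq_bigr => a _.
  rewrite hornerZ hornerXn mulr_suml; apply: eq_bigr => b _; ring.
pose q : {poly R} := hx *: 'X + x0%:P.
have qE x : q.[x] = x0 + hx * x by rewrite !hornerE addrC.
have sq : size q = 2.
  by rewrite size_polyDl size_scale ?size_polyX// (leq_ltn_trans (size_polyC_leq1 _)).
exists (fun y => p (y0 + hy * y) \Po q); split => [|y|x y|x y].
- exists k.+1, (fun a y => \sum_(b < k.+1) c a b * (y0 + hy * y) ^+ b),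
    (fun a => q ^+ a); split => [a|y]; first by cont.
  rewrite /p (raddf_sum (comp_poly q)); apply: eq_bigr => a _ /=.
  by rewrite comp_polyZ comp_Xn_poly.
- rewrite size_comp_poly2//; apply: (leq_trans (size_sum _ _ _)).
  apply/bigmax_leqP => a _; rewrite (leq_trans (size_scale_leq _ _))//.
  by rewrite size_polyXn.
- by rewrite horner_comp qE pE.
- rewrite deriv_comp hornerM horner_comp qE.
  have -> : q^`() = hx%:P.
    by rewrite derivD derivZ derivX derivC addr0 alg_polyC.
  rewrite hornerC mulrC; congr (_ * _).
  rewrite /dx derive1E.
  have -> : (fun s => f s (y0 + hy * y)) = horner (p (y0 + hy * y)).
    by apply/funext => s; rewrite pE.
  by have [_ ->] := is_derive_poly (p (y0 + hy * y)) (x0 + hx * x).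
Qed.

Lemma Qpoly_dx_cont k f : Qpoly k f -> cont2 (dx f).
Proof.
move=> fQ; have [V [cV _ _ dV]] := Qpoly_slices 0 0 1 fQ (oner_neq0 R).
have -> : dx f = fun x y => (V y)^`().[x].
  by apply/funext => x; apply/funext => y; rewrite -dV !mul1r !add0r.
exact/cpoly_cont2/cpoly_deriv.
Qed.

Lemma dx_transpose f : dx (fun x y => f y x) = fun x y => dy f y x.
Proof. by []. Qed.

Lemma dy_transpose f : dy (fun x y => f y x) = fun x y => dx f y x.
Proof. by []. Qed.

Lemma cont2_transpose f : cont2 f -> cont2 (fun x y => f y x).
Proof. by move=> cf; cont. Qed.

Lemma cont_int1_row f a b : cont2 f ->
  continuous (fun y => int1 a b (fun x => f x y)).
Proof. by move=> cf; cont. Qed.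

Lemma Qpoly_dy_cont k f : Qpoly k f -> cont2 (dy f).
Proof.
move=> /Qpoly_transpose/Qpoly_dx_cont; rewrite dx_transpose => cf.
exact: (cont2_transpose cf).
Qed.

End TensorPolynomials.

Section Grid.
Context {R : realType}.
Variables (Om : rect R) (N My : nat).
Hypotheses (hN : (0 < N)%N) (hMy : (0 < My)%N).
Implicit Types (f : R -> R -> R) (v w : broken N My (R := R)).

Local Notation hx := (Dx Om N).
Local Notation hy := (Dy Om My).
Local Notation Lx := (xhi Om - xlo Om).

Lemma Dx_gt0 : 0 < hx.
Proof. by rewrite divr_gt0// ?subr_gt0 ?xlo_lt// ltr0n. Qed.

Lemma Dy_gt0 : 0 < hy.
Proof. by rewrite divr_gt0// ?subr_gt0 ?ylo_lt// ltr0n. Qed.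

Lemma xr_xl (i : 'I_N) : xr Om i = xl Om i + hx.
Proof. by rewrite /xr /xl -natr1 mulrDl mul1r addrA. Qed.

Lemma yr_yl (j : 'I_My) : yr Om j = yl Om j + hy.
Proof. by rewrite /yr /yl -natr1 mulrDl mul1r addrA. Qed.

(** Periodicity matters for the last cell: its cyclic successor is the first cell, a full period to
    the left of the right neighbour. *)
Lemma xlS_periodic (g : R -> R) (i : 'I_N) s : (forall x, g (x + Lx) = g x) ->
  g (xl Om (ordS i) + s) = g (xl Om i + hx + s).
Proof.
move=> gL; rewrite -xr_xl /xl /xr /=.
have := ltn_ord i; rewrite leq_eqVlt => /predU1P[iN|iN]; last by rewrite modn_small.
rewrite iN modnn mul0r addr0 -[in LHS]gL; congr g.
by rewrite /Dx [N%:R * _]mulrC divfK ?pnatr_eq0 -?lt0n//; ring.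
Qed.

Lemma int1_cells n (a h : R) (g : R -> R) : continuous g -> 0 < h ->
  int1 a (a + n%:R * h) g = \sum_(i < n) int1 (a + i%:R * h) (a + i.+1%:R * h) g.
Proof.
move=> cg h0; elim: n => [|n IHn].
  by rewrite big_ord0 mul0r addr0 int1_set1.
rewrite big_ord_recr/= -IHn -int1_chasles//.
  by rewrite lerDl mulr_ge0// ltW.
by rewrite lerD2l ler_pM2r// ler_nat.
Qed.

Lemma cellintE (i : 'I_N) (j : 'I_My) f : cont2 f -> cellint Om i j f =
  hx * hy * unit_int2 (fun x y => f (xl Om i + hx * x) (yl Om j + hy * y)).
Proof.
move=> cf; rewrite /cellint int2E// xr_xl yr_yl int1_affine; last 2 first.
- by cont.
- exact: Dy_gt0.
rewrite [in RHS](mulrC hx hy) -[RHS]mulrA; apply: (congr1 ( *%R hy)); rewrite /unit_int2.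
rewrite -(@int1Z _ (fun y => int1 0 1 (fun x =>
    f (xl Om i + hx * x) (yl Om j + hy * y)))); last by cont.
apply: eq_int1 => y _; rewrite int1_affine//; last exact: Dx_gt0.
by cont.
Qed.

Lemma intOm_cells f : cont2 f ->
  intOm Om f = \sum_(i < N) \sum_(j < My) cellint Om i j f.
Proof.
move=> cf; rewrite /intOm int2E//.
have -> : yhi Om = ylo Om + My%:R * hy.
  by rewrite /Dy [My%:R * _]mulrC divfK ?pnatr_eq0 -?lt0n//; ring.
have -> : xhi Om = xlo Om + N%:R * hx.
  by rewrite /Dx [N%:R * _]mulrC divfK ?pnatr_eq0 -?lt0n//; ring.
rewrite int1_cells; [|by cont|exact: Dy_gt0].
rewrite exchange_big; apply: eq_bigr => j _.
rewrite -/(yl Om j) -/(yr Om j).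
transitivity (int1 (yl Om j) (yr Om j) (fun y =>
    \sum_(i < N) int1 (xl Om i) (xr Om i) (f^~ y))).
  by apply: eq_int1 => y _; rewrite int1_cells//; [cont|exact: Dx_gt0].
rewrite int1_sum => [|i]; last by cont.
by apply: eq_bigr => i _; rewrite /cellint int2E.
Qed.

End Grid.

(** * The horizontal part of the form in reference coordinates *)

Section HorizontalForm.
Context {R : realType}.
Variables (Om : rect R) (N My : nat).
Hypotheses (hN : (0 < N)%N) (hMy : (0 < My)%N).
Implicit Types (f : R -> R -> R) (v w : broken N My (R := R)).

Local Notation hx := (Dx Om N).
Local Notation hy := (Dy Om My).

Definition Aform_x w v : R :=
  \sum_(i < N) \sum_(j < My) cellint Om i j (fun x y =>
      bdx w i j x y * bdx v i j x y)
  + \sum_(i < N) \sum_(j < My) int1 (yl Om j) (yr Om j) (fun y =>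
      avgx Om (bdx w) i j y * jumpx Om v i j y
      + avgx Om (bdx v) i j y * jumpx Om w i j y).

Definition grid_slices k w (W : 'I_N -> 'I_My -> R -> {poly R}) : Prop :=
  forall i j, slices (xl Om i) hx (yl Om j) hy k (w i j) (W i j).

Lemma Qh_slices k w : Qh k w -> exists W, grid_slices k w W.
Proof.
move=> wQ; have hx0 : hx != 0 by apply/lt0r_neq0/Dx_gt0.
have H (ij : 'I_N * 'I_My) : exists V,
    slices (xl Om ij.1) hx (yl Om ij.2) hy k (w ij.1 ij.2) V.
  exact: Qpoly_slices.
have [W WP] := choice H.
by exists (fun i j => W (i, j)) => i j; exact: (WP (i, j)).
Qed.

(** The cell terms carry two derivatives and the Jacobian [hx * hy], the edge terms one derivative
    and the Jacobian [hy]: both scale like [hy * hx^-1]. *)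
Lemma Aform_x_slices k w v W V : Qh k w -> Qh k v ->
  grid_slices k w W -> grid_slices k v V ->
  Aform_x w v = hy * hx^-1 *
    \sum_(j < My) int1 0 1 (fun y => dg1 (fun i => W i j y) (fun i => V i j y)).
Proof.
move=> wQ vQ WP VP; have hx0 := Dx_gt0 Om hN; have hy0 := Dy_gt0 Om hMy.
have hx0' := lt0r_neq0 hx0.
have cdw i j : cont2 (dx (w i j)) by exact: Qpoly_dx_cont (wQ i j).
have cdv i j : cont2 (dx (v i j)) by exact: Qpoly_dx_cont (vQ i j).
have cw i j : cont2 (w i j) by exact: Qpoly_cont (wQ i j).
have cv i j : cont2 (v i j) by exact: Qpoly_cont (vQ i j).
have cW i j : cpoly (W i j) by have [] := WP i j.
have cV i j : cpoly (V i j) by have [] := VP i j.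
have cW' i j := cpoly_deriv (cW i j); have cV' i j := cpoly_deriv (cV i j).
have hW i j x := @cpoly_horner _ x _ (cW i j).
have hV i j x := @cpoly_horner _ x _ (cV i j).
have hW' i j x := @cpoly_horner _ x _ (cW' i j).
have hV' i j x := @cpoly_horner _ x _ (cV' i j).
have cWV i j := cpoly_pint (cW' i j) (cV' i j).
rewrite /Aform_x -big_split/=.
under eq_bigr do rewrite -big_split/=.
rewrite exchange_big mulr_sumr; apply: eq_bigr => j _.
rewrite /dg1 int1_sum => [|i]; last by cont.
rewrite mulr_sumr; apply: eq_bigr => i _.
have dWE i' x y : dx (w i' j) (xl Om i' + hx * x) (yl Om j + hy * y) =
    hx^-1 * (W i' j y)^`().[x].
  by have [_ _ _ <-] := WP i' j; rewrite mulKf.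
have dVE i' x y : dx (v i' j) (xl Om i' + hx * x) (yl Om j + hy * y) =
    hx^-1 * (V i' j y)^`().[x].
  by have [_ _ _ <-] := VP i' j; rewrite mulKf.
have WE i' x y : w i' j (xl Om i' + hx * x) (yl Om j + hy * y) = (W i' j y).[x].
  by have [_ _ -> _] := WP i' j.
have VE i' x y : v i' j (xl Om i' + hx * x) (yl Om j + hy * y) = (V i' j y).[x].
  by have [_ _ -> _] := VP i' j.
have xlE (i' : 'I_N) : xl Om i' = xl Om i' + hx * 0 by rewrite mulr0 addr0.
have xrE (i' : 'I_N) : xr Om i' = xl Om i' + hx * 1 by rewrite mulr1 xr_xl.
pose F y := pint ((W i j y)^`() * (V i j y)^`()).
pose G y := 2^-1 * ((W i j y)^`().[1] + (W (ordS i) j y)^`().[0])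
        * ((V (ordS i) j y).[0] - (V i j y).[1])
    + 2^-1 * ((V i j y)^`().[1] + (V (ordS i) j y)^`().[0])
        * ((W (ordS i) j y).[0] - (W i j y).[1]).
have cF : continuous F by exact: cWV.
have cG : continuous G by rewrite /G; cont.
have -> : cellint Om i j (fun x y => bdx w i j x y * bdx v i j x y) =
    hy * hx^-1 * int1 0 1 F.
  rewrite (cellintE Om hN hMy); last by rewrite /bdx; have ? := cdw i j;
    have ? := cdv i j; cont.
  rewrite (_ : unit_int2 _ = int1 0 1 (fun y => (hx^-1 * hx^-1) * F y)).
    by rewrite int1Z//; field.
  apply: eq_int1 => y _; rewrite /F /pint -int1Z; last by cont.
  by apply: eq_int1 => x _; rewrite /bdx dWE dVE hornerM; ring.
have -> : int1 (yl Om j) (yr Om j) (fun y =>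
      avgx Om (bdx w) i j y * jumpx Om v i j y
      + avgx Om (bdx v) i j y * jumpx Om w i j y) =
    hy * hx^-1 * int1 0 1 G.
  rewrite yr_yl int1_affine//; last first.
    rewrite /avgx /jumpx /bdx.
    by have ? := cdw i j; have ? := cdw (ordS i) j; have ? := cdv i j;
      have ? := cdv (ordS i) j; have ? := cw i j; have ? := cw (ordS i) j;
      have ? := cv i j; have ? := cv (ordS i) j; cont.
  rewrite -mulrA; apply: (congr1 ( *%R hy)); rewrite -int1Z//.
  apply: eq_int1 => y _; rewrite /avgx /jumpx /bdx /G.
  rewrite (xlE (ordS i)) (xrE i) !dWE !dVE !WE !VE; ring.
rewrite -mulrDr; apply: (congr1 ( *%R (hy * hx^-1))); rewrite -int1D//.
by apply: eq_int1 => y _; rewrite /F /G addrA.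
Qed.

End HorizontalForm.

Lemma eq_le_refl {R : realType} (a b : R) : a = b -> a <= b.
Proof. by move=> ->. Qed.

Section TensorInterpolant.
Context {R : realType}.
Variables (k : nat) (node : 'I_k.+3 -> R) (lam : 'I_k.+3 -> {poly R}).
Hypothesis hk : (1 <= k)%N.
Hypothesis hP : quasi_projector node lam.
Implicit Types (u : R -> R -> R).

Local Notation P := (quasi_interp node lam).

Definition interp2 (Om : rect R) (N My : nat) u : broken N My :=
  fun i j x y => \sum_a \sum_b
    u (xl Om i + Dx Om N * node a) (yl Om j + Dy Om My * node b) *
    ((lam a).[(x - xl Om i) / Dx Om N] * (lam b).[(y - yl Om j) / Dy Om My]).

Lemma Qh_interp2 Om N My u : Qh k (@interp2 Om N My u).
Proof.
move=> i j; have [_ sl _ _] := hP.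
have rescale (p : {poly R}) (a h : R) : (size p <= k.+1)%N ->
    exists2 q : {poly R}, (size q <= k.+1)%N & forall x, q.[x] = p.[(x - a) / h].
  move=> sp; exists (p \Po (h^-1 *: ('X - a%:P))); last first.
    by move=> x; rewrite horner_comp !hornerE mulrC.
  apply: (leq_trans (size_comp_poly_leq _ _)).
  have : (size (h^-1 *: ('X - a%:P))%R <= 2)%N.
    by rewrite (leq_trans (size_scale_leq _ _))// size_XsubC.
  case: (size (h^-1 *: ('X - a%:P))%R) => [|[|[|//]]] _; rewrite ?muln0//=.
  by rewrite muln1; case: (size p) sp.
apply: Qpoly_sum => a; apply: Qpoly_sum => b.
have [q1 sq1 q1E] := rescale _ (xl Om i) (Dx Om N) (sl a).
have [q2 sq2 q2E] := rescale _ (yl Om j) (Dy Om My) (sl b).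
have Q12 := Qpoly_prod sq1 sq2.
set c := u _ _.
apply: Qpoly_eq (QpolyD c 0 Q12 Q12) => x y.
by rewrite mul0r addr0 q1E q2E.
Qed.

Lemma interp2_ref Om N My u (i : 'I_N) (j : 'I_My) x y : (0 < N)%N -> (0 < My)%N ->
  interp2 Om u i j (xl Om i + Dx Om N * x) (yl Om j + Dy Om My * y) =
  (P (fun s => (P (fun t => u (xl Om i + Dx Om N * s) (yl Om j + Dy Om My * t))).[y])).[x].
Proof.
move=> hN hMy; rewrite horner_interp; apply: eq_bigr => a _.
rewrite horner_interp mulr_suml; apply: eq_bigr => b _.
have cancel (z h w : R) : 0 < h -> (z + h * w - z) / h = w.
  by move=> h0; field; exact: lt0r_neq0.
rewrite !cancel; [ring|exact: Dy_gt0|exact: Dx_gt0].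
Qed.

Lemma interp2_slices Om N My u : (0 < N)%N -> (0 < My)%N ->
  grid_slices Om k (@interp2 Om N My u) (fun i j y =>
    P (fun s => (P (fun t =>
      u (xl Om i + Dx Om N * s) (yl Om j + Dy Om My * t))).[y])).
Proof.
move=> hN hMy; have [W WP] := Qh_slices Om hN (@Qh_interp2 Om N My u).
move=> i j; have [cW sW WE dWE] := WP i j.
have -> : (fun y => P (fun s => (P (fun t =>
      u (xl Om i + Dx Om N * s) (yl Om j + Dy Om My * t))).[y])) = W i j.
  apply/funext => y; apply: poly_ext => x.
  by rewrite -WE interp2_ref.
by split.
Qed.

Lemma cellint_sqr_ref Om N My (f : R -> R -> R) (c : R) (i : 'I_N) (j : 'I_My) :
  (0 < N)%N -> (0 < My)%N -> cont2 f ->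
  unit_int2 (fun x y => (c * f (xl Om i + Dx Om N * x) (yl Om j + Dy Om My * y)) ^+ 2)
  = c ^+ 2 * (Dx Om N * Dy Om My)^-1 * cellint Om i j (fun x y => f x y ^+ 2).
Proof.
move=> hN hMy cf; have hx0 := Dx_gt0 Om hN; have hy0 := Dy_gt0 Om hMy.
have cf2 : cont2 (fun x y => f x y ^+ 2) by cont.
have h0 : Dx Om N * Dy Om My != 0 by rewrite mulf_neq0// lt0r_neq0.
rewrite (cellintE Om hN hMy)// -mulrA mulKf// /unit_int2.
rewrite -(@int1Z _ (fun y => int1 0 1 (fun x =>
  f (xl Om i + Dx Om N * x) (yl Om j + Dy Om My * y) ^+ 2))); last by cont.
apply: eq_int1 => y _; rewrite -int1Z; last by cont.
by apply: eq_int1 => x _; rewrite exprMn.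
Qed.

Lemma Aform_x_residual : exists2 C : R, 0 <= C &
  forall Om N My u (v : broken N My) (e : R), (0 < N)%N -> (0 < My)%N -> 0 < e ->
  smooth2 u -> perx (xhi Om - xlo Om) u -> Qh k v ->
  `|Aform_x Om (interp2 Om u) v
    + \sum_(i < N) \sum_(j < My) cellint Om i j (fun x y => dx (dx u) x y * v i j x y)|
  <= e^-1 * C *
     ((Dx Om N ^+ k.+1) ^+ 2 * intOm Om (fun x y => iter k.+3 dx u x y ^+ 2)
      + (Dy Om My ^+ k.+1) ^+ 2
        * intOm Om (fun x y => iter k.+1 dy (dx (dx u)) x y ^+ 2))
     + e * ip Om v v.
Proof.
have [C C0 HC] := row_residual hk hP.
exists C => // Om N My u v e hN hMy e0 su pu vQ.
set hx := Dx Om N; set hy := Dy Om My.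
have hx0 : 0 < hx by exact: Dx_gt0.
have hy0 : 0 < hy by exact: Dy_gt0.
have [V VP] := Qh_slices Om hN vQ.
pose F (i : 'I_N) (j : 'I_My) n x y := hx ^+ n * iter n dx u (xl Om i + hx * x) (yl Om j + hy * y).
pose H (i : 'I_N) (j : 'I_My) m x y := hy ^+ m *
  (hx ^+ 2 * iter m dy (dx (dx u)) (xl Om i + hx * x) (yl Om j + hy * y)).
pose W i j y := P (fun s => (P (F i j 0%N s)).[y]) : {poly R}.
have cdx n : cont2 (iter n dx u) by exact: smooth2_cont (@smooth2_iter _ u n 0 su).
have sxx : smooth2 (dx (dx u)) by do 2 apply: smooth2_dx.
have cdy m : cont2 (iter m dy (dx (dx u))).
  exact: smooth2_cont (smooth2_iter_dy m sxx).
have cF i j n : cont2 (F i j n) by have ? := cdx n; rewrite /F; cont.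
have cH i j n : cont2 (H i j n) by have ? := cdy n; rewrite /H; cont.
have WP : grid_slices Om k (interp2 Om u) W.
  have := @interp2_slices Om N My u hN hMy; congr grid_slices.
  apply/funext => i; apply/funext => j; apply/funext => y; rewrite /W.
  congr quasi_interp; apply/funext => s; congr (_.[_]); congr quasi_interp.
  by apply/funext => t; rewrite /F expr0 mul1r.
have cV i j : cpoly (V i j) by have [] := VP i j.
have cv i j : cont2 (v i j) by exact: Qpoly_cont (vQ i j).
have VE i j x y : v i j (xl Om i + hx * x) (yl Om j + hy * y) = (V i j y).[x].
  by have [_ _ -> _] := VP i j.
have cW i j : cpoly (W i j) by have [] := WP i j.
(* With this weight the factor [hy * hx^-1] of the form and the Jacobian leave exactly [e] in front
   of [ip Om v v]; in the other terms the negative powers of [hx] and [hy] cancel as well. *)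
pose e' := e * hx ^+ 2.
have e'0 : 0 < e' by rewrite mulr_gt0// exprn_gt0.
pose X j := int1 0 1 (fun y => dg1 (fun i => W i j y) (fun i => V i j y)
  + \sum_i int1 0 1 (fun x => F i j 2%N x y * (V i j y).[x])).
pose SF j := \sum_i unit_int2 (fun x y => F i j k.+3 x y ^+ 2).
pose SH j := \sum_i unit_int2 (fun x y => H i j k.+1 x y ^+ 2).
pose SV j := \sum_i unit_int2 (fun x y => (V i j y).[x] ^+ 2).
have HX j : `|X j| <= e'^-1 * C * (SF j + SH j) + e' * SV j.
  have tF i y : tower (fun n x => F i j n x y).
    move=> n x; rewrite /F.
    exact: (tower_affine (xl Om i) hx (tower_dx (yl Om j + hy * y) su)).
  have FS i n x y : F (ordS i) j n x y = F i j n (x + 1) y.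
    rewrite /F (@xlS_periodic _ Om N hN
      (fun z => iter n dx u z (yl Om j + hy * y))).
      by rewrite -/hx; have -> : xl Om i + hx + hx * x = xl Om i + hx * (x + 1)
        by ring.
    by move=> z; exact: (@perx_iter _ _ u n 0 su pu).
  have tH i x : tower (fun n y => H i j n x y).
    move=> n y; rewrite /H.
    have tw := towerZ (hx ^+ 2) (tower_dy (xl Om i + hx * x) sxx).
    exact: (tower_affine (yl Om j) hy tw).
  have H0 i x y : H i j 0%N x y = F i j 2%N x y.
    by rewrite /H /F expr0 mul1r.
  have sV i y : (size (V i j y) <= k.+1)%N by have [] := VP i j.
  exact: (HC N (fun i => F i j) (fun i => H i j) (fun i => V i j) e' e'0
    (fun i => cF i j) tF FS (fun i => cH i j) tH H0 (fun i => cV i j) sV).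
have EX : Aform_x Om (interp2 Om u) v
    + \sum_(i < N) \sum_(j < My) cellint Om i j (fun x y => dx (dx u) x y * v i j x y)
    = hy * hx^-1 * \sum_j X j.
  rewrite (Aform_x_slices hN hMy (@Qh_interp2 Om N My u) vQ WP VP).
  rewrite exchange_big -/hx -/hy !mulr_sumr -big_split; apply: eq_bigr => j _ /=.
  have cFV i : cont2 (fun x y => F i j 2%N x y * (V i j y).[x]).
    exact: (contM (cF i j 2%N) (cpoly_cont2 (cV i j))).
  rewrite /X int1D; last 2 first.
  - by apply: cpoly_dg1.
  - by apply: cont_sum => i _; exact: (cont_int1_row (cFV i)).
  rewrite mulrDr int1_sum => [|i]; last exact: (cont_int1_row (cFV i)).
  apply: (congr1 ( +%R _)); rewrite mulr_sumr; apply: eq_bigr => i _.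
  rewrite (cellintE Om hN hMy) -/hx -/hy; last first.
    by have ? := smooth2_cont sxx; have ? := cv i j; cont.
  rewrite /unit_int2 -(@int1Z _ (fun y => int1 0 1 (fun x => F i j 2%N x y * (V i j y).[x])));
    last exact: (cont_int1_row (cFV i)).
  rewrite -int1Z; last first.
    by have ? := smooth2_cont sxx; have ? := cv i j; cont.
  apply: eq_int1 => y _; have ? := cFV i; rewrite -!int1Z; last 2 first.
  - by cont.
  - by have ? := smooth2_cont sxx; have ? := cv i j; cont.
  apply: eq_int1 => x _; rewrite VE /F /=; field; exact: lt0r_neq0.
have EF : \sum_j SF j = (hx ^+ k.+3) ^+ 2 * (hx * hy)^-1
    * intOm Om (fun x y => iter k.+3 dx u x y ^+ 2).
  rewrite (intOm_cells Om hN hMy); last by have ? := cdx k.+3; cont.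
  rewrite /SF exchange_big mulr_sumr; apply: eq_bigr => i _.
  rewrite mulr_sumr; apply: eq_bigr => j _.
  exact: cellint_sqr_ref.
have EH : \sum_j SH j = (hy ^+ k.+1 * hx ^+ 2) ^+ 2 * (hx * hy)^-1
    * intOm Om (fun x y => iter k.+1 dy (dx (dx u)) x y ^+ 2).
  rewrite (intOm_cells Om hN hMy); last by have ? := cdy k.+1; cont.
  rewrite /SH exchange_big mulr_sumr; apply: eq_bigr => i _.
  rewrite mulr_sumr; apply: eq_bigr => j _.
  transitivity (unit_int2 (fun x y => (hy ^+ k.+1 * hx ^+ 2
    * iter k.+1 dy (dx (dx u)) (xl Om i + hx * x) (yl Om j + hy * y)) ^+ 2)).
    by congr unit_int2; apply/funext => x; apply/funext => y; rewrite /H mulrA.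
  exact: cellint_sqr_ref.
have EV : \sum_j SV j = (hx * hy)^-1 * ip Om v v.
  rewrite /SV /ip exchange_big mulr_sumr; apply: eq_bigr => i _.
  rewrite mulr_sumr; apply: eq_bigr => j _.
  have := @cellint_sqr_ref Om N My (v i j) 1 i j hN hMy (cv i j).
  rewrite expr1n mul1r -/hx -/hy => EQ.
  transitivity (unit_int2 (fun x y => (1 * v i j (xl Om i + hx * x) (yl Om j + hy * y)) ^+ 2)).
    by congr unit_int2; apply/funext => x; apply/funext => y; rewrite mul1r VE.
  by rewrite EQ; congr (_ * cellint _ _ _ _).
clearbody X SF SH SV; rewrite {}EX normrM (ger0_norm (x := hy * hx^-1)); last first.
  by rewrite mulr_ge0 ?invr_ge0// ltW.
have hyx0 : 0 <= hy * hx^-1 by rewrite mulr_ge0 ?invr_ge0// ltW.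
apply: (le_trans (ler_wpM2l hyx0 (ler_norm_sum _ _ _))).
apply: (le_trans (ler_wpM2l hyx0 (ler_sum _ (fun j _ => HX j)))).
rewrite big_split/= -!mulr_sumr big_split/= EF EH EV.
set I1 := intOm _ _; set I2 := intOm _ _; set I3 := ip _ _ _.
rewrite /e' (_ : hx ^+ k.+3 = hx ^+ k.+1 * hx ^+ 2); last first.
  by rewrite -exprD addn2.
set a := hx ^+ k.+1; set b := hy ^+ k.+1.
clearbody hx hy I1 I2 I3 a b; apply: eq_le_refl.
by field; rewrite !lt0r_neq0.
Qed.

End TensorInterpolant.

Lemma approx_algebra {R : realType} (z a b g0 g1 G h0 h1 C1 C2 C3 : R) :
  0 <= C1 -> 0 <= C2 -> 0 <= C3 -> 0 <= G -> 0 <= h0 -> 0 <= h1 ->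
  z <= 2 * a + 2 * b -> a <= C1 * G -> b <= C3 * (g0 + g1) ->
  g0 <= C1 * h0 -> g1 <= C2 * h1 ->
  z <= (2 * C1 + 2 * (C3 * (C1 + C2))) * (G + h0 + h1).
Proof.
move=> C10 C20 C30 G0 h00 h10 za aG bg g0h g1h.
have b1 : b <= C3 * (C1 * h0 + C2 * h1).
  by apply: (le_trans bg); rewrite ler_wpM2l// lerD.
have p1 : 0 <= C1 * (h0 + h1) by rewrite mulr_ge0// addr_ge0.
have p2 : 0 <= C3 * (C1 * (G + h1)) by rewrite !mulr_ge0// addr_ge0.
have p3 : 0 <= C3 * (C2 * (G + h0)) by rewrite !mulr_ge0// addr_ge0.
lra.
Qed.

(** * Two-dimensional interpolation error on the reference cell *)

Section InterpolationError.
Context {R : realType}.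
Variables (k : nat) (node : 'I_k.+3 -> R) (lam : 'I_k.+3 -> {poly R}).
Hypothesis hk : (1 <= k)%N.
Hypothesis hP : quasi_projector node lam.

Local Notation P := (quasi_interp node lam).

Lemma unit_int2_ge0 (F : R -> R -> R) : (forall x y, 0 <= F x y) -> 0 <= unit_int2 F.
Proof. by move=> F0; apply: int1_ge0 => y _; apply: int1_ge0 => x _. Qed.

Lemma unit_int2_le (F G : R -> R -> R) : cont2 F -> cont2 G ->
  (forall x y, F x y <= G x y) -> unit_int2 F <= unit_int2 G.
Proof.
move=> cF cG FG; apply: int1_le => [||y _]; [by cont|by cont|].
by apply: int1_le => //; cont.
Qed.

Lemma unit_int2_lin (F G : R -> R -> R) a b : cont2 F -> cont2 G ->
  unit_int2 (fun x y => a * F x y + b * G x y) =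
  a * unit_int2 F + b * unit_int2 G.
Proof.
move=> cF cG; rewrite /unit_int2.
transitivity (int1 0 1 (fun y => a * int1 0 1 (F^~ y) + b * int1 0 1 (G^~ y))).
  apply: eq_int1 => y _; rewrite int1D; [|by cont|by cont].
  by rewrite !int1Z//; cont.
rewrite int1D; [|by cont|by cont].
by rewrite !int1Z//; cont.
Qed.

(** The error is Px G - G plus Px (Py G - G). The outer interpolation of the second part is bounded
    by [interp_stable], which costs one derivative in [x]; [H1] then contributes only [k]
    derivatives in [y], for the same total order. *)
Lemma ref_approx : exists2 C : R, 0 <= C &
  forall (G : nat -> R -> R -> R) (H0 H1 : nat -> R -> R -> R),
  (forall n, cont2 (G n)) -> (forall y, tower (fun n x => G n x y)) ->
  (forall n, cont2 (H0 n)) -> (forall x, tower (fun n y => H0 n x y)) ->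
  (forall n, cont2 (H1 n)) -> (forall x, tower (fun n y => H1 n x y)) ->
  (forall x y, H0 0%N x y = G 0%N x y) -> (forall x y, H1 0%N x y = G 1%N x y) ->
  unit_int2 (fun x y =>
    ((P (fun s => (P (G 0%N s)).[y])).[x] - G 0%N x y) ^+ 2) <=
  C * (unit_int2 (fun x y => G k.+1 x y ^+ 2)
       + unit_int2 (fun x y => H0 k.+1 x y ^+ 2)
       + unit_int2 (fun x y => H1 k x y ^+ 2)).
Proof.
have [C1 C10 HC1] := interp_approx hP (s := k.+1) (leqnn _).
have kk : (0 < k <= k.+1)%N by rewrite hk/=.
have [C2 C20 HC2] := interp_approx hP kk.
have [C3 C30 HC3] := interp_stable hP.
exists (2 * C1 + 2 * (C3 * (C1 + C2))).
  by rewrite addr_ge0 ?mulr_ge0// ?mulr_ge0// addr_ge0.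
move=> G H0 H1 cG tG cH0 tH0 cH1 tH1 E0 E1.
pose g n x y := (P (G n x)).[y] - G n x y.
have gE n x y : g n x y = \sum_m (lam m).[y] * G n x (node m) - G n x y.
  by rewrite /g horner_interp; congr (_ - _); apply: eq_bigr => m _; rewrite mulrC.
have cg n : cont2 (g n).
  have -> : g n = fun x y => \sum_m (lam m).[y] * G n x (node m) - G n x y.
    by apply/funext => x; apply/funext => y; rewrite gE.
  by have ? := cG n; cont.
have tg y : tower (fun n x => g n x y).
  have -> : (fun n x => g n x y) =
      fun n x => \sum_m (lam m).[y] * G n x (node m) - G n x y.
    by apply/funext => n; apply/funext => x; rewrite gE.
  by apply: towerB => //; apply: tower_sum => m; exact: towerZ.
have cP (f : R -> R -> R) : cont2 f -> cont2 (fun x y => (P (fun s => f s y)).[x]).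
  move=> cf.
  have -> : (fun x y => (P (fun s => f s y)).[x]) =
      fun x y => \sum_m f (node m) y * (lam m).[x].
    by apply/funext => x; apply/funext => y; rewrite horner_interp.
  by cont.
pose A x y := ((P (fun s => G 0%N s y)).[x] - G 0%N x y) ^+ 2.
pose B x y := (P (fun s => g 0%N s y)).[x] ^+ 2.
have cA : cont2 A by have ? := cP _ (cG 0%N); have ? := cG 0%N; rewrite /A; apply: contX; exact: contB.
have cB : cont2 B by have ? := cP _ (cg 0%N); rewrite /B; exact: contX.
have EP x y : (P (fun s => (P (G 0%N s)).[y])).[x] - G 0%N x y =
    ((P (fun s => G 0%N s y)).[x] - G 0%N x y) + (P (fun s => g 0%N s y)).[x].
  have -> : (fun s => (P (G 0%N s)).[y]) = fun s => G 0%N s y + g 0%N s y.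
    by apply/funext => s; rewrite /g addrC subrK.
  by rewrite interpD hornerD; ring.
have step1 : unit_int2 (fun x y =>
    ((P (fun s => (P (G 0%N s)).[y])).[x] - G 0%N x y) ^+ 2) <=
    2 * unit_int2 A + 2 * unit_int2 B.
  rewrite -unit_int2_lin//; apply: unit_int2_le.
  - have -> : (fun x y => ((P (fun s => (P (G 0%N s)).[y])).[x] - G 0%N x y) ^+ 2) =
       fun x y => (((P (fun s => G 0%N s y)).[x] - G 0%N x y)
                   + (P (fun s => g 0%N s y)).[x]) ^+ 2.
      by apply/funext => x; apply/funext => y; rewrite EP.
    apply: contX; apply: contD; last exact: (cP _ (cg 0%N)).
    by apply: contB; [exact: (cP _ (cG 0%N))|exact: cG].
  - by cont.
  - move=> x y; rewrite EP /A /B.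
    set a := _ - _; set b := _.[x].
    have -> : (a + b) ^+ 2 = 2 * a ^+ 2 + 2 * b ^+ 2 - (a - b) ^+ 2 by ring.
    by rewrite gerBl sqr_ge0.
have cS (f : R -> R -> R) : cont2 f -> cont2 (fun x y => f x y ^+ 2).
  by move=> cf; cont.
have stepA : unit_int2 A <= C1 * unit_int2 (fun x y => G k.+1 x y ^+ 2).
  rewrite /unit_int2 -int1Z; last by have ? := cG k.+1; cont.
  apply: int1_le => [||y _].
  - exact: (cont_int1_row cA).
  - by have ? := cG k.+1; cont.
  - exact: (HC1 (fun n x => G n x y) (tG y)).
have stepB : unit_int2 B <= C3 * (unit_int2 (fun x y => g 0%N x y ^+ 2)
    + unit_int2 (fun x y => g 1%N x y ^+ 2)).
  rewrite /unit_int2 -int1D; last 2 first.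
  - exact: (cont_int1_row (cS _ (cg 0%N))).
  - exact: (cont_int1_row (cS _ (cg 1%N))).
  rewrite -int1Z; last first.
    apply: contD; first exact: (cont_int1_row (cS _ (cg 0%N))).
    exact: (cont_int1_row (cS _ (cg 1%N))).
  apply: int1_le => [||y _].
  - exact: (cont_int1_row cB).
  - apply: contM; first exact: cont_cst.
    apply: contD; first exact: (cont_int1_row (cS _ (cg 0%N))).
    exact: (cont_int1_row (cS _ (cg 1%N))).
  - exact: (HC3 (fun n x => g n x y) (tg y)).
have stepH (H : nat -> R -> R -> R) (n s : nat) (C : R) :
    (forall D, tower D -> int1 0 1 (fun x => ((P (D 0%N)).[x] - D 0%N x) ^+ 2) <=
      C * int1 0 1 (fun x => D s x ^+ 2)) ->
    (forall n, cont2 (H n)) -> (forall x, tower (fun n y => H n x y)) ->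
    (forall x y, H 0%N x y = G n x y) ->
    unit_int2 (fun x y => g n x y ^+ 2) <= C * unit_int2 (fun x y => H s x y ^+ 2).
  move=> HC cH tH EH; rewrite !unit_int2C; last 2 first.
  - exact: cS.
  - exact: cS.
  rewrite -int1Z; last by have ? := cH s; cont.
  apply: int1_le => [||x _].
  - by have ? := cg n; cont.
  - by have ? := cH s; cont.
  have := HC (fun n y => H n x y) (tH x).
  rewrite (eq_int1 (g := fun y => g n x y ^+ 2))// => y _.
  by rewrite /g (_ : H 0%N x = G n x)//; apply/funext => z.
have stepH0 := stepH H0 0%N k.+1 C1 HC1 cH0 tH0 E0.
have stepH1 := stepH H1 1%N k C2 HC2 cH1 tH1 E1.
have pos (f : R -> R -> R) : 0 <= unit_int2 (fun x y => f x y ^+ 2).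
  by apply: unit_int2_ge0 => x y; exact: sqr_ge0.
move: (pos (G k.+1)) (pos (H0 k.+1)) (pos (H1 k)) step1 stepA stepB stepH0 stepH1.
exact: (approx_algebra C10 C20 C30).
Qed.

End InterpolationError.

(** * Approximation and consistency of the tensor-product interpolant *)

Lemma rescaled_error {R : realType} (hx hy a b c C err z1 z2 z3 : R) :
  0 < hx -> 0 < hy ->
  err <= C * (a ^+ 2 * (hx * hy)^-1 * z1 + b ^+ 2 * (hx * hy)^-1 * z2
              + c ^+ 2 * (hx * hy)^-1 * z3) ->
  hx * hy * err <= C * (a ^+ 2 * z1 + b ^+ 2 * z2 + c ^+ 2 * z3).
Proof.
move=> hx0 hy0 H; have hh : 0 < hx * hy by exact: mulr_gt0.
apply: (le_trans (ler_wpM2l (ltW hh) H)); apply: eq_le_refl.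
by field; rewrite !lt0r_neq0.
Qed.

Section GridApproximation.
Context {R : realType}.
Variables (k : nat) (node : 'I_k.+3 -> R) (lam : 'I_k.+3 -> {poly R}).
Hypothesis hk : (1 <= k)%N.
Hypothesis hP : quasi_projector node lam.

Local Notation P := (quasi_interp node lam).

Definition interp_error Om N My (u : R -> R -> R) : broken N My (R := R) :=
  fun i j x y => interp2 node lam Om u i j x y - u x y.

Lemma interp2_cont Om N My (u : R -> R -> R) (i : 'I_N) (j : 'I_My) :
  cont2 (interp2 node lam Om u i j).
Proof. exact: Qpoly_cont (Qh_interp2 hP Om u i j). Qed.

Lemma interp2_approx : exists2 C : R, 0 <= C &
  forall Om N My u, (0 < N)%N -> (0 < My)%N -> smooth2 u ->
  ip Om (@interp_error Om N My u) (interp_error Om u) <= C *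
    ((Dx Om N ^+ k.+1) ^+ 2 * intOm Om (fun x y => iter k.+1 dx u x y ^+ 2)
     + (Dy Om My ^+ k.+1) ^+ 2 * intOm Om (fun x y => iter k.+1 dy u x y ^+ 2)
     + (Dx Om N * Dy Om My ^+ k) ^+ 2
       * intOm Om (fun x y => iter k dy (dx u) x y ^+ 2)).
Proof.
have [C C0 HC] := ref_approx hk hP.
exists C => // Om N My u hN hMy su.
set hx := Dx Om N; set hy := Dy Om My.
have hx0 : 0 < hx by exact: Dx_gt0.
have hy0 : 0 < hy by exact: Dy_gt0.
have sx := smooth2_dx su.
have cu := smooth2_cont su.
have cdx n : cont2 (iter n dx u) by exact: smooth2_cont (@smooth2_iter _ u n 0 su).
have cdy n : cont2 (iter n dy u) by exact: smooth2_cont (smooth2_iter_dy n su).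
have cdxy n : cont2 (iter n dy (dx u)) by exact: smooth2_cont (smooth2_iter_dy n sx).
have c1 : cont2 (fun x y => iter k.+1 dx u x y ^+ 2) by have ? := cdx k.+1; cont.
have c2 : cont2 (fun x y => iter k.+1 dy u x y ^+ 2) by have ? := cdy k.+1; cont.
have c3 : cont2 (fun x y => iter k dy (dx u) x y ^+ 2) by have ? := cdxy k; cont.
have E1 := intOm_cells Om hN hMy c1; have E2 := intOm_cells Om hN hMy c2.
have E3 := intOm_cells Om hN hMy c3.
apply: (le_trans _ (eq_le_refl (f_equal3 (fun a b c => C *
  ((hx ^+ k.+1) ^+ 2 * a + (hy ^+ k.+1) ^+ 2 * b + (hx * hy ^+ k) ^+ 2 * c))
  (esym E1) (esym E2) (esym E3)))) => {E1 E2 E3}.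
rewrite !mulr_sumr -!big_split/= mulr_sumr; apply: ler_sum => i _.
rewrite !mulr_sumr -!big_split/= mulr_sumr; apply: ler_sum => j _.
pose G n x y := hx ^+ n * iter n dx u (xl Om i + hx * x) (yl Om j + hy * y).
pose H0 m x y := hy ^+ m * iter m dy u (xl Om i + hx * x) (yl Om j + hy * y).
pose H1 m x y := hy ^+ m *
  (hx * iter m dy (dx u) (xl Om i + hx * x) (yl Om j + hy * y)).
have cG n : cont2 (G n) by have ? := cdx n; rewrite /G; cont.
have cH0 n : cont2 (H0 n) by have ? := cdy n; rewrite /H0; cont.
have cH1 n : cont2 (H1 n) by have ? := cdxy n; rewrite /H1; cont.
have tG y : tower (fun n x => G n x y).
  move=> n x; rewrite /G.
  exact: (tower_affine (xl Om i) hx (tower_dx (yl Om j + hy * y) su)).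
have tH0 x : tower (fun n y => H0 n x y).
  move=> n y; rewrite /H0.
  exact: (tower_affine (yl Om j) hy (tower_dy (xl Om i + hx * x) su)).
have tH1 x : tower (fun n y => H1 n x y).
  move=> n y; rewrite /H1.
  have tw := towerZ hx (tower_dy (xl Om i + hx * x) sx).
  exact: (tower_affine (yl Om j) hy tw).
have E0 x y : H0 0%N x y = G 0%N x y by rewrite /H0 /G !expr0.
have E1 x y : H1 0%N x y = G 1%N x y by rewrite /H1 /G expr0 mul1r expr1.
pose zG := unit_int2 (fun x y => G k.+1 x y ^+ 2).
pose zH0 := unit_int2 (fun x y => H0 k.+1 x y ^+ 2).
pose zH1 := unit_int2 (fun x y => H1 k x y ^+ 2).
pose err := unit_int2 (fun x y =>
  ((P (fun s => (P (G 0%N s)).[y])).[x] - G 0%N x y) ^+ 2).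
have Herr : err <= C * (zG + zH0 + zH1).
  exact: (HC G H0 H1 cG tG cH0 tH0 cH1 tH1 E0 E1).
have EG : zG = (hx ^+ k.+1) ^+ 2 * (hx * hy)^-1
    * cellint Om i j (fun x y => iter k.+1 dx u x y ^+ 2).
  exact: cellint_sqr_ref.
have EH0 : zH0 = (hy ^+ k.+1) ^+ 2 * (hx * hy)^-1
    * cellint Om i j (fun x y => iter k.+1 dy u x y ^+ 2).
  exact: cellint_sqr_ref.
have EH1 : zH1 = (hx * hy ^+ k) ^+ 2 * (hx * hy)^-1
    * cellint Om i j (fun x y => iter k dy (dx u) x y ^+ 2).
  transitivity (unit_int2 (fun x y => (hx * hy ^+ k
    * iter k dy (dx u) (xl Om i + hx * x) (yl Om j + hy * y)) ^+ 2)).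
    congr unit_int2; apply/funext => x; apply/funext => y; rewrite /H1.
    by rewrite mulrA [hy ^+ k * hx]mulrC.
  exact: cellint_sqr_ref.
have Eerr : cellint Om i j (fun x y =>
    interp_error Om u i j x y * interp_error Om u i j x y) = hx * hy * err.
  rewrite (cellintE Om hN hMy) -/hx -/hy; last first.
    have ? := @interp2_cont Om N My u i j; rewrite /interp_error.
    by apply: contM; apply: contB.
  apply: (congr1 ( *%R _)); congr unit_int2.
  apply/funext => x; apply/funext => y; rewrite /interp_error interp2_ref//.
  rewrite -expr2 /G /= expr0 mul1r; congr ((_.[_] - _) ^+ 2).
  congr quasi_interp; apply/funext => s; congr (_.[_]); congr quasi_interp.
  by apply/funext => t; rewrite mul1r.
rewrite Eerr; clearbody err zG zH0 zH1; move: Herr; rewrite EG EH0 EH1.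
exact: rescaled_error.
Qed.

End GridApproximation.

(** * Exchange of the two variables *)

Section Transposition.
Context {R : realType}.
Variables (Om : rect R) (N My : nat).
Hypotheses (hN : (0 < N)%N) (hMy : (0 < My)%N).
Implicit Types (f g : R -> R -> R) (v w : broken N My (R := R)).

Definition swap_rect : rect R := Rect (ylo_lt Om) (xlo_lt Om).

Definition swap w : broken My N := fun j i x y => w i j y x.

Lemma Qh_swap k w : Qh k w -> Qh k (swap w).
Proof. by move=> wQ j i; exact: Qpoly_transpose. Qed.

Lemma int2_swap f a b c d : cont2 f ->
  int2 c d a b (fun x y => f y x) = int2 a b c d f.
Proof. by move=> cf; rewrite int2E ?int2Er//; exact: cont2_transpose. Qed.

Lemma int2D f g a b c d : cont2 f -> cont2 g ->
  int2 a b c d (fun x y => f x y + g x y) = int2 a b c d f + int2 a b c d g.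
Proof.
move=> cf cg; rewrite !int2E//; last by cont.
rewrite -int1D; [|by cont|by cont].
by apply: eq_int1 => y _; rewrite int1D//; cont.
Qed.

Lemma intOm_swap f : cont2 f -> intOm swap_rect (fun x y => f y x) = intOm Om f.
Proof. exact: int2_swap. Qed.

Lemma cellint_swap (i : 'I_N) (j : 'I_My) f : cont2 f ->
  cellint swap_rect j i (fun x y => f y x) = cellint Om i j f.
Proof. exact: int2_swap. Qed.

Lemma ip_swap w v : (forall i j, cont2 (w i j)) -> (forall i j, cont2 (v i j)) ->
  ip swap_rect (swap w) (swap v) = ip Om w v.
Proof.
move=> cw cv; rewrite /ip exchange_big; apply: eq_bigr => i _.
apply: eq_bigr => j _; rewrite -cellint_swap//.
exact: (contM (cw i j) (cv i j)).
Qed.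

(** The vertical half of the form is the horizontal half for the transposed functions, so that the
    residual has to be estimated in one direction only. *)
Lemma Aform_split k w v : Qh k w -> Qh k v ->
  Aform Om w v = Aform_x Om w v + Aform_x swap_rect (swap w) (swap v).
Proof.
move=> wQ vQ.
have cdx (z : @broken R N My) i j : Qh k z -> cont2 (dx (z i j)).
  by move=> zQ; exact: Qpoly_dx_cont (zQ i j).
have cdy (z : @broken R N My) i j : Qh k z -> cont2 (dy (z i j)).
  by move=> zQ; exact: Qpoly_dy_cont (zQ i j).
rewrite /Aform /Aform_x.
have cdx2 i j : cont2 (fun x y => bdx w i j x y * bdx v i j x y).
  by have ? := cdx _ i j wQ; have ? := cdx _ i j vQ; rewrite /bdx; cont.
have cdy2 i j : cont2 (fun x y => bdy w i j x y * bdy v i j x y).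
  by have ? := cdy _ i j wQ; have ? := cdy _ i j vQ; rewrite /bdy; cont.
have -> : \sum_(i < N) \sum_(j < My) cellint Om i j (fun x y =>
      bdx w i j x y * bdx v i j x y + bdy w i j x y * bdy v i j x y) =
  \sum_(i < N) \sum_(j < My) cellint Om i j (fun x y => bdx w i j x y * bdx v i j x y)
  + \sum_(j < My) \sum_(i < N) cellint swap_rect j i (fun x y =>
      bdx (swap w) j i x y * bdx (swap v) j i x y).
  rewrite [X in _ = _ + X]exchange_big -big_split; apply: eq_bigr => i _.
  rewrite -big_split; apply: eq_bigr => j _ /=.
  rewrite {1}/cellint (int2D _ _ _ _ (cdx2 i j) (cdy2 i j)).
  apply: (congr1 ( +%R _)); rewrite -[LHS](cellint_swap i j (cdy2 i j)).
  by congr cellint; rewrite /bdx /swap !dx_transpose.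
have -> : \sum_(i < N) \sum_(j < My) int1 (xl Om i) (xr Om i) (fun x =>
      avgy Om (bdy w) i j x * jumpy Om v i j x
      + avgy Om (bdy v) i j x * jumpy Om w i j x) =
    \sum_(j < My) \sum_(i < N) int1 (yl swap_rect i) (yr swap_rect i) (fun x =>
      avgx swap_rect (bdx (swap w)) j i x * jumpx swap_rect (swap v) j i x
      + avgx swap_rect (bdx (swap v)) j i x * jumpx swap_rect (swap w) j i x).
  rewrite exchange_big; apply: eq_bigr => j _; apply: eq_bigr => i _.
  apply: eq_int1 => x _; rewrite /avgx /avgy /jumpx /jumpy /bdx /bdy /swap.
  by rewrite !dx_transpose.
by rewrite -!addrA; congr (_ + _); rewrite addrCA.
Qed.

End Transposition.

Section SmoothTransposition.
Context {R : realType}.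
Implicit Types u v : R -> R -> R.

Lemma smooth2_transpose v : smooth2 v -> smooth2 (fun x y => v y x).
Proof.
move=> + n; elim: n v => [|n IHn] v sv.
  by split=> //; apply: cont2_transpose; exact: smooth2_cont.
split; first by apply: cont2_transpose; exact: smooth2_cont.
rewrite dx_transpose dy_transpose; split.
- move=> x y; have [_ [/(_ y x)[d1 d2] _ _]] := sv 1%N.
  by split; [exact: d2|exact: d1].
- by apply: IHn; exact: smooth2_dy.
- by apply: IHn; exact: smooth2_dx.
Qed.

Lemma iter_dx_transpose v n :
  iter n dx (fun x y => v y x) = fun x y => iter n dy v y x.
Proof. by elim: n => [//|n /= ->]; rewrite dx_transpose. Qed.

Lemma iter_dy_transpose v n :
  iter n dy (fun x y => v y x) = fun x y => iter n dx v y x.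
Proof. by elim: n => [//|n /= ->]; rewrite dy_transpose. Qed.

End SmoothTransposition.

Lemma residual_algebra {R : realType} (e C a1 a2 b1 b2 s1 s2 s3 s4 X Y h V : R) :
  0 < e -> 0 <= C -> 0 <= s1 -> 0 <= s2 -> 0 <= s3 -> 0 <= s4 -> X <= h -> Y <= h ->
  `|a1 + b1| <= (e / 2)^-1 * C * (X * s1 + Y * s2) + e / 2 * V ->
  `|a2 + b2| <= (e / 2)^-1 * C * (Y * s3 + X * s4) + e / 2 * V ->
  `|a1 + a2 + (b1 + b2)| <= e^-1 * (2 * C) * (h * (s1 + s2 + (s3 + s4))) + e * V.
Proof.
move=> e0 C0 s10 s20 s30 s40 Xh Yh h1 h2.
have -> : a1 + a2 + (b1 + b2) = (a1 + b1) + (a2 + b2) by ring.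
apply: (le_trans (ler_normD _ _)); apply: (le_trans (lerD h1 h2)).
have -> : (e / 2)^-1 * C * (X * s1 + Y * s2) + e / 2 * V
    + ((e / 2)^-1 * C * (Y * s3 + X * s4) + e / 2 * V) =
    e^-1 * (2 * C) * (X * s1 + Y * s2 + (Y * s3 + X * s4)) + e * V.
  by field; exact: lt0r_neq0.
rewrite lerD2r ler_wpM2l//; first by rewrite mulr_ge0 ?invr_ge0 ?mulr_ge0// ltW.
rewrite !mulrDr; apply: lerD; apply: lerD; exact: ler_wpM2r.
Qed.

Section ResidualEstimate.
Context {R : realType}.
Variables (k : nat) (node : 'I_k.+3 -> R) (lam : 'I_k.+3 -> {poly R}).
Hypothesis hk : (1 <= k)%N.
Hypothesis hP : quasi_projector node lam.
Implicit Types (Om : rect R) (u : R -> R -> R).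

Definition sqnorm Om u : R := intOm Om (fun x y => u x y ^+ 2).

Lemma sqnorm_ge0 Om u : cont2 u -> 0 <= sqnorm Om u.
Proof.
by move=> cu; apply: int2_ge0 => [|x y]; [cont|exact: sqr_ge0].
Qed.

(** The derivatives of order [k + 3] that the residuals in the two directions call for: pure ones,
    from exactness in that direction, and those with two derivatives in that direction and [k + 1]
    in the other, from the interpolation error there. *)
Definition residual_norm Om u : R :=
  sqnorm Om (iter k.+3 dx u) + sqnorm Om (iter k.+1 dy (dx (dx u)))
  + (sqnorm Om (iter k.+3 dy u) + sqnorm Om (iter k.+1 dx (dy (dy u)))).

(** Not symmetric in the two variables, because [interp2] is estimated as an interpolation in [y]
    followed by one in [x]. *)
Definition approx_norm Om u : R :=
  sqnorm Om (iter k.+1 dx u) + sqnorm Om (iter k.+1 dy u)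
  + sqnorm Om (iter k dy (dx u)).

Lemma interp2_swap Om N My u :
  interp2 node lam (swap_rect Om) (fun x y => u y x)
  = swap (@interp2 R k node lam Om N My u).
Proof.
apply/funext => j; apply/funext => i; apply/funext => x; apply/funext => y.
rewrite /swap /interp2 exchange_big; apply: eq_bigr => a _.
by apply: eq_bigr => b _; rewrite [X in _ * X]mulrC.
Qed.

Lemma Dx_le_mesh Om N My : Dx Om N <= meshsize Om N My.
Proof. by rewrite /meshsize le_max lexx. Qed.

Lemma Dy_le_mesh Om N My : Dy Om My <= meshsize Om N My.
Proof. by rewrite /meshsize le_max lexx orbT. Qed.

Lemma pow_le_mesh n (a h : R) : 0 < a -> a <= h -> (a ^+ n) ^+ 2 <= (h ^+ n) ^+ 2.
Proof.
move=> a0 ah; have h0 := lt_le_trans a0 ah.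
by rewrite -!exprM lerXn2r ?nnegrE// ltW.
Qed.

Lemma Aform_residual : exists2 C : R, 0 <= C &
  forall Om N My u (v : broken N My) (e : R), (0 < N)%N -> (0 < My)%N -> 0 < e ->
  smooth2 u -> perx (xhi Om - xlo Om) u -> pery (yhi Om - ylo Om) u -> Qh k v ->
  `|Aform Om (interp2 node lam Om u) v + ip Om (fun _ _ => lap u) v|
  <= e^-1 * C * ((meshsize Om N My ^+ k.+1) ^+ 2 * residual_norm Om u)
     + e * ip Om v v.
Proof.
have [C C0 HC] := Aform_x_residual hk hP.
exists (2 * C) => [|Om N My u v e hN hMy e0 su pxu pyu vQ]; first by rewrite mulr_ge0.
have e2 : 0 < e / 2 by rewrite divr_gt0.
have sut := smooth2_transpose su.
have svQ : Qh k (swap v) by exact: Qh_swap.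
have cv i j : cont2 (v i j) by exact: Qpoly_cont (vQ i j).
have sxx := smooth2_dx (smooth2_dx su); have syy := smooth2_dy (smooth2_dy su).
have pyu' : perx (xhi (swap_rect Om) - xlo (swap_rect Om)) (fun x y => u y x).
  by move=> x y; exact: pyu.
have hx := HC Om N My u v (e / 2) hN hMy e2 su pxu vQ.
have hy := HC (swap_rect Om) My N (fun x y => u y x) (swap v) (e / 2) hMy hN e2
  sut pyu' svQ.
rewrite interp2_swap ip_swap// in hy.
have Esplit := Aform_split Om (Qh_interp2 hP Om u) vQ.
have cxx := smooth2_cont sxx; have cyy := smooth2_cont syy.
have Elap : ip Om (fun _ _ => lap u) v =
   \sum_(i < N) \sum_(j < My) cellint Om i j (fun x y => dx (dx u) x y * v i j x y)
   + \sum_(j < My) \sum_(i < N) cellint (swap_rect Om) j i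
       (fun x y => dx (dx (fun x y => u y x)) x y * swap v j i x y).
  rewrite [X in _ = _ + X]exchange_big -big_split; apply: eq_bigr => i _.
  rewrite -big_split; apply: eq_bigr => j _ /=.
  have c1 : cont2 (fun x y => dx (dx u) x y * v i j x y).
    by have ? := cv i j; cont.
  have c2 : cont2 (fun x y => dy (dy u) x y * v i j x y).
    by have ? := cv i j; cont.
  transitivity (cellint Om i j (fun x y => dx (dx u) x y * v i j x y)
      + cellint Om i j (fun x y => dy (dy u) x y * v i j x y)).
    rewrite /cellint -(int2D _ _ _ _ c1 c2).
    by apply: eq_int2 => x y _ _; rewrite lapE mulrDl.
  apply: (congr1 ( +%R _)); apply: (etrans (esym (cellint_swap Om i j c2))).
  by rewrite !dx_transpose.
have En : iter k.+3 dx (fun x y => u y x) = fun x y => iter k.+3 dy u y x.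
  exact: iter_dx_transpose.
have Em : iter k.+1 dy (dx (dx (fun x y => u y x))) =
    fun x y => iter k.+1 dx (dy (dy u)) y x.
  by rewrite !dx_transpose iter_dy_transpose.
have c3 : cont2 (fun x y => iter k.+3 dy u x y ^+ 2).
  by have ? := smooth2_cont (smooth2_iter_dy k.+3 su); cont.
have c4 : cont2 (fun x y => iter k.+1 dx (dy (dy u)) x y ^+ 2).
  by have ? := smooth2_cont (@smooth2_iter _ _ k.+1 0 syy); cont.
have R1 : intOm (swap_rect Om) (fun x y => iter k.+3 dx (fun x y => u y x) x y ^+ 2)
    = sqnorm Om (iter k.+3 dy u).
  by rewrite En; exact: (intOm_swap Om c3).
have R2 : intOm (swap_rect Om) (fun x y =>
    iter k.+1 dy (dx (dx (fun x y => u y x))) x y ^+ 2)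
    = sqnorm Om (iter k.+1 dx (dy (dy u))).
  by rewrite Em; exact: (intOm_swap Om c4).
rewrite R1 R2 in hy; rewrite Esplit Elap.
have n1 := sqnorm_ge0 Om (smooth2_cont (@smooth2_iter _ _ k.+3 0 su)).
have n2 := sqnorm_ge0 Om (smooth2_cont (smooth2_iter_dy k.+1 sxx)).
have n3 := sqnorm_ge0 Om (smooth2_cont (smooth2_iter_dy k.+3 su)).
have n4 := sqnorm_ge0 Om (smooth2_cont (@smooth2_iter _ _ k.+1 0 syy)).
have hX := pow_le_mesh k.+1 (Dx_gt0 Om hN) (Dx_le_mesh Om N My).
have hY := pow_le_mesh k.+1 (Dy_gt0 Om hMy) (Dy_le_mesh Om N My).
exact: (residual_algebra e0 C0 n1 n2 n3 n4 hX hY hx hy).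
Qed.

End ResidualEstimate.

Lemma add3_lin {R : realType} (a b A A1 A2 B B1 B2 C C1 C2 : R) :
  A = a * A1 + b * A2 -> B = a * B1 + b * B2 -> C = a * C1 + b * C2 ->
  A + B + C = a * (A1 + B1 + C1) + b * (A2 + B2 + C2).
Proof. by move=> -> -> ->; ring. Qed.

(** * Linearity and symmetry of the discrete forms *)

Section BrokenInnerProduct.
Context {R : realType}.
Variables (Om : rect R) (N My : nat).
Implicit Types (F G : R -> R -> R) (v w z : broken N My (R := R)) (a b e : R).

Definition cont_broken v := forall i j, cont2 (v i j).

Lemma Qh_cont k v : Qh k v -> cont_broken v.
Proof. by move=> vQ i j; exact: Qpoly_cont (vQ i j). Qed.

Lemma cont_broken_lin v w a b : cont_broken v -> cont_broken w ->
  cont_broken (fun i j x y => a * v i j x y + b * w i j x y).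
Proof.
by move=> cv cw i j; have ? := cv i j; have ? := cw i j; cont.
Qed.

Lemma Qh_lin k v w a b : Qh k v -> Qh k w ->
  Qh k (fun i j x y => a * v i j x y + b * w i j x y).
Proof. by move=> vQ wQ i j; exact: QpolyD. Qed.

Lemma int2_lin F G a b (p q r s : R) : cont2 F -> cont2 G ->
  int2 p q r s (fun x y => a * F x y + b * G x y) =
  a * int2 p q r s F + b * int2 p q r s G.
Proof.
move=> cF cG.
have cFa : cont2 (fun x y => a * F x y) by cont.
have cGb : cont2 (fun x y => b * G x y) by cont.
rewrite (int2D _ _ _ _ cFa cGb) !int2E//.
have Z (H : R -> R -> R) c : cont2 H ->
    int1 r s (fun y => int1 p q (fun x => c * H x y)) =
    c * int1 r s (fun y => int1 p q (fun x => H x y)).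
  move=> cH; rewrite -int1Z; last by cont.
  by apply: eq_int1 => y _; rewrite int1Z//; cont.
by rewrite (Z _ _ cF) (Z _ _ cG).
Qed.

Lemma ip_sym v w : ip Om v w = ip Om w v.
Proof.
apply: eq_bigr => i _; apply: eq_bigr => j _; apply: eq_int2 => x y _ _.
exact: mulrC.
Qed.

Lemma ip_lin v w z a b : cont_broken v -> cont_broken w -> cont_broken z ->
  ip Om (fun i j x y => a * v i j x y + b * w i j x y) z =
  a * ip Om v z + b * ip Om w z.
Proof.
move=> cv cw cz; rewrite /ip !mulr_sumr -big_split; apply: eq_bigr => i _ /=.
rewrite !mulr_sumr -big_split; apply: eq_bigr => j _ /=.
have := cv i j; have := cw i j; have := cz i j => c1 c2 c3.
rewrite /cellint -(int2_lin a b _ _ _ _ (contM c3 c1) (contM c2 c1)).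
by apply: eq_int2 => x y _ _; ring.
Qed.

Lemma ip_ge0 v : cont_broken v -> 0 <= ip Om v v.
Proof.
move=> cv; apply: sumr_ge0 => i _; apply: sumr_ge0 => j _.
apply: int2_ge0 => [|x y]; first exact: (contM (cv i j) (cv i j)).
by rewrite -expr2 sqr_ge0.
Qed.

Lemma ip_expand v w a b : cont_broken v -> cont_broken w ->
  let z := fun i j x y => a * v i j x y + b * w i j x y in
  ip Om z z = a ^+ 2 * ip Om v v + 2 * a * b * ip Om v w + b ^+ 2 * ip Om w w.
Proof.
move=> cv cw z; have cz : cont_broken z by exact: cont_broken_lin.
rewrite {1}/z ip_lin// [ip Om v z]ip_sym [ip Om w z]ip_sym !ip_lin//.
rewrite [ip Om w v]ip_sym.
by move: (ip _ _ _) (ip _ _ _) (ip _ _ _) => A B C; ring.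
Qed.

Lemma ip_AMGM v w e : 0 < e -> cont_broken v -> cont_broken w ->
  `|ip Om v w| <= e^-1 * ip Om v v + e * ip Om w w.
Proof.
move=> e0 cv cw.
have h1 := ip_ge0 (cont_broken_lin (a := 1) (b := e) cv cw).
have h2 := ip_ge0 (cont_broken_lin (a := 1) (b := - e) cv cw).
have n1 := ip_ge0 cv; have n2 := ip_ge0 cw.
rewrite !ip_expand// in h1 h2; move: h1 h2 n1 n2.
move: (ip _ _ _) (ip _ _ _) (ip _ _ _) => A B C h1 h2 A0 C0.
rewrite -(ler_pM2l e0) -{1}(gtr0_norm e0) -normrM.
rewrite mulrDr mulrA divff ?lt0r_neq0// mul1r ler_norml.
have eC : 0 <= e * (e * C) by rewrite !mulr_ge0// ltW.
have eE : e * (e * C) = e ^+ 2 * C by ring.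
rewrite eE in eC *; rewrite sqrrN expr1n mul1r mulr1 mulrN mulNr in h1 h2.
apply/andP; split; move: h1 h2 eC; rewrite -mulrA; set X := e * B;
  set Y := e ^+ 2 * C; clearbody X Y; lra.
Qed.

Lemma ip_lin_le v w a b : cont_broken v -> cont_broken w ->
  let z := fun i j x y => a * v i j x y + b * w i j x y in
  ip Om z z <= 2 * a ^+ 2 * ip Om v v + 2 * b ^+ 2 * ip Om w w.
Proof.
move=> cv cw /=; rewrite ip_expand//.
have := ip_ge0 (cont_broken_lin (a := a) (b := - b) cv cw); rewrite ip_expand//.
move: (ip _ _ _) (ip _ _ _) (ip _ _ _) => A B C; lra.
Qed.

Lemma eq_ip v v' w w' :
  (forall i j x y, xl Om i <= x <= xr Om i -> yl Om j <= y <= yr Om j ->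
     v i j x y = v' i j x y /\ w i j x y = w' i j x y) ->
  ip Om v w = ip Om v' w'.
Proof.
move=> h; apply: eq_bigr => i _; apply: eq_bigr => j _.
by apply: eq_int2 => x y hx hy; have [-> ->] := h i j x y hx hy.
Qed.

Lemma Aform_sym v w : Aform Om v w = Aform Om w v.
Proof.
have sum_eq (F G : 'I_N -> 'I_My -> R) : (forall i j, F i j = G i j) ->
    \sum_i \sum_j F i j = \sum_i \sum_j G i j.
  by move=> FG; apply: eq_bigr => i _; apply: eq_bigr => j _; exact: FG.
apply: (f_equal3 (fun a b c => a + b + c)); apply: sum_eq => i j.
- apply: eq_int2 => x y _ _.
  exact: (f_equal2 (fun a b => a + b) (mulrC _ _) (mulrC _ _)).
- by apply: eq_int1 => y _; exact: addrC.
- by apply: eq_int1 => y _; exact: addrC.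
Qed.

Lemma Qpoly_is_derive_x k F x y : Qpoly k F ->
  is_derive (x : R) (1 : R) (fun s => F s y) (dx F x y).
Proof.
move=> FQ; have [V [_ _ VE dVE]] := Qpoly_slices 0 0 1 FQ (oner_neq0 R).
have h := is_derive_poly (V y) x; rewrite -dVE !mul1r !add0r in h.
by congr (is_derive _ _ _ _) : h; apply/funext => s; rewrite -VE !mul1r !add0r.
Qed.

Lemma Qpoly_is_derive_y k F x y : Qpoly k F ->
  is_derive (y : R) (1 : R) (fun s => F x s) (dy F x y).
Proof. by move/Qpoly_transpose/(Qpoly_is_derive_x y x); rewrite dx_transpose. Qed.

Lemma Aform_lin k v w z a b : Qh k v -> Qh k w -> Qh k z ->
  Aform Om (fun i j x y => a * v i j x y + b * w i j x y) z =
  a * Aform Om v z + b * Aform Om w z.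
Proof.
move=> vQ wQ zQ; set u : @broken R N My := fun i j x y => _.
have ux : bdx u = fun i j x y => a * bdx v i j x y + b * bdx w i j x y.
  apply/funext => i; apply/funext => j; apply: dx_eq => x y.
  by apply: is_derive_lin; [exact: (Qpoly_is_derive_x _ _ (vQ i j))|
    exact: (Qpoly_is_derive_x _ _ (wQ i j))].
have uy : bdy u = fun i j x y => a * bdy v i j x y + b * bdy w i j x y.
  apply/funext => i; apply/funext => j; apply: dy_eq => x y.
  by apply: is_derive_lin; [exact: (Qpoly_is_derive_y _ _ (vQ i j))|
    exact: (Qpoly_is_derive_y _ _ (wQ i j))].
have cdx z' i j : Qh k z' -> cont2 (bdx z' i j).
  by move=> zQ'; exact: Qpoly_dx_cont (zQ' i j).
have cdy z' i j : Qh k z' -> cont2 (bdy z' i j).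
  by move=> zQ'; exact: Qpoly_dy_cont (zQ' i j).
have sum_lin (F G H : 'I_N -> 'I_My -> R) :
    (forall i j, F i j = a * G i j + b * H i j) ->
    \sum_i \sum_j F i j = a * (\sum_i \sum_j G i j) + b * (\sum_i \sum_j H i j).
  move=> FGH; rewrite !mulr_sumr -big_split; apply: eq_bigr => i _ /=.
  by rewrite !mulr_sumr -big_split; apply: eq_bigr => j _ /=.
have int1_lin (f g : R -> R) c d : continuous f -> continuous g ->
    int1 c d (fun s => a * f s + b * g s) = a * int1 c d f + b * int1 c d g.
  by move=> cf cg; rewrite int1D ?int1Z//; cont.
have cvh := Qh_cont vQ; have cwh := Qh_cont wQ; have czh := Qh_cont zQ.
rewrite /Aform ux uy; apply: add3_lin; apply: sum_lin => i j.
- have ? := cdx _ i j vQ; have ? := cdx _ i j wQ; have ? := cdx _ i j zQ.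
  have ? := cdy _ i j vQ; have ? := cdy _ i j wQ; have ? := cdy _ i j zQ.
  rewrite /cellint -int2_lin; [|by cont|by cont].
  by apply: eq_int2 => x y _ _; ring.
- have c1 := cdx _ i j vQ; have c2 := cdx _ i j wQ; have c3 := cdx _ i j zQ.
  have c1' := cdx _ (ordS i) j vQ; have c2' := cdx _ (ordS i) j wQ.
  have c3' := cdx _ (ordS i) j zQ; have ? := cvh i j; have ? := cwh i j.
  have ? := czh i j; have ? := cvh (ordS i) j; have ? := cwh (ordS i) j.
  have ? := czh (ordS i) j.
  rewrite /avgx /jumpx -int1_lin; [|by cont|by cont].
  by apply: eq_int1 => y _; rewrite /u; ring.
- have c1 := cdy _ i j vQ; have c2 := cdy _ i j wQ; have c3 := cdy _ i j zQ.
  have c1' := cdy _ i (ordS j) vQ; have c2' := cdy _ i (ordS j) wQ.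
  have c3' := cdy _ i (ordS j) zQ; have ? := cvh i j; have ? := cwh i j.
  have ? := czh i j; have ? := cvh i (ordS j); have ? := cwh i (ordS j).
  have ? := czh i (ordS j).
  rewrite /avgy /jumpy -int1_lin; [|by cont|by cont].
  by apply: eq_int1 => x _; rewrite /u; ring.
Qed.

Lemma Atilde_sym a1 a2 v w : Atilde Om a1 a2 v w = Atilde Om a1 a2 w v.
Proof. by rewrite /Atilde Aform_sym ip_sym. Qed.

Lemma Atilde_lin k a1 a2 v w z a b : Qh k v -> Qh k w -> Qh k z ->
  Atilde Om a1 a2 (fun i j x y => a * v i j x y + b * w i j x y) z =
  a * Atilde Om a1 a2 v z + b * Atilde Om a1 a2 w z.
Proof.
move=> vQ wQ zQ; rewrite /Atilde (Aform_lin a b vQ wQ zQ).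
rewrite ip_lin; [|exact: (Qh_cont vQ)|exact: (Qh_cont wQ)|exact: (Qh_cont zQ)].
move: (Aform _ _ _) (Aform _ _ _) (ip _ _ _) (ip _ _ _) (Num.sqrt _) (a1 / _).
by move=> A B C D c d; ring.
Qed.

End BrokenInnerProduct.

Lemma consistency_algebra {R : realType} (s b e C1 C2 A L E H r ap V : R) :
  0 < s -> 0 < e -> 0 <= C1 -> 0 <= C2 -> 0 <= H -> 0 <= r -> 0 <= ap ->
  `|A + L| <= (e / (2 * s))^-1 * C1 * (H * r) + e / (2 * s) * V ->
  `|E| <= (e / (2 * (`|b| + 1)))^-1 * C2 * (H * ap) + e / (2 * (`|b| + 1)) * V ->
  0 <= V ->
  `|s * (A + L) + b * E| <=
  e^-1 * (2 * s ^+ 2 * C1 + 2 * (`|b| + 1) ^+ 2 * C2) * (H * (r + ap)) + e * V.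
Proof.
move=> s0 e0 C10 C20 H0 r0 ap0 h1 h2 V0.
have B1 : 0 < `|b| + 1 by rewrite ltr_wpDl.
apply: (le_trans (ler_normD _ _)); rewrite !normrM (gtr0_norm s0).
have h1' := ler_wpM2l (ltW s0) h1.
have h2' : `|b| * `|E| <= (`|b| + 1) * ((e / (2 * (`|b| + 1)))^-1 * C2 * (H * ap)
    + e / (2 * (`|b| + 1)) * V).
  by apply: ler_pM => //; rewrite lerDl.
apply: (le_trans (lerD h1' h2')); move: (`|b| + 1) B1 => c c0.
have -> : s * ((e / (2 * s))^-1 * C1 * (H * r) + e / (2 * s) * V)
    + c * ((e / (2 * c))^-1 * C2 * (H * ap) + e / (2 * c) * V) =
    e^-1 * (2 * s ^+ 2 * C1 * (H * r) + 2 * c ^+ 2 * C2 * (H * ap)) + e * V.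
  by field; rewrite !lt0r_neq0.
rewrite lerD2r -[leRHS]mulrA; apply: ler_wpM2l; first by rewrite invr_ge0 ltW.
rewrite [leRHS]mulrDl; apply: lerD.
- apply: ler_wpM2l; first by rewrite !mulr_ge0// ltW.
  by apply: ler_wpM2l => //; rewrite lerDl.
- apply: ler_wpM2l; first by rewrite !mulr_ge0// ltW.
  by apply: ler_wpM2l => //; rewrite lerDr.
Qed.

Lemma pow2_le_mesh {R : realType} n (a b h : R) : 0 < a -> 0 < b ->
  a <= h -> b <= h -> (a * b ^+ n) ^+ 2 <= (h ^+ n.+1) ^+ 2.
Proof.
move=> a0 b0 ah bh; have h0 := lt_le_trans a0 ah.
have b0' := ltW b0; have h0' := ltW h0; have bn := exprn_ge0 n b0'.
have bh' : b ^+ n <= h ^+ n by apply: lerXn2r.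
have ab0 : 0 <= a * b ^+ n by rewrite mulr_ge0// ltW.
apply: lerXn2r; rewrite ?nnegrE ?exprn_ge0//.
by rewrite exprS; apply: ler_pM => //; exact: ltW.
Qed.

Lemma weighted_sum_le {R : realType} (C a b c h x y z : R) : 0 <= C ->
  0 <= x -> 0 <= y -> 0 <= z -> a <= h -> b <= h -> c <= h ->
  C * (a * x + b * y + c * z) <= C * (h * (x + y + z)).
Proof.
move=> C0 x0 y0 z0 ah bh ch; rewrite ler_wpM2l// !mulrDr.
by apply: lerD; [apply: lerD|]; exact: ler_wpM2r.
Qed.

(** * Consistency of the form with the differential operator *)

Section Consistency.
Context {R : realType}.
Variables (k : nat) (node : 'I_k.+3 -> R) (lam : 'I_k.+3 -> {poly R}).
Hypothesis hk : (1 <= k)%N.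
Hypothesis hP : quasi_projector node lam.
Implicit Types (Om : rect R) (u : R -> R -> R).

Lemma lap_lin u : lap u = fun x y => 1 * dx (dx u) x y + 1 * dy (dy u) x y.
Proof.
apply/funext => x; apply/funext => y; rewrite lapE.
exact: (esym (f_equal2 (fun r s : R => r + s) (mul1r _) (mul1r _))).
Qed.

Lemma smooth2_lap u : smooth2 u -> smooth2 (lap u).
Proof.
move=> su; rewrite lap_lin.
exact: (smooth2_lin 1 1 (smooth2_dx (smooth2_dx su)) (smooth2_dy (smooth2_dy su))).
Qed.

Lemma approx_norm_ge0 Om u : smooth2 u -> 0 <= approx_norm k Om u.
Proof.
move=> su; rewrite !addr_ge0//; apply: sqnorm_ge0; apply: smooth2_cont.
- exact: (@smooth2_iter _ u k.+1 0).
- exact: smooth2_iter_dy.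
- exact: (smooth2_iter_dy k (smooth2_dx su)).
Qed.

Lemma residual_norm_ge0 Om u : smooth2 u -> 0 <= residual_norm k Om u.
Proof.
move=> su; rewrite !addr_ge0//; apply: sqnorm_ge0; apply: smooth2_cont.
- exact: (@smooth2_iter _ u k.+3 0).
- exact: (smooth2_iter_dy k.+1 (smooth2_dx (smooth2_dx su))).
- exact: smooth2_iter_dy.
- exact: (@smooth2_iter _ _ k.+1 0 (smooth2_dy (smooth2_dy su))).
Qed.

Lemma interp_error_cont Om N My u : smooth2 u ->
  cont_broken (@interp_error R k node lam Om N My u).
Proof.
move=> su i j; have cu := smooth2_cont su.
have cI := @interp2_cont R k node lam hP Om N My u i j.
by rewrite /interp_error; cont.
Qed.

Lemma interp_error_bound : exists2 C : R, 0 <= C &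
  forall Om N My u, (0 < N)%N -> (0 < My)%N -> smooth2 u ->
  ip Om (@interp_error R k node lam Om N My u) (interp_error node lam Om u)
  <= C * ((meshsize Om N My ^+ k.+1) ^+ 2 * approx_norm k Om u).
Proof.
have [C C0 HC] := interp2_approx hk hP.
exists C => // Om N My u hN hMy su; apply: (le_trans (HC _ _ _ _ hN hMy su)).
have n1 := sqnorm_ge0 Om (smooth2_cont (@smooth2_iter _ _ k.+1 0 su)).
have n2 := sqnorm_ge0 Om (smooth2_cont (smooth2_iter_dy k.+1 su)).
have n3 := sqnorm_ge0 Om (smooth2_cont (smooth2_iter_dy k (smooth2_dx su))).
have X0 := Dx_gt0 Om hN; have Y0 := Dy_gt0 Om hMy.
have hX := Dx_le_mesh Om N My; have hY := Dy_le_mesh Om N My.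
have h1 := pow_le_mesh k.+1 X0 hX; have h2 := pow_le_mesh k.+1 Y0 hY.
have h3 := pow2_le_mesh k X0 Y0 hX hY.
exact: (weighted_sum_le C0 n1 n2 n3 h1 h2 h3).
Qed.

Lemma interp_error_test : exists2 C : R, 0 <= C &
  forall Om N My u (v : broken N My) (e : R), (0 < N)%N -> (0 < My)%N -> 0 < e -> smooth2 u ->
  cont_broken v ->
  `|ip Om (@interp_error R k node lam Om N My u) v|
  <= e^-1 * C * ((meshsize Om N My ^+ k.+1) ^+ 2 * approx_norm k Om u)
     + e * ip Om v v.
Proof.
have [C C0 HC] := interp_error_bound.
exists C => // Om N My u v e hN hMy e0 su cv.

apply: (le_trans (ip_AMGM Om e0 (@interp_error_cont Om N My u su) cv)).
rewrite lerD2r -[leRHS]mulrA ler_wpM2l ?invr_ge0 ?(ltW e0)//.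
exact: HC.
Qed.

(* The strong form of the bilinear form [Atilde a1 a2]. *)
Definition sqrt_op (a1 a2 : R) u : R -> R -> R := fun x y =>
  - Num.sqrt (- a2) * lap u x y + a1 / (2 * Num.sqrt (- a2)) * u x y.

Lemma smooth2_sqrt_op a1 a2 u : smooth2 u -> smooth2 (sqrt_op a1 a2 u).
Proof. by move=> su; exact: (smooth2_lin _ _ (smooth2_lap su) su). Qed.

(** The difference is [s] times the residual of [Aform] plus [b] times the interpolation error
    tested against [v]; the weight [e] is shared between the two. *)
Lemma Atilde_consistency (a1 a2 : R) : a2 < 0 -> exists2 C : R, 0 <= C &
  forall Om N My u (v : broken N My) (e : R), (0 < N)%N -> (0 < My)%N -> 0 < e ->
  smooth2 u -> perx (xhi Om - xlo Om) u -> pery (yhi Om - ylo Om) u -> Qh k v ->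
  `|Atilde Om a1 a2 (interp2 node lam Om u) v
    - ip Om (fun _ _ => sqrt_op a1 a2 u) v|
  <= e^-1 * C * ((meshsize Om N My ^+ k.+1) ^+ 2
                 * (residual_norm k Om u + approx_norm k Om u))
     + e * ip Om v v.
Proof.
move=> ha2; have [C1 C10 H1] := Aform_residual hk hP.
have [C2 C20 H2] := interp_error_test.
set s := Num.sqrt (- a2); set b := a1 / (2 * s).
have s0 : 0 < s by rewrite sqrtr_gt0 oppr_gt0.
exists (2 * s ^+ 2 * C1 + 2 * (`|b| + 1) ^+ 2 * C2).
  by apply: addr_ge0; apply: mulr_ge0 => //; apply: mulr_ge0 => //; exact: sqr_ge0.
move=> Om N My u v e hN hMy e0 su pxu pyu vQ.
have e1 : 0 < e / (2 * s) by rewrite divr_gt0 ?mulr_gt0.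
(* The absolute value of [b] is increased by 1, because [b] vanishes together with [a1]. *)
have e2 : 0 < e / (2 * (`|b| + 1)) by rewrite divr_gt0 ?mulr_gt0 ?ltr_wpDl.
have cv := Qh_cont vQ.
have h1 := H1 Om N My u v _ hN hMy e1 su pxu pyu vQ.
have h2 := H2 Om N My u v _ hN hMy e2 su cv.
have cu : @cont_broken R N My (fun _ _ => u) by move=> i j; exact: (smooth2_cont su).
have cl : @cont_broken R N My (fun _ _ => lap u).
  by move=> i j; exact: (smooth2_cont (smooth2_lap su)).
have cI : @cont_broken R N My (interp2 node lam Om u).
  exact: (Qh_cont (Qh_interp2 hP Om u)).
have E1 := ip_lin Om (- s) b cl cu cv.
have E2 := ip_lin Om 1 (-1) cI cu cv.
have E3 : ip Om (fun (_ : 'I_N) (_ : 'I_My) => sqrt_op a1 a2 u) v =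
  - s * ip Om (fun _ _ => lap u) v + b * ip Om (fun _ _ => u) v by exact: E1.
have E4 : ip Om (interp_error node lam Om u) v =
    1 * ip Om (interp2 node lam Om u) v + -1 * ip Om (fun _ _ => u) v.
  rewrite -E2; apply: eq_ip => i j x y _ _; split => //.
  by rewrite /interp_error mul1r mulN1r.
rewrite E3 /Atilde -/s -/b.
have -> : s * Aform Om (interp2 node lam Om u) v
    + b * ip Om (interp2 node lam Om u) v
    - (- s * ip Om (fun _ _ => lap u) v + b * ip Om (fun _ _ => u) v) =
    s * (Aform Om (interp2 node lam Om u) v + ip Om (fun _ _ => lap u) v)
    + b * ip Om (interp_error node lam Om u) v.
  rewrite E4; move: (Aform _ _ _) (ip _ _ _) (ip _ _ _) (ip _ _ _) => A B C D.
  by move: s b {s0 e1 e2 h1 h2 E1 E3} => p q; ring.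
have h0 : 0 <= (meshsize Om N My ^+ k.+1) ^+ 2 by exact: sqr_ge0.
have r0 := residual_norm_ge0 Om su; have ap0 := approx_norm_ge0 Om su.
have V0 := ip_ge0 Om cv.
exact: (consistency_algebra s0 e0 C10 C20 h0 r0 ap0 h1 h2 V0).
Qed.

End Consistency.

(** * Energy and stability *)

Section RealDerivatives.
Context {R : realType}.
Implicit Types f g : R -> R.

Lemma is_derive_mul f g (x f' g' : R) :
  is_derive x (1 : R) f f' -> is_derive x (1 : R) g g' ->
  is_derive x (1 : R) (fun s => f s * g s) (f' * g x + f x * g').
Proof.
move=> df dg; apply: (is_derive_eq (is_deriveM df dg)).
by rewrite /GRing.scale /= addrC [g x * _]mulrC.
Qed.

Lemma is_derive_big (I : Type) (r : seq I) (F : I -> R -> R) (F' : I -> R) (x : R) :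
  (forall i, is_derive x (1 : R) (F i) (F' i)) ->
  is_derive x (1 : R) (fun s => \sum_(i <- r) F i s) (\sum_(i <- r) F' i).
Proof.
move=> dF; elim: r => [|i r IHr].
  rewrite big_nil; have -> : (fun s => \sum_(i <- [::]) F i s) = cst 0.
    by apply/funext => s; rewrite big_nil.
  exact: is_derive_cst.
rewrite big_cons.
have -> : (fun s => \sum_(j <- i :: r) F j s) = F i + (fun s => \sum_(j <- r) F j s).
  by apply/funext => s; rewrite big_cons.
exact: is_deriveD.
Qed.

(* Gronwall's inequality: [exp (- K s) f s - D s] is nonincreasing. *)
Lemma gronwall f (f' : R -> R) (T K D : R) : 0 < T ->
  {within `[0, T], continuous f} ->
  (forall s : R, 0 < s < T -> is_derive s (1 : R) f (f' s)) ->
  (forall s, 0 < s < T -> f' s <= K * f s + D * expR (K * s)) ->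
  forall t, 0 <= t <= T -> f t <= expR (K * t) * (f 0 + D * t).
Proof.
move=> T0 cf df hf t /andP[t0 tT].
pose g s := expR (- (K * s)) * f s - D * s.
pose g' s := - K * expR (- (K * s)) * f s + expR (- (K * s)) * f' s - D.
have dE s : is_derive (s : R) (1 : R) (fun s => expR (- (K * s)))
    (- K * expR (- (K * s))).
  have dl : is_derive (s : R) (1 : R) (fun s => 0 + - K * s) (- K).
    exact: is_derive_affine.
  have := @is_derive1_comp R expR (fun s => 0 + - K * s) s _ _
    (is_derive_expR (0 + - K * s)) dl.
  rewrite add0r mulNr mulrC; congr (is_derive _ _ _ _).
  by apply/funext => r /=; rewrite add0r mulNr.
have dD s : is_derive (s : R) (1 : R) (fun s => D * s) D.
  have := is_derive_affine 0 D s; congr (is_derive _ _ _ _).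
  by apply/funext => r; rewrite add0r.
have dg s : 0 < s < T -> is_derive s (1 : R) g (g' s).
  by move=> sT; apply: is_deriveB; apply: is_derive_mul; exact: df.
have g'0 s : 0 < s < T -> g' s <= 0.
  move=> sT; have e0 : 0 < expR (- (K * s)) by exact: expR_gt0.
  have := ler_wpM2l (ltW e0) (hf s sT).
  rewrite mulrDr [_ * (D * _)]mulrCA -expRD addNr expR0 mulr1 /g'.
  move: (expR _) (f s) (f' s) {e0} => A B C; rewrite mulrA; lra.
have cg : {within `[0, T], continuous g}.
  have cE : {within `[0, T], continuous (fun s => expR (- (K * s)))}.
    by apply: continuous_subspaceT; exact: is_derive_cont dE.
  have cD : {within `[0, T], continuous (fun s => D * s)}.
    by apply: continuous_subspaceT; exact: is_derive_cont dD.
  exact: (contB (contM cE cf) cD).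
have : g t <= g 0.
  apply: (@ler0_derive1_nincr _ g 0 T _ _ cg 0 t (lexx 0) t0 tT).
  - by move=> s; rewrite in_itv/= => /dg[].
  - move=> s; rewrite in_itv/= => sT; rewrite derive1E.
    by have [_ ->] := dg s sT; exact: g'0.
rewrite /g !mulr0 oppr0 expR0 mul1r addr0 => h.
have e0 : 0 < expR (K * t) by exact: expR_gt0.
rewrite -(ler_pM2l (expR_gt0 (- (K * t)))) mulrA -expRD addNr expR0 mul1r.
by rewrite -lerBlDr.
Qed.

End RealDerivatives.

(** * The energy as a quadratic form in point values *)

Section Energy.
Context {R : realType}.
Variables (k : nat) (node : 'I_k.+3 -> R) (lam : 'I_k.+3 -> {poly R}).
Hypothesis hP : quasi_projector node lam.
Variables (Om : rect R) (N My : nat).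
Hypotheses (hN : (0 < N)%N) (hMy : (0 < My)%N).
Implicit Types (v w : broken N My (R := R)).

Lemma interp2_id f (i : 'I_N) (j : 'I_My) : Qpoly k f ->
  interp2 node lam Om f i j = f.
Proof.
move=> fQ; have [_ _ rep _] := hP.
have hx0 := Dx_gt0 Om hN; have hy0 := Dy_gt0 Om hMy.
apply/funext => x; apply/funext => y.
have -> : x = xl Om i + Dx Om N * ((x - xl Om i) / Dx Om N).
  by rewrite mulrC divfK ?lt0r_neq0// addrC subrK.
have -> : y = yl Om j + Dy Om My * ((y - yl Om j) / Dy Om My).
  by rewrite mulrC divfK ?lt0r_neq0// addrC subrK.
move: ((x - _) / _) ((y - _) / _) => {x y} x y; rewrite interp2_ref//.
have [V [_ sV VE _]] := Qpoly_slices (xl Om i) 0 1 fQ (lt0r_neq0 hx0).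
have [W [_ sW WE _]] :=
  Qpoly_slices (yl Om j) 0 1 (Qpoly_transpose fQ) (lt0r_neq0 hy0).
have -> : (fun s => (quasi_interp node lam (fun t => f (xl Om i + Dx Om N * s)
    (yl Om j + Dy Om My * t))).[y]) =
    horner (V (yl Om j + Dy Om My * y)).
  apply/funext => s.
  have -> : (fun t => f (xl Om i + Dx Om N * s) (yl Om j + Dy Om My * t)) =
      horner (W (xl Om i + Dx Om N * s)).
    by apply/funext => t; rewrite -WE add0r mul1r.
  by rewrite rep// -WE -VE !add0r !mul1r.
by rewrite rep// -VE add0r mul1r.
Qed.

Definition nodal v (i : 'I_N) (j : 'I_My) (m : 'I_k.+3 * 'I_k.+3) : R :=
  v i j (xl Om i + Dx Om N * node m.1) (yl Om j + Dy Om My * node m.2).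

Definition nodal_basis (m : 'I_k.+3 * 'I_k.+3) : broken N My := fun i j x y =>
  (lam m.1).[(x - xl Om i) / Dx Om N] * (lam m.2).[(y - yl Om j) / Dy Om My].

(** The functions [nodal_basis] span the discrete space but are overcomplete: (k + 3)^2 samples for
    dimension (k + 1)^2. The expansion suffices to make the energy a fixed quadratic form in point
    values, whose regularity in time is part of the notion of solution. *)
Lemma nodal_expand v : Qh k v ->
  v = fun i j x y => \sum_m nodal v i j m * nodal_basis m i j x y.
Proof.
move=> vQ; apply/funext => i; apply/funext => j.
rewrite -[LHS](interp2_id i j (vQ i j)); apply/funext => x; apply/funext => y.
by rewrite /interp2 pair_bigA.
Qed.

Lemma nodal_basis_cont m (i : 'I_N) (j : 'I_My) : cont2 (nodal_basis m i j).
Proof. by rewrite /nodal_basis; cont. Qed.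

Definition gram i j m n : R := cellint Om i j (fun x y =>
  nodal_basis m i j x y * nodal_basis n i j x y).

Lemma ip_nodal v w : Qh k v -> Qh k w ->
  ip Om v w = \sum_i \sum_j \sum_m \sum_n nodal v i j m * nodal w i j n * gram i j m n.
Proof.
move=> /nodal_expand + /nodal_expand.
move: (nodal v) (nodal w) => c d -> ->.
apply: eq_bigr => i _; apply: eq_bigr => j _; rewrite /cellint.
have int2_sum (F : 'I_k.+3 * 'I_k.+3 -> R -> R -> R) (e : 'I_k.+3 * 'I_k.+3 -> R) :
    (forall m, cont2 (F m)) ->
    int2 (xl Om i) (xr Om i) (yl Om j) (yr Om j) (fun x y => \sum_m e m * F m x y) =
    \sum_m e m * int2 (xl Om i) (xr Om i) (yl Om j) (yr Om j) (F m).
  move=> cF; elim: (index_enum _) => [|m r IHr].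
    rewrite big_nil; have c0 : cont2 (fun _ _ : R => 0 : R) by cont.
    transitivity (int2 (xl Om i) (xr Om i) (yl Om j) (yr Om j)
      (fun x y => 0 * (fun _ _ => 0) x y + 0 * (fun _ _ => 0) x y)).
      by apply: eq_int2 => x y _ _; rewrite big_nil !mul0r addr0.
    by rewrite (int2_lin 0 0 _ _ _ _ c0 c0) !mul0r addr0.
  have cs : cont2 (fun x y => \sum_(m <- r) e m * F m x y).
    by rewrite /cont2; apply: cont_sum => n _; have ? := cF n; cont.
  rewrite big_cons -IHr.
  rewrite -[X in _ = _ + X]mul1r -(int2_lin (e m) 1 _ _ _ _ (cF m) cs).
  by apply: eq_int2 => x y _ _; rewrite big_cons mul1r.
have cL m : cont2 (nodal_basis m i j) by exact: nodal_basis_cont.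
transitivity (int2 (xl Om i) (xr Om i) (yl Om j) (yr Om j) (fun x y =>
    \sum_m c i j m * (\sum_n d i j n *
      (nodal_basis m i j x y * nodal_basis n i j x y)))).
  apply: eq_int2 => x y _ _; rewrite mulr_suml; apply: eq_bigr => m _.
  rewrite -mulrA mulr_sumr; congr (_ * _); apply: eq_bigr => n _.
  by rewrite mulrCA.
rewrite (int2_sum (fun m x y => \sum_n d i j n *
      (nodal_basis m i j x y * nodal_basis n i j x y))); last first.
  move=> m; rewrite /cont2; apply: cont_sum => n _.
  by have ? := cL m; have ? := cL n; cont.
apply: eq_bigr => m _.
rewrite (int2_sum (fun n x y => nodal_basis m i j x y * nodal_basis n i j x y)).
  by rewrite mulr_sumr; apply: eq_bigr => n _; rewrite mulrA.
by move=> n; exact: (contM (cL m) (cL n)).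
Qed.

Lemma energy_cont (w : R -> broken N My) (T : R) :
  (forall s, 0 <= s <= T -> Qh k (w s)) ->
  (forall i j x y, {within `[0, T], continuous (fun s => w s i j x y)}) ->
  {within `[0, T], continuous (fun s => ip Om (w s) (w s))}.
Proof.
move=> wQ cw; pose E s := \sum_i \sum_j \sum_m \sum_n
  nodal (w s) i j m * nodal (w s) i j n * gram i j m n.
apply: (@subspace_eq_continuous _ _ _ E) => [s|].
  rewrite inE /= in_itv/= => sT; have sQ := wQ s sT.
  exact: (esym (ip_nodal sQ sQ)).
apply: cont_sum => i _; apply: cont_sum => j _.
apply: cont_sum => m _; apply: cont_sum => n _.
by apply: contM; [apply: contM; exact: cw|exact: cont_cst].
Qed.

(** That the time derivative stays in the discrete space is not part of [dg_solution]; it follows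
    from differentiating the nodal expansion and uniqueness of the derivative. *)
Lemma energy_derive (w : R -> broken N My) (w' : broken N My) (t : R) :
  (\forall s \near t, Qh k (w s)) ->
  (forall i j x y, is_derive t (1 : R) (fun s => w s i j x y) (w' i j x y)) ->
  is_derive t (1 : R) (fun s => ip Om (w s) (w s)) (2 * ip Om w' (w t)) /\ Qh k w'.
Proof.
move=> nQ dw; have wtQ : Qh k (w t) by exact: nbhs_singleton nQ.
have w'Q : Qh k w'.
  suff -> : w' = fun i j x y => \sum_m nodal w' i j m * nodal_basis m i j x y.
    move=> i j; apply: Qpoly_eq (Qh_interp2 hP Om (w' i j) i j) => x y.
    by rewrite /interp2 pair_bigA.
  apply/funext => i; apply/funext => j; apply/funext => x; apply/funext => y.
  apply: (is_derive_unique (dw i j x y)).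
  apply: (@near_eq_is_derive _ _ _ (fun s =>
    \sum_m nodal (w s) i j m * nodal_basis m i j x y)).
    by apply: filterS nQ => s sQ; rewrite [in RHS](nodal_expand sQ).
  apply: is_derive_big => m.
  have dm := is_derive_mul (dw i j (xl Om i + Dx Om N * node m.1)
    (yl Om j + Dy Om My * node m.2)) (is_derive_cst (nodal_basis m i j x y) t 1).
  by apply: (is_derive_eq dm); rewrite mulr0 addr0.
split => //.
apply: (@near_eq_is_derive _ _ _ (fun s => \sum_i \sum_j \sum_m \sum_n
  nodal (w s) i j m * nodal (w s) i j n * gram i j m n)).
  by apply: filterS nQ => s sQ; rewrite [in RHS]ip_nodal.
have -> : 2 * ip Om w' (w t) = \sum_i \sum_j \sum_m \sum_n
    (nodal w' i j m * nodal (w t) i j n + nodal (w t) i j m * nodal w' i j n)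
    * gram i j m n.
  rewrite mulr_natl mulr2n {2}ip_sym !ip_nodal// -big_split; apply: eq_bigr => i _ /=.
  rewrite -big_split; apply: eq_bigr => j _ /=.
  rewrite -big_split; apply: eq_bigr => m _ /=.
  by rewrite -big_split; apply: eq_bigr => n _ /=; rewrite mulrDl.
apply: is_derive_big => i; apply: is_derive_big => j.
apply: is_derive_big => m; apply: is_derive_big => n.
have dmn := is_derive_mul (dw i j (xl Om i + Dx Om N * node m.1)
  (yl Om j + Dy Om My * node m.2)) (dw i j (xl Om i + Dx Om N * node n.1)
  (yl Om j + Dy Om My * node n.2)).
have dG := is_derive_mul dmn (is_derive_cst (gram i j m n) t 1).
by apply: (is_derive_eq dG); rewrite mulr0 addr0.
Qed.

End Energy.

(** * Stability of the semi-discrete scheme *)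

Section Stability.
Context {R : realType}.
Variables (Om : rect R) (N My k : nat) (a0 a1 a2 : R) (u0 : R -> R -> R).
Variables (uh qh : R -> broken N My (R := R)).
Hypotheses (hk : (1 <= k)%N) (hN : (0 < N)%N) (hMy : (0 < My)%N).
Hypothesis dg : dg_solution Om k a0 a1 a2 u0 uh qh.

Local Notation M := (a0 - a1 ^+ 2 / (4 * a2)).

Definition dg_dt (t : R) : broken N My := fun i j x y =>
  derive1 (fun s => uh s i j x y) t.

Lemma dg_is_derive (t : R) i j x y : 0 < t ->
  is_derive t (1 : R) (fun s => uh s i j x y) (dg_dt t i j x y).
Proof.
by move=> t0; rewrite /dg_dt derive1E; apply: derivableP; exact: (dg_derivable dg).
Qed.

Lemma dg_Qh (t : R) : 0 <= t -> Qh k (uh t).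
Proof.
rewrite le_eqVlt => /predU1P[<-|]; last exact: (dg_uh dg).
by have [] := dg_init dg.
Qed.

(** Differentiability is available for positive times only; at time 0 the right limit [dg_init_cont]
    takes over. *)
Lemma dg_within_cont (T : R) i j x y : 0 < T ->
  {within `[0, T], continuous (fun s => uh s i j x y)}.
Proof.
move=> T0; have ct s : 0 < s -> {for s, continuous (fun s => uh s i j x y)}.
  move=> s0; have [ds _] := dg_is_derive i j x y s0.
  by apply: differentiable_continuous; apply/derivable1_diffP.
apply/continuous_within_itvP => //; split.
- by move=> s; rewrite in_itv/= => /andP[s0 _]; exact: ct.
- exact: (dg_init_cont dg).
- exact: (cvg_at_left_filter (ct T T0)).
Qed.

Lemma near_pos (t : R) (P : R -> Prop) : 0 < t -> (forall s, 0 < s -> P s) ->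
  \forall s \near t, P s.
Proof. by move=> t0 HP; apply: filterS (lt_nbhsr t0) => s; exact: HP. Qed.

Lemma dg_stability (t : R) : 0 <= t ->
  bnorm Om (uh t) <= bnorm Om (uh 0) * expR (M * t).
Proof.
have [node [lam hP]] := exists_quasi_projector (R := R) hk.
rewrite le_eqVlt => /predU1P[<-|t0]; first by rewrite mulr0 expR0 mulr1.
(* [gronwall] is applied on [0, t] without source term; the energy is a squared norm, hence the rate
   [2 * M]. *)
have h : ip Om (uh t) (uh t) <= expR (2 * M * t) * (ip Om (uh 0) (uh 0) + 0 * t).
  apply: (@gronwall _ (fun s => ip Om (uh s) (uh s))
    (fun s => 2 * ip Om (dg_dt s) (uh s)) t (2 * M) 0 t0).
  - have uQ s : 0 <= s <= t -> Qh k (uh s) by move=> /andP[s0 _]; exact: dg_Qh.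
    apply: (@energy_cont R k node lam hP Om N My hN hMy uh t uQ) => i j x y.
    exact: dg_within_cont.
  - move=> s /andP[s0 _].
    have nQ : \forall r \near s, Qh k (uh r) by exact: near_pos (dg_uh dg).
    have dE i j x y := dg_is_derive i j x y s0.
    by have [] := @energy_derive R k node lam hP Om N My hN hMy uh _ s nQ dE.
  - move=> s /andP[s0 _]; rewrite mul0r addr0 /dg_dt.
    have uQ := dg_uh dg s0; have qQ := dg_qh dg s0.
    rewrite (dg_eq1 dg s0 uQ) Atilde_sym -(dg_eq2 dg s0 qQ).
    have := ip_ge0 Om (Qh_cont qQ); move: (ip _ (qh s) _) (ip _ (uh s) _) M => A B C; lra.
  - by rewrite ltW//= lexx.
rewrite mul0r addr0 in h.
rewrite /bnorm; apply: (le_trans (ler_wsqrtr h)).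
have -> : 2 * M * t = M * t + M * t by ring.
rewrite sqrtrM ?expR_ge0// mulrC expRD -expr2 sqrtr_sqr.
by rewrite ger0_norm ?expR_ge0.
Qed.

End Stability.

(** * Time derivative of the exact solution *)

Section ExactTimeDerivative.
Context {R : realType}.
Variable T : R.
Implicit Types u : R -> R -> R -> R.

(** [dt] is a limit relative to [0, T]; an interior time has a neighbourhood inside this interval,
    so there the limit is the two-sided derivative. *)
Lemma smooth_is_derive_t u (t x y : R) : smooth T u -> 0 < t < T ->
  is_derive t (1 : R) (fun s => u s x y) (dt T u t x y).
Proof.
move=> su /andP[t0 tT]; have [_ [/(_ t x y) + _ _ _]] := su 1%N.
have t0T : 0 <= t <= T by rewrite !ltW.
move=> /(_ t0T)[du _ _].
have lim_growth : h^-1 *: (u (h *: 1 + t) x y - u t x y) @[h --> 0^'] --> dt T u t x y.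
  apply/cvgrPdist_lt => e e0.
  have /cvgrPdist_lt/(_ e e0) W := du.
  have {W} W : nbhs t (fun s => s != t -> [set` `[0, T]] s ->
      `|dt T u t x y - quot_t u t x y s| < e) := W.
  have shift : (fun h : R => h + t) h @[h --> (0 : R)] --> t.
    by rewrite -[X in _ --> X]add0r; apply: cvgD; [exact: cvg_id|exact: cvg_cst].
  have I : nbhs t (fun s => 0 < s < T).
    by apply: filterS2 (lt_nbhsr t0) (lt_nbhsl tT) => s -> ->.
  have W0 : nbhs (0 : R) (fun h => h + t != t -> [set` `[0, T]] (h + t) ->
      `|dt T u t x y - quot_t u t x y (h + t)| < e) := shift _ W.
  have I0 : nbhs (0 : R) (fun h => 0 < h + t < T) := shift _ I.
  have W1 : nbhs (0 : R) (fun h => h != 0 ->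
      `|dt T u t x y - h^-1 *: (u (h *: 1 + t) x y - u t x y)| < e).
    apply: filterS2 W0 I0 => h; rewrite (_ : h *: (1 : R) = h); last exact: mulr1.
    move=> Wh /andP[h0 hT] hn0.
    have htn : h + t != t by rewrite -subr_eq0 addrK.
    have hI : [set` `[0, T]] (h + t) by rewrite /= in_itv/= !ltW.
    by have := Wh htn hI; rewrite /quot_t addrK /GRing.scale /= mulrC.
  exact: W1.
apply: DeriveDef; first by apply/cvg_ex; exists (dt T u t x y).
exact: cvg_lim.
Qed.

Lemma smooth_within_cont u x y : smooth T u ->
  {within `[0, T], continuous (fun s => u s x y)}.
Proof.
move=> su; have [/subspace_continuousP cu _] := su 0%N.
apply/subspace_continuousP => t; rewrite /= in_itv/= => tT A uA.
have H : nbhs (t, x, y) (fun p : R * R * R => 0 <= p.1.1 <= T -> A (u p.1.1 p.1.2 p.2)).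
  exact: (cu (t, x, y) tT A uA).
have phi : (fun s : R => (s, x, y)) s @[s --> t] --> (t, x, y).
  have c1 : (fun s : R => (s, x)) s @[s --> t] --> (t, x).
    exact: (cvg_pair cvg_id (cvg_cst x)).
  exact: (cvg_pair c1 (cvg_cst y)).
have H' : nbhs t (fun s => 0 <= s <= T -> A (u s x y)) := phi _ H.
have : nbhs t (fun s => [set` `[0, T]] s -> A (u s x y)).
  by apply: filterS H' => s Hs; rewrite /= in_itv.
exact.
Qed.

End ExactTimeDerivative.

(** * Norms of the exact solution *)

Section RealAlgebra.
Context {R : realType}.
Implicit Types A B C D S x y : R.

Lemma sum3_lin x y A B C A' B' C' :
  x * A + y * A' + (x * B + y * B') + (x * C + y * C') =
  x * (A + B + C) + y * (A' + B' + C').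
Proof. by ring. Qed.

Lemma sum4_lin x y A B C D A' B' C' D' :
  x * A + y * A' + (x * B + y * B') + (x * C + y * C' + (x * D + y * D')) =
  x * (A + B + (C + D)) + y * (A' + B' + (C' + D')).
Proof. by ring. Qed.

Lemma sum3_le A B C S : A <= S -> B <= S -> C <= S -> A + B + C <= 3 * S.
Proof. by move=> ? ? ?; lra. Qed.

Lemma sum4_le A B C D S : A <= S -> B <= S -> C <= S -> D <= S ->
  A + B + (C + D) <= 4 * S.
Proof. by move=> ? ? ? ?; lra. Qed.

Lemma lap_sum_le A B S : A <= S -> B <= S -> 2 * A + 2 * B <= 4 * S.
Proof. by move=> ? ?; lra. Qed.

Lemma residual_sum_le A B C x y : 0 <= C -> A <= x -> B <= y ->
  A + B + (y + x) <= 2 * (x + y + C).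
Proof. by move=> ? ? ?; lra. Qed.

End RealAlgebra.

Section DerivativeNorms.
Context {R : realType}.
Implicit Types (Om : rect R) (v w : R -> R -> R) (a b c d m n k : nat).

Lemma iter_dy_iter_dx v b c : smooth2 v ->
  iter b dy (iter c dx v) = iter c dx (iter b dy v).
Proof.
move=> sv; elim: c => [//|c IHc] /=.
by rewrite (iter_dy_dx b (@smooth2_iter _ v c 0 sv)) IHc.
Qed.

Lemma iter_iter v a b c d : smooth2 v ->
  iter a dx (iter b dy (iter c dx (iter d dy v))) =
  iter (a + c) dx (iter (b + d) dy v).
Proof.
by move=> sv; rewrite (iter_dy_iter_dx _ _ (smooth2_iter_dy d sv)) !iterD.
Qed.

Lemma iter_lin v w a b (p q : R) : smooth2 v -> smooth2 w ->
  iter a dx (iter b dy (fun x y => p * v x y + q * w x y)) =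
  fun x y => p * iter a dx (iter b dy v) x y + q * iter a dx (iter b dy w) x y.
Proof.
move=> sv sw; rewrite iter_dy_lin//; apply: iter_dx_lin; exact: smooth2_iter_dy.
Qed.

Lemma iter_lap v a b : smooth2 v ->
  iter a dx (iter b dy (lap v)) = fun x y =>
    1 * iter a.+2 dx (iter b dy v) x y + 1 * iter a dx (iter b.+2 dy v) x y.
Proof.
move=> sv; rewrite lap_lin.
have e1 : iter a dx (iter b dy (dx (dx v))) = iter a.+2 dx (iter b dy v).
  by have := iter_iter a b 2 0 sv; rewrite addn2 addn0.
have e2 : iter a dx (iter b dy (dy (dy v))) = iter a dx (iter b.+2 dy v).
  by have := iter_iter a b 0 2 sv; rewrite addn2 addn0.
exact: (etrans (iter_lin a b 1 1 (smooth2_dx (smooth2_dx sv)) (smooth2_dy (smooth2_dy sv)))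
  (f_equal2 (fun (V W : R -> R -> R) x y => 1 * V x y + 1 * W x y) e1 e2)).
Qed.

Lemma lap_iter v a b : smooth2 v ->
  lap (iter a dx (iter b dy v)) = iter a dx (iter b dy (lap v)).
Proof.
move=> sv; rewrite lap_lin.
have e : dy (dy (iter a dx (iter b dy v))) = iter a dx (iter b.+2 dy v).
  exact: (iter_iter 0 2 a b sv).
exact: (etrans (f_equal (fun (W : R -> R -> R) x y =>
  1 * dx (dx (iter a dx (iter b dy v))) x y + 1 * W x y) e) (esym (iter_lap a b sv))).
Qed.

Definition sqD Om a b v : R := sqnorm Om (iter a dx (iter b dy v)).

Lemma sqD_ge0 Om a b v : smooth2 v -> 0 <= sqD Om a b v.
Proof. by move=> sv; apply: sqnorm_ge0; exact: smooth2_cont (smooth2_iter a b sv). Qed.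

Lemma sqnorm_lin Om v w (p q : R) : cont2 v -> cont2 w ->
  sqnorm Om (fun x y => p * v x y + q * w x y) <=
  2 * p ^+ 2 * sqnorm Om v + 2 * q ^+ 2 * sqnorm Om w.
Proof.
move=> cv cw.
have cv2 : cont2 (fun x y => v x y ^+ 2) by cont.
have cw2 : cont2 (fun x y => w x y ^+ 2) by cont.
have cs : cont2 (fun x y => (p * v x y + q * w x y) ^+ 2) by cont.
have cd : cont2 (fun x y => (p * v x y - q * w x y) ^+ 2) by cont.
have d0 : 0 <= intOm Om (fun x y => (p * v x y - q * w x y) ^+ 2).
  by apply: int2_ge0 => // x y; exact: sqr_ge0.
have E : 2 * p ^+ 2 * sqnorm Om v + 2 * q ^+ 2 * sqnorm Om w =
    sqnorm Om (fun x y => p * v x y + q * w x y)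
    + intOm Om (fun x y => (p * v x y - q * w x y) ^+ 2).
  rewrite /sqnorm /intOm -(int2_lin _ _ _ _ _ _ cv2 cw2) -(int2D _ _ _ _ cs cd).
  by apply: eq_int2 => x y _ _; ring.
by rewrite E lerDl.
Qed.

Lemma sqD_lin Om a b v w (p q : R) : smooth2 v -> smooth2 w ->
  sqD Om a b (fun x y => p * v x y + q * w x y) <=
  2 * p ^+ 2 * sqD Om a b v + 2 * q ^+ 2 * sqD Om a b w.
Proof.
move=> sv sw; rewrite {1}/sqD iter_lin//.
apply: sqnorm_lin; exact: smooth2_cont (smooth2_iter a b _).
Qed.

Lemma sqD_lap Om a b v : smooth2 v ->
  sqD Om a b (lap v) <= 2 * sqD Om a.+2 b v + 2 * sqD Om a b.+2 v.
Proof.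
move=> sv; rewrite {1}/sqD iter_lap//.
have := sqnorm_lin Om 1 1 (smooth2_cont (smooth2_iter a.+2 b sv))
  (smooth2_cont (smooth2_iter a b.+2 sv)).
by rewrite expr1n !mulr1.
Qed.

Lemma sqD_Hnorm Om a b m v : smooth2 v -> (a + b <= m)%N ->
  sqD Om a b v <= Hnorm Om m v ^+ 2.
Proof.
move=> sv abm; have am : (a < m.+1)%N by rewrite ltnS (leq_trans (leq_addr b a)).
have bm : (b < m.+1)%N by rewrite ltnS (leq_trans (leq_addl a b)).
have s0 (i j : nat) : 0 <= intOm Om (fun x y => iter i dx (iter j dy v) x y ^+ 2).
  exact: (sqD_ge0 Om i j sv).
rewrite /Hnorm sqr_sqrtr; last by apply: sumr_ge0 => i _; exact: sumr_ge0.
rewrite (bigD1 (Ordinal am))//= (bigD1 (Ordinal bm))//= -addrA.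
by rewrite lerDl addr_ge0//; apply: sumr_ge0 => // i _; exact: sumr_ge0.
Qed.

Lemma sqD_Hseminorm Om a b m v : smooth2 v -> (a + b)%N = m ->
  sqD Om a b v <= Hseminorm Om m v ^+ 2.
Proof.
move=> sv abm; have am : (a < m.+1)%N by rewrite ltnS -abm leq_addr.
have bm : (b < m.+1)%N by rewrite ltnS -abm leq_addl.
have s0 (i j : nat) : 0 <= intOm Om (fun x y => iter i dx (iter j dy v) x y ^+ 2).
  exact: (sqD_ge0 Om i j sv).
rewrite /Hseminorm sqr_sqrtr; last by apply: sumr_ge0 => i _; exact: sumr_ge0.
rewrite (bigD1 (Ordinal am))//= (bigD1 (Ordinal bm))/=; last by rewrite abm.
rewrite -addrA lerDl addr_ge0//; apply: sumr_ge0 => // i _; exact: sumr_ge0.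
Qed.

Lemma approx_normE Om k v : smooth2 v ->
  approx_norm k Om v = sqD Om k.+1 0 v + sqD Om 0 k.+1 v + sqD Om 1 k v.
Proof. by move=> sv; rewrite /approx_norm (iter_dy_dx k sv). Qed.

Lemma residual_normE Om k v : smooth2 v -> residual_norm k Om v =
  sqD Om k.+3 0 v + sqD Om 2 k.+1 v + (sqD Om 0 k.+3 v + sqD Om k.+1 2 v).
Proof.
move=> sv; rewrite /residual_norm.
have -> : iter k.+1 dy (dx (dx v)) = iter 2 dx (iter k.+1 dy v).
  exact: (iter_dy_iter_dx k.+1 2 sv).
by [].
Qed.

Lemma approx_norm_lin Om k v w (p q : R) : smooth2 v -> smooth2 w ->
  approx_norm k Om (fun x y => p * v x y + q * w x y) <=
  2 * p ^+ 2 * approx_norm k Om v + 2 * q ^+ 2 * approx_norm k Om w.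
Proof.
move=> sv sw; rewrite !approx_normE//; last exact: smooth2_lin.
have h1 := sqD_lin Om k.+1 0 p q sv sw; have h2 := sqD_lin Om 0 k.+1 p q sv sw.
have h3 := sqD_lin Om 1 k p q sv sw.
exact: (le_trans (lerD (lerD h1 h2) h3) (eq_le_refl (sum3_lin _ _ _ _ _ _ _ _))).
Qed.

Lemma residual_norm_lin Om k v w (p q : R) : smooth2 v -> smooth2 w ->
  residual_norm k Om (fun x y => p * v x y + q * w x y) <=
  2 * p ^+ 2 * residual_norm k Om v + 2 * q ^+ 2 * residual_norm k Om w.
Proof.
move=> sv sw; rewrite !residual_normE//; last exact: smooth2_lin.
have h1 := sqD_lin Om k.+3 0 p q sv sw; have h2 := sqD_lin Om 2 k.+1 p q sv sw.
have h3 := sqD_lin Om 0 k.+3 p q sv sw; have h4 := sqD_lin Om k.+1 2 p q sv sw.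
exact: (le_trans (lerD (lerD h1 h2) (lerD h3 h4))
  (eq_le_refl (sum4_lin _ _ _ _ _ _ _ _ _ _))).
Qed.

Lemma approx_norm_Hnorm Om k v : smooth2 v ->
  approx_norm k Om v <= 3 * Hnorm Om k.+1 v ^+ 2.
Proof.
move=> sv; rewrite approx_normE//.
have h1 : sqD Om k.+1 0 v <= Hnorm Om k.+1 v ^+ 2
  by apply: sqD_Hnorm; rewrite ?addn0.
have h2 : sqD Om 0 k.+1 v <= Hnorm Om k.+1 v ^+ 2
  by apply: sqD_Hnorm; rewrite ?addn0.
have h3 : sqD Om 1 k v <= Hnorm Om k.+1 v ^+ 2
  by apply: sqD_Hnorm; rewrite ?addn0.
exact: (sum3_le h1 h2 h3).
Qed.

Lemma approx_norm_Hseminorm Om k v : smooth2 v ->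
  approx_norm k Om v <= 3 * Hseminorm Om k.+1 v ^+ 2.
Proof.
move=> sv; rewrite approx_normE//.
have h1 : sqD Om k.+1 0 v <= Hseminorm Om k.+1 v ^+ 2
  by apply: sqD_Hseminorm; rewrite ?addn0 ?addn2.
have h2 : sqD Om 0 k.+1 v <= Hseminorm Om k.+1 v ^+ 2
  by apply: sqD_Hseminorm; rewrite ?addn0 ?addn2.
have h3 : sqD Om 1 k v <= Hseminorm Om k.+1 v ^+ 2
  by apply: sqD_Hseminorm; rewrite ?addn0 ?addn2.
exact: (sum3_le h1 h2 h3).
Qed.

Lemma approx_norm_lap Om k v : smooth2 v ->
  approx_norm k Om (lap v) <= 3 * (4 * Hseminorm Om k.+3 v ^+ 2).
Proof.
move=> sv; rewrite approx_normE; last exact: smooth2_lap.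
have H a b : (a + b)%N = k.+1 -> sqD Om a b (lap v) <= 4 * Hseminorm Om k.+3 v ^+ 2.
  move=> ab; apply: (le_trans (sqD_lap Om a b sv)).
  have h1 : sqD Om a.+2 b v <= Hseminorm Om k.+3 v ^+ 2.
    by apply: sqD_Hseminorm; rewrite // !addSn ab.
  have h2 : sqD Om a b.+2 v <= Hseminorm Om k.+3 v ^+ 2.
    by apply: sqD_Hseminorm; rewrite // !addnS ab.
  exact: (lap_sum_le h1 h2).
have h1 := H k.+1 0%N (addn0 _); have h2 := H 0%N k.+1 erefl.
have h3 := H 1%N k erefl.
exact: (sum3_le h1 h2 h3).
Qed.

Lemma residual_norm_Hseminorm Om k v : smooth2 v ->
  residual_norm k Om v <= 4 * Hseminorm Om k.+3 v ^+ 2.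
Proof.
move=> sv; rewrite residual_normE//.
have h1 : sqD Om k.+3 0 v <= Hseminorm Om k.+3 v ^+ 2
  by apply: sqD_Hseminorm; rewrite ?addn0 ?addn2.
have h2 : sqD Om 2 k.+1 v <= Hseminorm Om k.+3 v ^+ 2
  by apply: sqD_Hseminorm; rewrite ?addn0 ?addn2.
have h3 : sqD Om 0 k.+3 v <= Hseminorm Om k.+3 v ^+ 2
  by apply: sqD_Hseminorm; rewrite ?addn0 ?addn2.
have h4 : sqD Om k.+1 2 v <= Hseminorm Om k.+3 v ^+ 2
  by apply: sqD_Hseminorm; rewrite ?addn0 ?addn2.
exact: (sum4_le h1 h2 h3 h4).
Qed.

Lemma perx_lap v (L : R) : smooth2 v -> perx L v -> perx L (lap v).
Proof.
move=> sv pv x y; rewrite !lapE.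
exact: (f_equal2 (fun r s : R => r + s) (@perx_iter _ L v 2 0 sv pv x y)
  (@perx_iter _ L v 0 2 sv pv x y)).
Qed.

Lemma pery_lap v (L : R) : smooth2 v -> pery L v -> pery L (lap v).
Proof.
move=> sv pv x y; rewrite !lapE.
exact: (f_equal2 (fun r s : R => r + s) (@pery_iter _ L v 2 0 sv pv x y)
  (@pery_iter _ L v 0 2 sv pv x y)).
Qed.

(* Periodicity bounds the mixed fourth order terms by the bilaplacian, the only
   fourth order quantity that the equation controls. *)
Lemma residual_norm_lap Om k v : smooth2 v -> perx (xhi Om - xlo Om) v ->
  pery (yhi Om - ylo Om) v ->
  residual_norm k Om (lap v) <= 2 * approx_norm k Om (lap (lap v)).
Proof.
move=> sv pxv pyv; have sl := smooth2_lap sv; have sll := smooth2_lap sl.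
have pxl := perx_lap sv pxv; have pyl := pery_lap sv pyv.
have H a b : sqD Om a.+2 b (lap v) <= sqD Om a b (lap (lap v)) /\
             sqD Om a b.+2 (lap v) <= sqD Om a b (lap (lap v)).
  have := lap_dominates (smooth2_iter a b sl) (xlo_lt Om) (ylo_lt Om)
    (perx_iter a b sl pxl) (pery_iter a b sl pyl).
  rewrite (lap_iter a b sl).
  have e : dy (dy (iter a dx (iter b dy (lap v)))) = iter a dx (iter b.+2 dy (lap v)).
    exact: (iter_iter 0 2 a b sl).
  by rewrite e.
(* Two more derivatives in either variable, added to the multi-indices (k + 1, 0) and (0, k + 1),
   produce exactly the four terms of [residual_norm]. *)
have [h1 h4] := H k.+1 0%N; have [h2 h3] := H 0%N k.+1.
rewrite (residual_normE Om k sl) (approx_normE Om k sll).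
have h0 := sqD_ge0 Om 1 k sll.
exact: (le_trans (lerD (lerD h1 h2) (lerD h3 h4)) (residual_sum_le h0 (lexx _) (lexx _))).
Qed.

End DerivativeNorms.

(** * Error estimate *)

Section ErrorAlgebra.
Context {R : realType}.

Lemma lin_bound (A X Y p q x y S : R) : A <= 2 * p ^+ 2 * X + 2 * q ^+ 2 * Y ->
  X <= x * S -> Y <= y * S -> A <= (2 * p ^+ 2 * x + 2 * q ^+ 2 * y) * S.
Proof.
move=> hA hX hY; apply: (le_trans hA); rewrite [leRHS]mulrDl; have p2 := sqr_ge0 p.
have q2 := sqr_ge0 q; apply: lerD; rewrite -[leRHS]mulrA.
  by apply: ler_wpM2l => //; rewrite mulr_ge0.
by apply: ler_wpM2l => //; rewrite mulr_ge0.
Qed.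

(* Here [P] is the pairing of the time derivative of the error with the error,
   [V] and [E] are the energies of the errors of qh and uh, and the five
   differences bounded below are the consistency errors. *)
Lemma error_identity (M P p1 p2 A1 u1 A2 A3 V q1 q2 A4 A5 A6 E u2 q3 b3 u3 t3 : R) :
  P = p1 - p2 -> p1 = - A1 + M * u1 -> A2 = A1 - A3 -> V = q1 - q2 -> q1 = A4 ->
  A5 = A4 - A6 -> A5 = A2 -> E = u1 - u2 -> t3 = - b3 + M * u3 ->
  P = - V + (A6 - q3) - (q2 - q3) - (A3 - b3) + M * E + M * (u2 - u3) - (p2 - t3).
Proof.
move=> -> -> hA2 -> -> hA5 h52 -> ->.
have -> : A4 = A1 - A3 + A6 by rewrite -hA2 -h52 hA5 subrK.
by ring.
Qed.

(** The two consistency errors tested against the error of [qh] get the weight 1 / 2, so that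
    together they use up exactly the dissipation [- V]. The other three leave multiples of [E] for
    Gronwall's inequality. *)
Lemma error_bound (M V r1 r2 r3 E r4 r5 C1 C2 H a b c d f : R) :
  0 <= C1 -> 0 <= C2 -> 0 <= H -> 0 <= E ->
  0 <= a -> 0 <= b -> 0 <= c -> 0 <= d -> 0 <= f ->
  `|r1| <= (1 / 2)^-1 * C2 * (H * (a + b)) + 1 / 2 * V ->
  `|r2| <= (1 / 2)^-1 * C1 * (H * d) + 1 / 2 * V ->
  `|r3| <= 1^-1 * C2 * (H * (c + d)) + 1 * E ->
  `|r4| <= 1^-1 * C1 * (H * b) + 1 * E ->
  `|r5| <= 1^-1 * C1 * (H * f) + 1 * E ->
  let K := 4 * (`|M| + 1) * (C1 + C2 + 1) in
  2 * (- V + r1 - r2 - r3 + M * E + M * r4 - r5) <=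
  K * E + K * (H * (a + b + (c + d) + f)).
Proof.
move=> C10 C20 H0 E0 a0 b0 c0 d0 f0.
have h2E : (1 / 2 : R)^-1 = 2 by field.
rewrite h2E invr1 !mul1r => h1 h2 h3 h4 h5 /=; set K := 4 * _ * _.
have KE : K = 4 * (`|M| * C1 + `|M| * C2 + `|M| + (C1 + C2 + 1)).
  by rewrite /K {K}; ring.
clearbody K.
have hM : M * r4 <= `|M| * (C1 * (H * b) + E).
  by apply: (le_trans (ler_norm _)); rewrite normrM; apply: ler_wpM2l.
have hE : M * E <= `|M| * E by apply: ler_wpM2r => //; exact: ler_norm.
have i1 := le_trans (ler_norm r1) h1.
have i2 : - r2 <= 2 * C1 * (H * d) + 2^-1 * V.
  by apply: le_trans h2; rewrite -normrN ler_norm.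
have i3 : - r3 <= C2 * (H * (c + d)) + E.
  by apply: le_trans h3; rewrite -normrN ler_norm.
have i5 : - r5 <= C1 * (H * f) + E.
  by apply: le_trans h5; rewrite -normrN ler_norm.
have m0 : 0 <= `|M| by [].
have mC1 : 0 <= `|M| * C1 by exact: mulr_ge0.
have mC2 : 0 <= `|M| * C2 by exact: mulr_ge0.
have bnd y z : 0 <= y -> z <= K -> z * y <= K * y by move=> y0; exact: ler_wpM2r.
have bE : (4 + 4 * `|M|) * E <= K * E by apply: bnd => //; rewrite KE; lra.
have ba : (4 * C2) * (H * a) <= K * (H * a).
  by apply: bnd; [exact: mulr_ge0|rewrite KE; lra].
have bb : (4 * C2 + 2 * (`|M| * C1)) * (H * b) <= K * (H * b).
  by apply: bnd; [exact: mulr_ge0|rewrite KE; lra].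
have bc : (2 * C2) * (H * c) <= K * (H * c).
  by apply: bnd; [exact: mulr_ge0|rewrite KE; lra].
have bd : (4 * C1 + 2 * C2) * (H * d) <= K * (H * d).
  by apply: bnd; [exact: mulr_ge0|rewrite KE; lra].
have bf : (2 * C1) * (H * f) <= K * (H * f).
  by apply: bnd; [exact: mulr_ge0|rewrite KE; lra].
have -> : K * E + K * (H * (a + b + (c + d) + f)) = K * E + K * (H * a)
  + K * (H * b) + K * (H * c) + K * (H * d) + K * (H * f) by ring.
apply: le_trans (lerD (lerD (lerD (lerD (lerD bE ba) bb) bc) bd) bf).
have -> : (4 + 4 * `|M|) * E + 4 * C2 * (H * a) + (4 * C2 + 2 * (`|M| * C1)) * (H * b)
    + 2 * C2 * (H * c) + (4 * C1 + 2 * C2) * (H * d) + 2 * C1 * (H * f) =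
  2 * (- V + (2 * C2 * (H * (a + b)) + 2^-1 * V) + (2 * C1 * (H * d) + 2^-1 * V)
    + (C2 * (H * (c + d)) + E) + `|M| * E + `|M| * (C1 * (H * b) + E)
    + (C1 * (H * f) + E)) by field.
rewrite ler_pM2l//.
exact: (lerD (lerD (lerD (lerD (lerD (lerD (lexx (- V)) i1) i2) i3) hE) hM) i5).
Qed.

End ErrorAlgebra.

Lemma lap_comb {R : realType} (v w : R -> R -> R) (p q x y : R) :
  smooth2 v -> smooth2 w ->
  lap (fun x y => p * v x y + q * w x y) x y = p * lap v x y + q * lap w x y.
Proof.
move=> sv sw; rewrite !lapE.
have ex := etrans (f_equal dx (dx_lin p q sv sw))
  (dx_lin p q (smooth2_dx sv) (smooth2_dx sw)).
have ey := etrans (f_equal dy (dy_lin p q sv sw))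
  (dy_lin p q (smooth2_dy sv) (smooth2_dy sw)).
have split_sum (a b c d : R) : p * a + q * b + (p * c + q * d) =
    p * (a + c) + q * (b + d) by ring.
exact: (etrans (f_equal2 (fun F G : R -> R -> R => F x y + G x y) ex ey)
  (split_sum _ _ _ _)).
Qed.

Section BrokenDifference.
Context {R : realType}.
Variables (Om : rect R) (N My : nat).
Implicit Types (v w z : broken N My (R := R)).

Definition bsub v w : broken N My := fun i j x y => v i j x y - w i j x y.

Lemma bsubE v w : bsub v w = fun i j x y => 1 * v i j x y + -1 * w i j x y.
Proof.
apply/funext => i; apply/funext => j; apply/funext => x; apply/funext => y.
by rewrite mul1r mulN1r.
Qed.

Lemma Qh_sub k v w : Qh k v -> Qh k w -> Qh k (bsub v w).
Proof. by move=> vQ wQ; rewrite bsubE; exact: Qh_lin. Qed.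

Lemma ip_sub v w z : cont_broken v -> cont_broken w -> cont_broken z ->
  ip Om (bsub v w) z = ip Om v z - ip Om w z.
Proof. by move=> cv cw cz; rewrite bsubE ip_lin// mul1r mulN1r. Qed.

Lemma Atilde_sub k (a1 a2 : R) v w z : Qh k v -> Qh k w -> Qh k z ->
  Atilde Om a1 a2 (bsub v w) z = Atilde Om a1 a2 v z - Atilde Om a1 a2 w z.
Proof. by move=> vQ wQ zQ; rewrite bsubE (Atilde_lin _ _ _ _ _ vQ wQ zQ) mul1r mulN1r. Qed.

End BrokenDifference.

(** * Energy balance of the error *)

Section ErrorEquation.
Context {R : realType}.
Variables (k : nat) (node : 'I_k.+3 -> R) (lam : 'I_k.+3 -> {poly R}).
Hypothesis hk : (1 <= k)%N.
Hypothesis hP : quasi_projector node lam.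
Variables (a0 a1 a2 : R).
Hypothesis ha2 : a2 < 0.

Local Notation M := (a0 - a1 ^+ 2 / (4 * a2)).
Local Notation B := (sqrt_op a1 a2).

(** Completing the square in the Laplacian: [2 * s * b = a1] and [b ^+ 2 = - a1 ^+ 2 / (4 * a2)],
    the latter because [s ^+ 2 = - a2]. *)
Lemma sqrt_op_factor u x y : smooth2 u ->
  Lop a0 a1 a2 u x y = -1 * B (B u) x y + M * u x y.
Proof.
move=> su; have sl := smooth2_lap su.
set s := Num.sqrt (- a2); pose b := a1 / (2 * s).
have s0 : 0 < s by rewrite sqrtr_gt0 oppr_gt0.
have ss : a2 = - s ^+ 2 by rewrite sqr_sqrtr ?opprK// oppr_ge0 ltW.
have lapB : lap (B u) x y = - s * lap (lap u) x y + b * lap u x y.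
  exact: (lap_comb _ _ _ _ sl su).
have eB : B (B u) x y = - s * lap (B u) x y + b * (- s * lap u x y + b * u x y) := erefl _.
have eL : Lop a0 a1 a2 u x y = a0 * u x y + a1 * lap u x y + a2 * lap (lap u) x y :=
  erefl _.
rewrite eL eB lapB; clear eL eB lapB.
move: (lap (lap u) x y) (lap u x y) (u x y) => X Y Z.
rewrite /b ss; move: s s0 {b ss} => s s0; field.
exact: lt0r_neq0.
Qed.

(** A statement about one instant: [uh'] and [ut] stand for the time derivatives, and the scheme
    enters only through its two weak equations. *)
Lemma error_energy : exists2 K : R, 0 <= K &
  forall (Om : rect R) (N My : nat) (u ut : R -> R -> R) (uh uh' qh : broken N My),
  (0 < N)%N -> (0 < My)%N -> smooth2 u -> smooth2 ut ->
  perx (xhi Om - xlo Om) u -> pery (yhi Om - ylo Om) u ->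
  (forall x y, ut x y = Lop a0 a1 a2 u x y) ->
  Qh k uh -> Qh k uh' -> Qh k qh ->
  (forall phi, Qh k phi ->
     ip Om uh' phi = - Atilde Om a1 a2 qh phi + M * ip Om uh phi) ->
  (forall psi, Qh k psi -> ip Om qh psi = Atilde Om a1 a2 uh psi) ->
  let th := bsub uh (interp2 node lam Om u) in
  2 * ip Om (bsub uh' (interp2 node lam Om ut)) th <= K * ip Om th th
   + K * ((meshsize Om N My ^+ k.+1) ^+ 2 *
       (residual_norm k Om u + approx_norm k Om u
        + (residual_norm k Om (B u) + approx_norm k Om (B u)) + approx_norm k Om ut)).
Proof.
have [C1 C10 H1] := interp_error_test hk hP.
have [C2 C20 H2] := Atilde_consistency hk hP a1 ha2.
exists (4 * (`|M| + 1) * (C1 + C2 + 1)).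
  by rewrite !mulr_ge0 ?addr_ge0.
move=> Om N My u ut uh uh' qh hN hMy su sut pxu pyu pde uhQ uhQ' qhQ eq1 eq2 /=.
set th := bsub uh _.
have sq := smooth2_sqrt_op a1 a2 su.
pose U : broken N My := interp2 node lam Om u.
pose Ut : broken N My := interp2 node lam Om ut.
pose Q : broken N My := interp2 node lam Om (B u).
have UQ : Qh k U by exact: Qh_interp2.
have UtQ : Qh k Ut by exact: Qh_interp2.
have QQ : Qh k Q by exact: Qh_interp2.
pose X := bsub qh Q.
have thQ : Qh k th by exact: Qh_sub.
have XQ : Qh k X by exact: Qh_sub.
have cth := Qh_cont thQ; have cX := Qh_cont XQ.
have cst v : smooth2 v -> @cont_broken R N My (fun _ _ => v).
  by move=> sv i j; exact: (smooth2_cont sv).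
have perxB : perx (xhi Om - xlo Om) (B u).
  by move=> x y; rewrite /sqrt_op (perx_lap su pxu) pxu.
have peryB : pery (yhi Om - ylo Om) (B u).
  by move=> x y; rewrite /sqrt_op (pery_lap su pyu) pyu.
have e0 : 0 < 1 / 2 :> R by rewrite divr_gt0.
have e1 : 0 < 1 :> R by [].
have b1 := H2 Om N My u X _ hN hMy e0 su pxu pyu XQ.
have b2 := H1 Om N My (B u) X _ hN hMy e0 sq cX.
have b3 := H2 Om N My (B u) th _ hN hMy e1 sq perxB peryB thQ.
have b4 := H1 Om N My u th _ hN hMy e1 su cth.
have b5 := H1 Om N My ut th _ hN hMy e1 sut cth.
have ierr v z : smooth2 v -> cont_broken z -> ip Om (interp_error node lam Om v) z =
    ip Om (@interp2 R k node lam Om N My v) z - ip Om (fun _ _ => v) z.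
  by move=> sv cz; exact: (ip_sub Om (Qh_cont (Qh_interp2 hP Om v)) (cst _ sv) cz).
rewrite (ierr _ _ sq cX) in b2; rewrite (ierr _ _ su cth) in b4.
rewrite (ierr _ _ sut cth) in b5.
have Et3 : ip Om (fun _ _ => ut) th =
    - ip Om (fun _ _ => B (B u)) th + M * ip Om (fun _ _ => u) th.
  have := ip_lin Om (-1) M (cst _ (smooth2_sqrt_op a1 a2 sq)) (cst _ su) cth.
  rewrite mulN1r => <-; apply: eq_ip => i j x y _ _; split=> //.
  by rewrite pde sqrt_op_factor.
(* Symmetry of [Atilde] cancels its values on the pair of errors [th] and [X], which no estimate
   would control; apart from the energies [V] and [E], only consistency errors remain. *)
have id := error_identity (ip Om (fun _ _ => B u) X) (ip_sub Om (Qh_cont uhQ') (Qh_cont UtQ) cth) (eq1 th thQ)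
  (Atilde_sub Om a1 a2 qhQ QQ thQ) (ip_sub Om (Qh_cont qhQ) (Qh_cont QQ) cX)
  (eq2 X XQ) (Atilde_sub Om a1 a2 uhQ UQ XQ) (Atilde_sym Om a1 a2 th X)
  (ip_sub Om (Qh_cont uhQ) (Qh_cont UQ) cth) Et3.
rewrite id.
apply: (error_bound _ C10 C20 (sqr_ge0 _) (ip_ge0 Om cth) (residual_norm_ge0 k Om su)
  (approx_norm_ge0 k Om su) (residual_norm_ge0 k Om sq) (approx_norm_ge0 k Om sq)
  (approx_norm_ge0 k Om sut) b1 b2 b3 b4 b5).
Qed.

End ErrorEquation.

(** * Norms of the auxiliary variable in terms of the solution *)

Section SolutionNorms.
Context {R : realType}.
Variables (a0 a1 a2 : R).
Hypothesis ha2 : a2 < 0.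

Lemma solution_norms : exists2 K : R, 0 <= K &
  forall (Om : rect R) k (v w : R -> R -> R) S, smooth2 v -> smooth2 w ->
  perx (xhi Om - xlo Om) v -> pery (yhi Om - ylo Om) v ->
  (forall x y, w x y = Lop a0 a1 a2 v x y) ->
  Hnorm Om k.+1 w ^+ 2 <= S -> Hseminorm Om k.+3 v ^+ 2 <= S ->
  Hseminorm Om k.+1 v ^+ 2 <= S ->
  residual_norm k Om v + approx_norm k Om v
  + (residual_norm k Om (sqrt_op a1 a2 v) + approx_norm k Om (sqrt_op a1 a2 v))
  + approx_norm k Om w <= K * S.
Proof.
pose s := Num.sqrt (- a2); pose b := a1 / (2 * s); pose c := a2^-1.
(* [Kz] and [Kll] belong to the approximation norms of [a0 v + a1 lap v] and of the bilaplacian,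
   [Kr] and [Kq] to the residual and approximation norms of [sqrt_op a1 a2 v]. The 12 is 3 times 4,
   from [approx_norm_lap]. *)
pose Kz := 2 * a0 ^+ 2 * 3 + 2 * a1 ^+ 2 * 12.
pose Kll := 2 * c ^+ 2 * 3 + 2 * (- c) ^+ 2 * Kz.
pose Kr := 2 * (- s) ^+ 2 * (2 * Kll) + 2 * b ^+ 2 * 4.
pose Kq := 2 * (- s) ^+ 2 * 12 + 2 * b ^+ 2 * 3.
have pos (p q x y : R) : 0 <= x -> 0 <= y -> 0 <= 2 * p ^+ 2 * x + 2 * q ^+ 2 * y.
  by move=> x0 y0; rewrite addr_ge0// mulr_ge0// mulr_ge0// sqr_ge0.
have Kz0 : 0 <= Kz by exact: pos.
have Kll0 : 0 <= Kll by exact: pos.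
have Kr0 : 0 <= Kr by apply: pos => //; exact: mulr_ge0.
have Kq0 : 0 <= Kq by exact: pos.
exists (4 + 3 + (Kr + Kq) + 3).
  by apply: addr_ge0 => //; apply: addr_ge0; exact: addr_ge0.
move=> Om k v w S sv sw pxv pyv pde hw hv3 hv1.
have sl := smooth2_lap sv; have sll := smooth2_lap sl.
have scale (x A B : R) : 0 <= x -> A <= x * B -> B <= S -> A <= x * S.
  by move=> x0 AB BS; apply: (le_trans AB); exact: ler_wpM2l.
have Aw : approx_norm k Om w <= 3 * S by exact: (scale _ _ _ _ (approx_norm_Hnorm Om k sw)).
have Av : approx_norm k Om v <= 3 * S.
  exact: (scale _ _ _ _ (approx_norm_Hseminorm Om k sv)).
have Rv : residual_norm k Om v <= 4 * S.
  exact: (scale _ _ _ _ (residual_norm_Hseminorm Om k sv)).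
have Al : approx_norm k Om (lap v) <= 12 * S.
  apply: (scale _ _ (Hseminorm Om k.+3 v ^+ 2)) => //.
  by apply: (le_trans (approx_norm_lap Om k sv)); apply: eq_le_refl; ring.
pose z x y := a0 * v x y + a1 * lap v x y.
have sz : smooth2 z by exact: (smooth2_lin a0 a1 sv sl).
have Az : approx_norm k Om z <= Kz * S.
  exact: (lin_bound (approx_norm_lin Om k a0 a1 sv sl) Av Al).
have Ell : lap (lap v) = fun x y => c * w x y + - c * z x y.
  apply/funext => x; apply/funext => y; rewrite pde /z /c.
  have eL : Lop a0 a1 a2 v x y = a0 * v x y + a1 * lap v x y + a2 * lap (lap v) x y :=
    erefl _.
  rewrite eL; move: (lap (lap v) x y) (lap v x y) (v x y) => X Y Z.
  by field; exact: ltr0_neq0.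
have All : approx_norm k Om (lap (lap v)) <= Kll * S.
  rewrite Ell; exact: (lin_bound (approx_norm_lin Om k c (- c) sw sz) Aw Az).
have Rl : residual_norm k Om (lap v) <= 2 * Kll * S.
  by rewrite -mulrA; apply: (le_trans (residual_norm_lap k sv pxv pyv)); rewrite ler_pM2l.
have Rq : residual_norm k Om (sqrt_op a1 a2 v) <= Kr * S.
  exact: (lin_bound (residual_norm_lin Om k (- s) b sl sv) Rl Rv).
have Aq : approx_norm k Om (sqrt_op a1 a2 v) <= Kq * S.
  exact: (lin_bound (approx_norm_lin Om k (- s) b sl sv) Al Av).
have split_sum (x y : R) : (4 + 3 + (x + y) + 3) * S =
    4 * S + 3 * S + (x * S + y * S) + 3 * S by ring.
rewrite split_sum; exact: (lerD (lerD (lerD Rv Av) (lerD Rq Aq)) Aw).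
Qed.

End SolutionNorms.

(** * Suprema over time *)

Section Suprema.
Context {R : realType}.
Variables (Om : rect R) (T : R).
Implicit Types u : R -> R -> R -> R.

Lemma smooth_sqD_bounded u a b : smooth T u ->
  exists B : R, forall t, 0 <= t <= T -> sqD Om a b (u t) <= B.
Proof.
move=> su; have [Mb Mb0 HM] :=
  smooth_bounded (xlo Om) (xhi Om) (ylo Om) (yhi Om) (smooth_iter a b su).
have cM : cont2 (fun _ _ : R => Mb ^+ 2) by cont.
exists (intOm Om (fun _ _ => Mb ^+ 2)) => t tT.
have s2 := smooth2_iter a b (smooth_smooth2 su tT).
have c2 := smooth2_cont s2.
have cd : cont2 (fun x y => iter a dx (iter b dy (u t)) x y ^+ 2) by cont.
rewrite /sqD /sqnorm /intOm !int2E//.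
apply: int1_le => [| |y hy].
- by cont.
- by cont.
apply: int1_le => [| |x hx].
- by cont.
- by cont.
have := HM t x y tT hx hy; rewrite -(ler_sqr) ?nnegrE// real_normK// num_real.
exact.
Qed.

(** The norms must be shown bounded in time, by compactness of [0, T] times the rectangle, since
    [sup] of an unbounded set is a default value. *)
Lemma smooth_norm_sup (P : rel nat) u m t : smooth T u -> 0 <= t <= T ->
  Num.sqrt (\sum_(a < m.+1) \sum_(b < m.+1 | P a b) sqD Om a b (u t)) <=
  sup [set Num.sqrt (\sum_(a < m.+1) \sum_(b < m.+1 | P a b) sqD Om a b (u s))
      | s in [set` `[0, T]]].
Proof.
move=> su tT; apply: ub_le_sup; last by exists t => //; rewrite /= in_itv.
have H (a b : 'I_m.+1) : exists B : R, forall t, 0 <= t <= T -> sqD Om a b (u t) <= B.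
  exact: smooth_sqD_bounded.
pose B (a b : 'I_m.+1) := projT1 (cid (H a b)).
exists (Num.sqrt (\sum_(a < m.+1) \sum_(b < m.+1 | P a b) B a b)) => _ [s + <-].
rewrite /= in_itv/= => sT; apply: ler_wsqrtr.
apply: ler_sum => a _; apply: ler_sum => b _.
exact: (projT2 (cid (H a b)) s sT).
Qed.

Lemma smooth_Hnorm_sup u m t : smooth T u -> 0 <= t <= T ->
  Hnorm Om m (u t) <= sup [set Hnorm Om m (u s) | s in [set` `[0, T]]].
Proof. exact: (smooth_norm_sup (fun a b => a + b <= m)%N). Qed.

Lemma smooth_Hseminorm_sup u m t : smooth T u -> 0 <= t <= T ->
  Hseminorm Om m (u t) <= sup [set Hseminorm Om m (u s) | s in [set` `[0, T]]].
Proof. exact: (smooth_norm_sup (fun a b => a + b == m)%N). Qed.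

End Suprema.

Section Convergence.
Context {R : realType}.

Lemma cell_in (a b c : R) n (i : 'I_n) : (0 < n)%N -> a < b ->
  a + i%:R * ((b - a) / n%:R) <= c <= a + i.+1%:R * ((b - a) / n%:R) -> a <= c <= b.
Proof.
move=> n0 ab /andP[h1 h2]; have h0 : 0 <= (b - a) / n%:R.
  by rewrite divr_ge0// subr_ge0 ltW.
apply/andP; split; first by apply: le_trans h1; rewrite lerDl mulr_ge0.
have e : a + n%:R * ((b - a) / n%:R) = b.
  by rewrite mulrC divfK ?pnatr_eq0 -?lt0n// addrC subrK.
by apply: (le_trans h2); rewrite -[leRHS]e lerD2l ler_wpM2r// ler_nat.
Qed.

(* The initial error is tested against itself: u_h(0) and u(0) have the same
   moments against Q_h. *)
Lemma initial_error (Om : rect R) (N My k : nat) node lam (C1 : R)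
    (u0 v : R -> R -> R) (uh0 : broken N My) :
  (0 < N)%N -> (0 < My)%N -> @quasi_projector R k node lam ->
  (forall (w : R -> R -> R) (z : broken N My) (e : R), 0 < e -> smooth2 w ->
     cont_broken z ->
     `|ip Om (interp_error node lam Om w) z| <=
     e^-1 * C1 * ((meshsize Om N My ^+ k.+1) ^+ 2 * approx_norm k Om w)
     + e * ip Om z z) ->
  smooth2 v ->
  (forall x y, xlo Om <= x <= xhi Om -> ylo Om <= y <= yhi Om -> v x y = u0 x y) ->
  L2projection Om k u0 uh0 ->
  let th := bsub uh0 (interp2 node lam Om v) in
  ip Om th th <= 4 * C1 * ((meshsize Om N My ^+ k.+1) ^+ 2 * approx_norm k Om v).
Proof.
move=> hN hMy hP HC sv vu0 [uQ uproj] /=; set th := bsub uh0 _.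
have IQ : Qh k (@interp2 R k node lam Om N My v) by exact: Qh_interp2.
have thQ : Qh k th by exact: Qh_sub.
have cth := Qh_cont thQ.
have cv : @cont_broken R N My (fun _ _ => v) by move=> i j; exact: (smooth2_cont sv).
have e2 : 0 < 1 / 2 :> R by rewrite divr_gt0.
have := HC v th _ e2 sv cth.
have E1 : ip Om th th = ip Om uh0 th - ip Om (interp2 node lam Om v) th.
  exact: (ip_sub Om (Qh_cont uQ) (Qh_cont IQ) cth).
have E2 : ip Om (interp_error node lam Om v) th =
    ip Om (interp2 node lam Om v) th - ip Om (fun _ _ => v) th.
  exact: (ip_sub Om (Qh_cont IQ) cv cth).
have E3 : ip Om uh0 th = ip Om (fun _ _ => v) th.
  rewrite (uproj th thQ); apply: eq_ip => i j x y hx hy; split => //; apply/esym/vu0.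
  - exact: (cell_in hN (xlo_lt Om) hx).
  - exact: (cell_in hMy (ylo_lt Om) hy).
have -> : ip Om (interp_error node lam Om v) th = - ip Om th th.
  by rewrite E2 E1 E3 opprB.
rewrite normrN => h; have := le_trans (ler_norm _) h.
have -> : (1 / 2 : R)^-1 = 2 by field.
set X := _ * approx_norm _ _ _; move: (ip _ _ _) X => E X.
have -> : 2 * C1 * X = C1 * X + C1 * X by ring.
have -> : 4 * C1 * X = 2 * (C1 * X + C1 * X) by ring.
move: (C1 * X) => Y; lra.
Qed.

Lemma interp2_is_derive (Om : rect R) (N My k : nat) node lam (u : R -> R -> R -> R)
    (T t : R) (i : 'I_N) (j : 'I_My) x y : smooth T u -> 0 < t < T ->
  is_derive t (1 : R) (fun s => @interp2 R k node lam Om N My (u s) i j x y)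
    (interp2 node lam Om (dt T u t) i j x y).
Proof.
move=> su tT; apply: is_derive_big => a; apply: is_derive_big => b.
have dab := is_derive_mul (smooth_is_derive_t (xl Om i + Dx Om N * node a)
  (yl Om j + Dy Om My * node b) su tT) (is_derive_cst
  ((lam a).[(x - xl Om i) / Dx Om N] * (lam b).[(y - yl Om j) / Dy Om My]) t 1).
by apply: (is_derive_eq dab); rewrite mulr0 addr0.
Qed.

Lemma interp2_within_cont (Om : rect R) (N My k : nat) node lam
    (u : R -> R -> R -> R) (T : R) (i : 'I_N) (j : 'I_My) x y : smooth T u ->
  {within `[0, T], continuous (fun s => @interp2 R k node lam Om N My (u s) i j x y)}.
Proof.
move=> su; apply: cont_sum => a _; apply: cont_sum => b _.
by apply: contM; [exact: smooth_within_cont|exact: cont_cst].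
Qed.

(* [c0], [K] and [Kn] come from [interp_error_bound], [error_energy] and
   [solution_norms]. *)
Definition error_constant (c0 K Kn T : R) : R :=
  2 * (expR (K * T) * (12 * c0 + K * Kn * T)) + 6 * c0.

(** In [error_constant], 12 is the 4 of [initial_error] times the 3 of [approx_norm_Hseminorm], and
    6 is this 3 times the 2 from splitting the total error into two parts. *)
Lemma error_constant_bound (c0 K Kn T t S H E0 Et A0 At err tot : R) :
  0 <= c0 -> 0 <= K -> 0 <= Kn -> 0 <= t <= T -> 0 <= S -> 0 <= H ->
  A0 <= 3 * S -> At <= 3 * S ->
  E0 <= 4 * c0 * (H * A0) ->
  Et <= expR (K * t) * (E0 + K * (H * (Kn * S)) * t) ->
  err <= c0 * (H * At) ->
  tot <= 2 * Et + 2 * err ->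
  tot <= error_constant c0 K Kn T * S * H.
Proof.
move=> c00 K0 Kn0 /andP[t0 tT] S0 H0 hA0 hAt hE0 hEt herr htot.
have hE0' : E0 <= 12 * c0 * (H * S).
  apply: (le_trans hE0).
  have -> : 12 * c0 * (H * S) = 4 * c0 * (H * (3 * S)) by ring.
  by rewrite ler_wpM2l ?mulr_ge0// ler_wpM2l.
have herr' : err <= 3 * c0 * (H * S).
  apply: (le_trans herr).
  have -> : 3 * c0 * (H * S) = c0 * (H * (3 * S)) by ring.
  by rewrite ler_wpM2l// ler_wpM2l.
have hG : E0 + K * (H * (Kn * S)) * t <= (12 * c0 + K * Kn * T) * (H * S).
  have -> : (12 * c0 + K * Kn * T) * (H * S) =
      12 * c0 * (H * S) + K * (H * (Kn * S)) * T by ring.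
  by rewrite lerD// ler_wpM2l// !mulr_ge0.
have G0 : 0 <= (12 * c0 + K * Kn * T) * (H * S).
  by rewrite !mulr_ge0// addr_ge0 ?mulr_ge0// (le_trans t0).
have hexp : expR (K * t) <= expR (K * T) by rewrite ler_expR ler_wpM2l.
have hEt' : Et <= expR (K * T) * ((12 * c0 + K * Kn * T) * (H * S)).
  apply: (le_trans hEt); apply: (le_trans (ler_wpM2l (expR_ge0 _) hG)).
  exact: ler_wpM2r.
apply: (le_trans htot).
have -> : error_constant c0 K Kn T * S * H =
    2 * (expR (K * T) * ((12 * c0 + K * Kn * T) * (H * S))) + 2 * (3 * c0 * (H * S)).
  by rewrite /error_constant; move: (expR _) => X; ring.
by apply: lerD; rewrite ler_pM2l.
Qed.

Lemma dg_error (Om : rect R) (k : nat) (a0 a1 a2 : R) : (1 <= k)%N -> a2 < 0 ->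
  exists C : R -> R -> R -> R -> R,
   forall (N My : nat) (T : R) (u0 : R -> R -> R) (u : R -> R -> R -> R)
       (uh qh : R -> broken N My),
     (0 < N)%N -> (0 < My)%N -> 0 < T ->
     exact_solution T Om a0 a1 a2 u0 u ->
     smooth T u ->
     dg_solution Om k a0 a1 a2 u0 uh qh ->
     forall t, 0 <= t <= T ->
       bnorm Om (fun i j x y => uh t i j x y - u t x y) <=
       C (sup [set Hnorm Om k.+1 (dt T u s) | s in [set` `[0, T]]])
         (sup [set Hseminorm Om k.+3 (u s) | s in [set` `[0, T]]])
         (sup [set Hseminorm Om k.+1 (u s) | s in [set` `[0, T]]])
         T * meshsize Om N My ^+ k.+1.
Proof.
move=> hk ha2; have [node [lam hP]] := exists_quasi_projector (R := R) hk.
have [C1 C10 H1] := interp_error_test hk hP.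
have [C2 C20 H2] := interp_error_bound hk hP.
have [K K0 HK] := error_energy hk hP a0 a1 ha2.
have [Kn Kn0 HKn] := solution_norms a0 a1 ha2.
pose c0 := C1 + C2.
have c00 : 0 <= c0 by exact: addr_ge0.
(* All estimates concern squares, so the constant is the square root of one that is linear in the
   sum of the squared suprema. *)
exists (fun s1 s2 s3 T =>
  Num.sqrt (error_constant c0 K Kn T * (s1 ^+ 2 + s2 ^+ 2 + s3 ^+ 2))).
move=> N My T u0 u uh qh hN hMy T0 [uper u_init pde] su dg t tT.
set s1 := sup _; set s2 := sup _; set s3 := sup _.
pose S := s1 ^+ 2 + s2 ^+ 2 + s3 ^+ 2.
have S0 : 0 <= S by rewrite /S !addr_ge0 ?sqr_ge0.
have h1 s : 0 <= s <= T -> Hnorm Om k.+1 (dt T u s) ^+ 2 <= S.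
  move=> sT; apply: (@le_trans _ _ (s1 ^+ 2)).
    have hh := smooth_Hnorm_sup Om k.+1 (smooth_dt su) sT.
    by apply: lerXn2r; rewrite ?nnegrE ?sqrtr_ge0// (le_trans _ hh) ?sqrtr_ge0.
  by rewrite /S -addrA lerDl addr_ge0 ?sqr_ge0.
have h2 s : 0 <= s <= T -> Hseminorm Om k.+3 (u s) ^+ 2 <= S.
  move=> sT; apply: (@le_trans _ _ (s2 ^+ 2)).
    have hh := smooth_Hseminorm_sup Om k.+3 su sT.
    by apply: lerXn2r; rewrite ?nnegrE ?sqrtr_ge0// (le_trans _ hh) ?sqrtr_ge0.
  by rewrite /S addrAC lerDr addr_ge0 ?sqr_ge0.
have h3 s : 0 <= s <= T -> Hseminorm Om k.+1 (u s) ^+ 2 <= S.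
  move=> sT; apply: (@le_trans _ _ (s3 ^+ 2)).
    have hh := smooth_Hseminorm_sup Om k.+1 su sT.
    by apply: lerXn2r; rewrite ?nnegrE ?sqrtr_ge0// (le_trans _ hh) ?sqrtr_ge0.
  by rewrite /S lerDr addr_ge0 ?sqr_ge0.
have hA s : 0 <= s <= T -> approx_norm k Om (u s) <= 3 * S.
  move=> sT; apply: (le_trans (approx_norm_Hseminorm Om k (smooth_smooth2 su sT))).
  by rewrite ler_pM2l//; exact: h3.
pose H := (meshsize Om N My ^+ k.+1) ^+ 2.
have H0 : 0 <= H by exact: sqr_ge0.
pose P s : broken N My := interp2 node lam Om (u s).
pose th s := bsub (uh s) (P s).
pose E s := ip Om (th s) (th s).
have PQ s : Qh k (P s) by exact: Qh_interp2.
have thQ s : 0 <= s -> Qh k (th s) by move=> s0; exact: (Qh_sub (dg_Qh dg s0) (PQ s)).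
have T00 : (0 : R) <= 0 <= T by apply/andP; split => //; exact: ltW.
have hE0 : E 0 <= 4 * c0 * (H * approx_norm k Om (u 0)).
  apply: (initial_error hN hMy hP _ (smooth_smooth2 su T00) u_init (dg_init dg)).
  move=> w z e e0 sw cz; apply: (le_trans (H1 _ _ _ _ _ _ hN hMy e0 sw cz)).
  rewrite lerD2r ler_wpM2r//; first by rewrite mulr_ge0// approx_norm_ge0.
  by rewrite ler_wpM2l ?invr_ge0 ?(ltW e0)// lerDl.
pose D := K * (H * (Kn * S)).
have D0 : 0 <= D := mulr_ge0 K0 (mulr_ge0 H0 (mulr_ge0 Kn0 S0)).
pose E' s := 2 * ip Om (bsub (dg_dt uh s) (interp2 node lam Om (dt T u s))) (th s).
have hE : E t <= expR (K * t) * (E 0 + D * t).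
  apply: (@gronwall _ E E' T K D T0 _ _ _ t tT).
  - apply: (@energy_cont R k node lam hP Om N My hN hMy th T) => [s /andP[s0 _]|i j x y].
      exact: thQ.
    apply: contB; first exact: (dg_within_cont dg).
    exact: interp2_within_cont.
  - move=> s sT; have /andP[s0 _] := sT.
    have nQ : \forall r \near s, Qh k (th r).
      by apply: near_pos s0 _ => r r0; apply: thQ; exact: ltW.
    have dE i j x y : is_derive s (1 : R) (fun r => th r i j x y)
        (bsub (dg_dt uh s) (interp2 node lam Om (dt T u s)) i j x y).
      by apply: is_deriveB; [exact: (dg_is_derive dg)|exact: interp2_is_derive].
    by have [] := @energy_derive R k node lam hP Om N My hN hMy th _ s nQ dE.
  - move=> s sT; have /andP[s0 sT'] := sT.
    have sT2 : 0 <= s <= T by rewrite !ltW.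
    have nQ : \forall r \near s, Qh k (uh r) by exact: near_pos (dg_uh dg).
    have dE i j x y := dg_is_derive dg i j x y s0.
    have [_ uh'Q] := @energy_derive R k node lam hP Om N My hN hMy uh _ s nQ dE.
    have pxu : perx (xhi Om - xlo Om) (u s) by move=> x y; have [] := uper s x y sT2.
    have pyu : pery (yhi Om - ylo Om) (u s) by move=> x y; have [] := uper s x y sT2.
    have sus := smooth_smooth2 su sT2; have sut := smooth_smooth2 (smooth_dt su) sT2.
    (* The equation is given for positive times, which is enough: [gronwall] asks for the
       differential inequality in the open interval only. *)
    have pdes x y : dt T u s x y = Lop a0 a1 a2 (u s) x y.
      by apply: pde; rewrite s0 ltW.
    have hen := HK Om N My (u s) (dt T u s) (uh s) (dg_dt uh s) (qh s) hN hMy sus sut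
      pxu pyu pdes (dg_uh dg s0) uh'Q (dg_qh dg s0)
      (fun phi => dg_eq1 dg s0 (phi := phi)) (fun psi => dg_eq2 dg s0 (psi := psi)).
    apply: (le_trans hen); rewrite lerD2l.
    have hn := HKn Om k (u s) (dt T u s) S sus sut pxu pyu pdes (h1 s sT2) (h2 s sT2)
      (h3 s sT2).
    apply: (@le_trans _ _ D).
      by rewrite /D ler_wpM2l// ler_wpM2l.
    (* [gronwall] allows the source to grow like [expR (K * s)], which is at least 1. *)
    by rewrite -[leLHS]mulr1 ler_wpM2l// -expR0 ler_expR mulr_ge0// ltW.
have tT' := tT; move: tT' => /andP[t0 _].
have sut := smooth_smooth2 su tT.
have herr : ip Om (@interp_error R k node lam Om N My (u t)) (interp_error node lam Om (u t))
    <= c0 * (H * approx_norm k Om (u t)).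
  apply: (le_trans (H2 _ _ _ _ hN hMy sut)).
  by rewrite ler_wpM2r ?lerDr// mulr_ge0// approx_norm_ge0.
pose tot := ip Om (fun i j x y => uh t i j x y - u t x y)
  (fun i j x y => uh t i j x y - u t x y).
have htot : tot <= 2 * E t + 2 * ip Om (@interp_error R k node lam Om N My (u t))
    (interp_error node lam Om (u t)).
  (* The total error is [th t] plus the interpolation error of [u t]. *)
  have := ip_lin_le Om 1 1 (Qh_cont (thQ t t0))
    (@interp_error_cont R k node lam hP Om N My (u t) sut).
  rewrite /= expr1n !mulr1; apply: le_trans; apply: eq_le_refl.
  apply: eq_ip => i j x y _ _; split; rewrite !mul1r /th /bsub /interp_error /P; ring.
have hfin := error_constant_bound c00 K0 Kn0 tT S0 H0 (hA 0 T00) (hA t tT) hE0 hE herr htot.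
have h0 : 0 <= meshsize Om N My ^+ k.+1.
  by rewrite exprn_ge0// (le_trans (ltW (Dx_gt0 Om hN)) (Dx_le_mesh Om N My)).
rewrite /bnorm; apply: (le_trans (ler_wsqrtr hfin)).
rewrite mulrC sqrtrM// mulrC /H sqrtr_sqr ger0_norm//.
Qed.

End Convergence.

Theorem theorem4p2 (R : realType) (Om : rect R) (k : nat) (a0 a1 a2 : R)
    (hk : (1 <= k)%N) (ha2 : a2 < 0) :
  (forall (N My : nat) (u0 : R -> R -> R) (uh qh : R -> broken N My),
     (0 < N)%N -> (0 < My)%N -> L2 Om u0 ->
     dg_solution Om k a0 a1 a2 u0 uh qh ->
     forall t, 0 <= t ->
       bnorm Om (uh t) <=
       bnorm Om (uh 0) * expR ((a0 - a1 ^+ 2 / (4 * a2)) * t)) /\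
  (exists C : R -> R -> R -> R -> R,
   forall (N My : nat) (T : R) (u0 : R -> R -> R) (u : R -> R -> R -> R)
       (uh qh : R -> broken N My),
     (0 < N)%N -> (0 < My)%N -> 0 < T ->
     exact_solution T Om a0 a1 a2 u0 u ->
     smooth T u ->
     dg_solution Om k a0 a1 a2 u0 uh qh ->
     forall t, 0 <= t <= T ->
       bnorm Om (fun i j x y => uh t i j x y - u t x y) <=
       C (sup [set Hnorm Om k.+1 (dt T u s) | s in [set` `[0, T]]])
         (sup [set Hseminorm Om k.+3 (u s) | s in [set` `[0, T]]])
         (sup [set Hseminorm Om k.+1 (u s) | s in [set` `[0, T]]])
         T * meshsize Om N My ^+ k.+1).
Proof.
split; last exact: dg_error.
by move=> N My u0 uh qh hN hMy _ dg t t0; exact: dg_stability hk hN hMy dg t t0.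
Qed.
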